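(* Let $a_0 = 1.3145271093265$. There exists an open neighborhood $B\subset\mathbb{R}$ of $b=-0.3$ such that for every $b\in B$ there is a parameter value $a\in [a_0-10^{-5},\,a_0+10^{-5}]$ for which the Hénon map $H_{a,b}(x,y)=(a-x^2+by,\;x)$ has a quadratic homoclinic tangency, unfolding generically (with respect to the parameter $a$), for its fixed point $(x_{a,b},y_{a,b})$ given by \[ x_{a,b}=y_{a,b}=\tfrac{1}{2}\left(b-\sqrt{(b-1)^2+4a}-1\right) \] (for $a=a_0$, $b=-0.3$ this fixed point is approximately $(-1.9679632427827796,\,-1.9679632427827796)$).
   Context: The Hénon map is $H_{a,b}:\mathbb{R}^2\to\mathbb{R}^2$, $H_{a,b}(x,y)=(a-x^2+by,\,x)$, a diffeomorphism for $b\neq 0$. For the parameter values considered, the fixed point $p_{a,b}=(x_{a,b},y_{a,b})$ is a hyperbolic saddle, so it has one-dimensional stable and unstable manifolds $W^s(p_{a,b})$, $W^u(p_{a,b})$. A homoclinic tangency for $p_{a,b}$ is a point $q\neq p_{a,b}$ lying in $W^s(p_{a,b})\cap W^u(p_{a,b})$ at which the two curves are tangent (the intersection is non-transversal). The tangency is quadratic if the two curves have exactly quadratic (second-order, not higher) contact at $q$, i.e. in local coordinates in which $W^s$ near $q$ is a graph and $W^u$ near $q$ is a graph over the same tangent line, their difference has a nondegenerate (nonzero second derivative) critical point at $q$. It unfolds generically in the one-parameter family $a\mapsto H_{a,b}$ if, as $a$ varies through the tangency value, the (continuously continued) local stable and unstable manifold pieces near $q$ move relative to each other with nonzero speed, i.e.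 the signed distance between them measured along a fixed line transversal to the common tangent has nonzero derivative with respect to $a$ at the tangency parameter. *)

(* Defs.v *)
From Stdlib Require Import Reals Lra Rtopology.
Open Scope R_scope.

Definition henon (a b : R) (z : R * R) : R * R :=
  (a - (fst z) ^ 2 + b * snd z, fst z).
Definition henon_inv (a b : R) (z : R * R) : R * R :=
  (snd z, (fst z - a + (snd z) ^ 2) / b).

Definition dist2 (z w : R * R) : R :=
  sqrt ((fst z - fst w) ^ 2 + (snd z - snd w) ^ 2).

Definition fix_x (a b : R) : R := (b - sqrt ((b - 1) ^ 2 + 4 * a) - 1) / 2.
Definition pfix (a b : R) : R * R := (fix_x a b, fix_x a b).

(* g restricted to (-eps,eps) is a piece of the stable manifold W^s(p_{a,b}):
   its forward iterates converge to p_{a,b}, uniformly on the piece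
   (uniformity forces the piece to be an intrinsic arc of W^s, i.e. it is
   mapped by some H^N into the local stable manifold). *)
Definition stable_piece (a b : R) (g : R -> R * R) (eps : R) : Prop :=
  forall eta, 0 < eta -> exists N : nat, forall n : nat, (N <= n)%nat ->
    forall x, Rabs x < eps -> dist2 (Nat.iter n (henon a b) (g x)) (pfix a b) < eta.

Definition unstable_piece (a b : R) (g : R -> R * R) (eps : R) : Prop :=
  forall eta, 0 < eta -> exists N : nat, forall n : nat, (N <= n)%nat ->
    forall x, Rabs x < eps -> dist2 (Nat.iter n (henon_inv a b) (g x)) (pfix a b) < eta.

(* Point with coordinates (x,y) in the orthonormal frame at q rotated by th:
   q + x e1 + y e2, e1 = (cos th, sin th), e2 = (- sin th, cos th). *)
Definition frame_pt (q : R * R) (th x y : R) : R * R :=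
  (fst q + x * cos th - y * sin th, snd q + x * sin th + y * cos th).

Definition twice_deriv_at (f : R -> R) (x0 d1 d2 : R) : Prop :=
  exists r, 0 < r /\ exists f' : R -> R,
    (forall x, Rabs (x - x0) < r -> derivable_pt_lim f x (f' x)) /\
    f' x0 = d1 /\ derivable_pt_lim f' x0 d2.

Definition jointly_continuous (f : R -> R -> R) (a0 del eps : R) : Prop :=
  forall a x, Rabs (a - a0) < del -> Rabs x < eps ->
  forall eta, 0 < eta -> exists rho, 0 < rho /\
    forall a' x', Rabs (a' - a0) < del -> Rabs x' < eps ->
      Rabs (a' - a) < rho -> Rabs (x' - x) < rho ->
      Rabs (f a' x' - f a x) < eta.

(* H_{a0,b} has a quadratic homoclinic tangency for p_{a0,b}, unfolding
   generically in the family a |-> H_{a,b}: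
   - in a fixed orthonormal frame (q; e1, e2), for all a near a0, W^s(p_{a,b})
     and W^u(p_{a,b}) near q contain the graphs x |-> fs a x, x |-> fu a x
     over the e1-axis, depending continuously on (a,x) (the continuation);
   - at a = a0 both graphs pass through q <> p_{a0,b} (fs a0 0 = fu a0 0 = 0)
     with horizontal tangent (tangency), and (fu - fs)'' (0) <> 0 (quadratic);
   - the signed distance fu a 0 - fs a 0 measured along the line q + R e2,
     transversal to the common tangent, has nonzero derivative at a = a0. *)
Definition quadratic_tangency_generic_unfolding (a0 b : R) : Prop :=
  exists (q : R * R) (th eps del : R) (fs fu : R -> R -> R),
    0 < eps /\ 0 < del /\ q <> pfix a0 b /\
    (forall a, Rabs (a - a0) < del ->
       stable_piece a b (fun x => frame_pt q th x (fs a x)) eps /\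
       unstable_piece a b (fun x => frame_pt q th x (fu a x)) eps) /\
    jointly_continuous fs a0 del eps /\ jointly_continuous fu a0 del eps /\
    fs a0 0 = 0 /\ fu a0 0 = 0 /\
    (exists ds du : R,
       twice_deriv_at (fs a0) 0 0 ds /\ twice_deriv_at (fu a0) 0 0 du /\
       du - ds <> 0) /\
    (exists v : R, derivable_pt_lim (fun a => fu a 0 - fs a 0) a0 v /\ v <> 0).

Definition a_0 : R := 13145271093265 / 10000000000000.

(* Main.v *)
Require Import Defs.
From Stdlib Require Import Reals Rtopology.
From Stdlib Require Import Lra Lia ZArith List Ranalysis5 ClassicalEpsilon.
From Coquelicot Require Import Coquelicot.
Open Scope R_scope.

(* Let lambda > 1 > mu be the multipliers of the saddle, so that lambda mu = - b. For nu either
   of them, the corresponding invariant manifold is parametrized by an entire function X with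
   X(nu t) = a - X(t)^2 + b X(t/nu), through t |-> (X(t), X(t/nu)), and the Henon map acts on it by
   t |-> nu t; so uniform convergence of the iterates on arcs is immediate. The Taylor
   coefficients are rational functions of nu and b and decay superexponentially. Near the tangency
   both manifolds are graphs x = hu(y), x = hs(y). On a tiny box around the numerical solution,
   hu - hs is strictly concave in y and its maximum over y changes sign as lambda varies, which
   gives the tangency; strict concavity and monotonicity in lambda give that it is quadratic and
   unfolds generically. The finitely many inequalities needed, uniformly for b in an interval
   around -3/10, are checked by interval arithmetic on the series truncated at degree 20. *)

(** Taking the unstable multiplier lambda as parameter in place of a removes all square roots: the
    fixed point, a and the Taylor coefficients are rational in lambda and beta = - b. As the stable
    multiplier is beta / lambda, one recursion and one evaluator serve both manifolds, and interval
    arithmetic with field operations suffices. The obstacle is that hu - hs and its y-derivative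
    both vanish at the tangency, so the sign of neither can be decided on a box around it. Only
    quantities with a definite sign or a crude bound are therefore enclosed on the box: the second
    derivative, the lambda-derivative and the size of the slope difference. The sign of the slope
    difference is taken at two values of y; that of hu - hs at two fixed values of lambda and a
    single y, whence the mean value theorem carries it to the maximum over y. The box has width
    about 4e-12 in lambda and 4e-8 in y. The two fixed values of lambda are 2e-12 apart, and b
    varies by about 1e-16 to either side, little enough not to blur the sign there. Finally lambda
    has positive derivative in a, which turns the statements about lambda into statements about
    a. *)

(** * Calculus of two variables and fibrewise inverses *)

Lemma continuity_2d_pt_comp (f g h : R -> R -> R) x y :
  continuity_2d_pt f (g x y) (h x y) ->
  continuity_2d_pt g x y -> continuity_2d_pt h x y ->
  continuity_2d_pt (fun u v => f (g u v) (h u v)) x y.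
Proof.
intros Hf Hg Hh eps.
destruct (Hf eps) as [d Hd].
destruct (Hg d) as [dg Hdg]. destruct (Hh d) as [dh Hdh].
assert (Hm : 0 < Rmin dg dh) by (apply Rmin_pos; apply cond_pos).
exists (mkposreal _ Hm); simpl; intros u v Hu Hv.
pose proof (Rmin_l dg dh). pose proof (Rmin_r dg dh).
apply Hd; [apply Hdg | apply Hdh]; lra.
Qed.

(** Continuity of one partial is enough: the increment in the second variable is handled by the mean
    value theorem, that in the first by the derivative at the point itself. This suits families of
    power series, where no continuity of the parameter derivative is established. *)
Lemma differentiable_pt_lim_of_partials (f fy : R -> R -> R) x y l :
  locally_2d (fun u v => is_derive (f u) v (fy u v)) x y ->
  continuity_2d_pt fy x y ->
  is_derive (fun u => f u y) x l ->
  differentiable_pt_lim f x y l (fy x y).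
Proof.
intros [d1 Hd1] Hc Hx eps.
assert (He2 : 0 < eps / 2) by (pose proof (cond_pos eps); lra).
destruct (Hc (mkposreal _ He2)) as [d2 Hd2]; simpl in Hd2.
apply is_derive_Reals in Hx.
destruct (Hx (eps / 2) He2) as [d3 Hd3].
assert (Hm : 0 < Rmin d1 (Rmin d2 d3)) by (repeat apply Rmin_pos; apply cond_pos).
exists (mkposreal _ Hm); simpl; intros u v Hu Hv.
pose proof (Rmin_l d1 (Rmin d2 d3)). pose proof (Rmin_r d1 (Rmin d2 d3)).
pose proof (Rmin_l d2 d3). pose proof (Rmin_r d2 d3).
assert (A : forall w, Rmin y v <= w <= Rmax y v -> Rabs (w - y) < d1 /\ Rabs (w - y) < d2).
{ intros w [Hw1 Hw2].
  assert (Rabs (w - y) <= Rabs (v - y)).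
  { unfold Rmin, Rmax in *. destruct (Rle_dec y v); unfold Rabs;
    destruct (Rcase_abs (w - y)); destruct (Rcase_abs (v - y)); lra. }
  lra. }
destruct (MVT_gen (f u) y v (fy u)) as [c [Hc1 Hc2]].
- intros w Hw. apply Hd1. lra. apply A. lra.
- intros w Hw. apply derivable_continuous_pt. exists (fy u w). apply is_derive_Reals.
  apply Hd1. lra. apply A; lra.
- destruct (A c Hc1) as [_ Hc3].
  assert (B1 : Rabs (fy u c - fy x y) < eps / 2) by (apply Hd2; lra).
  assert (B2 : Rabs (f u y - f x y - l * (u - x)) <= eps / 2 * Rabs (u - x)).
  { destruct (Req_dec u x) as [->|Hne].
    - replace (f x y - f x y - l * (x - x)) with 0 by ring.
      replace (x - x) with 0 by ring. rewrite Rabs_R0. lra.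
    - assert (Hh : u - x <> 0) by lra.
      assert (K := Hd3 (u - x) Hh ltac:(lra)).
      replace (x + (u - x)) with u in K by ring.
      replace (f u y - f x y - l * (u - x)) with
        (((f u y - f x y) / (u - x) - l) * (u - x)) by (field; lra).
      rewrite Rabs_mult. apply Rmult_le_compat_r. apply Rabs_pos. lra. }
  replace (f u v - f x y - (l * (u - x) + fy x y * (v - y))) with
    ((f u y - f x y - l * (u - x)) + (fy u c - fy x y) * (v - y))
    by (replace (f u v) with (f u y + fy u c * (v - y)) by lra; ring).
  eapply Rle_trans. apply Rabs_triang. rewrite (Rabs_mult (fy u c - _)).
  pose proof (Rmax_l (Rabs (u - x)) (Rabs (v - y))).
  pose proof (Rmax_r (Rabs (u - x)) (Rabs (v - y))).
  pose proof (Rabs_pos (u - x)). pose proof (Rabs_pos (v - y)).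
  pose proof (Rabs_pos (fy u c - fy x y)).
  set (M := Rmax (Rabs (u - x)) (Rabs (v - y))) in *. pose proof (cond_pos eps).
  assert (Rabs (fy u c - fy x y) * Rabs (v - y) <= eps / 2 * M)
    by (apply Rmult_le_compat; lra).
  assert (eps / 2 * Rabs (u - x) <= eps / 2 * M) by (apply Rmult_le_compat_l; lra).
  lra.
Qed.

Lemma differentiable_pt_lim_continuity f x y lx ly :
  differentiable_pt_lim f x y lx ly -> continuity_2d_pt f x y.
Proof.
intros H. apply differentiable_continuity_pt. exists lx, ly. exact H.
Qed.

Lemma differentiable_pt_lim_is_derive_snd f x y lx ly :
  differentiable_pt_lim f x y lx ly -> is_derive (f x) y ly.
Proof.
intros H. apply is_derive_Reals.
replace ly with (lx * 0 + ly * 1) by ring.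
apply (derivable_pt_lim_comp_2d f (fun _ => x) (fun t => t) y lx ly 0 1); auto.
apply derivable_pt_lim_const. apply derivable_pt_lim_id.
Qed.

Lemma differentiable_pt_lim_is_derive_fst f x y lx ly :
  differentiable_pt_lim f x y lx ly -> is_derive (fun u => f u y) x lx.
Proof.
intros H. apply is_derive_Reals.
replace lx with (lx * 1 + ly * 0) by ring.
apply (derivable_pt_lim_comp_2d f (fun t => t) (fun _ => y) x lx ly 1 0); auto.
apply derivable_pt_lim_id. apply derivable_pt_lim_const.
Qed.

Lemma is_derive_continuity_pt (f : R -> R) x l : is_derive f x l -> continuity_pt f x.
Proof.
intros H. apply derivable_continuous_pt. exists l. apply is_derive_Reals, H.
Qed.

Lemma is_derive_pos_increasing (f df : R -> R) a b :
  (forall x, a < x < b -> is_derive f x (df x)) ->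
  (forall x, a < x < b -> 0 < df x) ->
  forall x y, a < x -> x < y -> y < b -> f x < f y.
Proof.
intros Hd Hp x y Hx Hxy Hy.
destruct (MVT_gen f x y df) as [c [Hc1 Hc2]].
- rewrite Rmin_left, Rmax_right by lra. intros z Hz. apply Hd. lra.
- rewrite Rmin_left, Rmax_right by lra. intros z Hz.
  apply (is_derive_continuity_pt _ _ (df z)), Hd. lra.
- rewrite Rmin_left, Rmax_right in Hc1 by lra.
  assert (0 < df c * (y - x)) by (apply Rmult_lt_0_compat; [apply Hp|]; lra). lra.
Qed.

(** Inverse of [phi x] on [(j1, j2)], chosen by [epsilon] so that it is a total function of [x] and
    [y]; its value is arbitrary where [y] is not attained. *)
Definition fiber_inverse (phi : R -> R -> R) (j1 j2 x y : R) : R :=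
  epsilon (inhabits 0) (fun z => j1 < z < j2 /\ phi x z = y).

Section FiberInverse.

Variables (i1 i2 j1 j2 y1 y2 : R) (phi phi2 : R -> R -> R).
Hypothesis phi_cont :
  forall x z, i1 < x < i2 -> j1 < z < j2 -> continuity_2d_pt phi x z.
Hypothesis phi_derive :
  forall x z, i1 < x < i2 -> j1 < z < j2 -> is_derive (phi x) z (phi2 x z).
Hypothesis phi2_pos : forall x z, i1 < x < i2 -> j1 < z < j2 -> 0 < phi2 x z.
Hypothesis phi_onto :
  forall x y, i1 < x < i2 -> y1 < y < y2 -> exists z, j1 < z < j2 /\ phi x z = y.

Let Z := fiber_inverse phi j1 j2.

Lemma fiber_inverse_spec x y :
  i1 < x < i2 -> y1 < y < y2 -> j1 < Z x y < j2 /\ phi x (Z x y) = y.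
Proof.
intros Hx Hy. unfold Z, fiber_inverse.
apply (epsilon_spec (inhabits 0) (fun z => j1 < z < j2 /\ phi x z = y)).
apply phi_onto; assumption.
Qed.

Lemma fiber_increasing x z z' :
  i1 < x < i2 -> j1 < z -> z < z' -> z' < j2 -> phi x z < phi x z'.
Proof.
intros Hx. apply (is_derive_pos_increasing (phi x) (phi2 x) j1 j2); auto.
Qed.

Lemma fiber_inverse_between x y a b :
  i1 < x < i2 -> y1 < y < y2 -> j1 < a < j2 -> j1 < b < j2 ->
  phi x a < y < phi x b -> a < Z x y < b.
Proof.
intros Hx Hy Ha Hb H. destruct (fiber_inverse_spec x y Hx Hy) as [Hz He]. split.
- apply Rnot_le_lt. intros [K|K].
  + pose proof (fiber_increasing x (Z x y) a Hx ltac:(lra) K ltac:(lra)). lra.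
  + rewrite <- K in H. lra.
- apply Rnot_le_lt. intros [K|K].
  + pose proof (fiber_increasing x b (Z x y) Hx ltac:(lra) K ltac:(lra)). lra.
  + rewrite K in H. lra.
Qed.

Lemma fiber_inverse_unique x y z :
  i1 < x < i2 -> y1 < y < y2 -> j1 < z < j2 -> phi x z = y -> Z x y = z.
Proof.
intros Hx Hy Hz E. destruct (fiber_inverse_spec x y Hx Hy) as [Hz' He].
destruct (Rtotal_order (Z x y) z) as [K|[K|K]]; auto.
- pose proof (fiber_increasing x (Z x y) z Hx ltac:(lra) K ltac:(lra)). lra.
- pose proof (fiber_increasing x z (Z x y) Hx ltac:(lra) K ltac:(lra)). lra.
Qed.

(** By monotonicity [y] lies strictly between [phi x (z - e)] and [phi x (z + e)]. Continuity of
    [phi] at these two points preserves this for nearby [(x, y)], which traps the inverse within [e]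
    of [z]. *)
Lemma fiber_inverse_continuity x y :
  i1 < x < i2 -> y1 < y < y2 -> continuity_2d_pt Z x y.
Proof.
intros Hx Hy eps. destruct (fiber_inverse_spec x y Hx Hy) as [Hz He].
set (z := Z x y) in *.
set (e := Rmin (eps / 2) (Rmin ((z - j1) / 2) ((j2 - z) / 2))).
assert (e1 : e <= eps / 2) by apply Rmin_l.
assert (e2 : e <= (z - j1) / 2) by (eapply Rle_trans; [apply Rmin_r | apply Rmin_l]).
assert (e3 : e <= (j2 - z) / 2) by (eapply Rle_trans; [apply Rmin_r | apply Rmin_r]).
pose proof (cond_pos eps) as Hep.
assert (e0 : 0 < e) by (unfold e; repeat apply Rmin_pos; lra).
assert (L : phi x (z - e) < y) by (rewrite <- He; apply fiber_increasing; lra).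
assert (U : y < phi x (z + e)) by (rewrite <- He; apply fiber_increasing; lra).
set (d := Rmin ((y - phi x (z - e)) / 2) ((phi x (z + e) - y) / 2)).
assert (d1 : d <= (y - phi x (z - e)) / 2) by apply Rmin_l.
assert (d2 : d <= (phi x (z + e) - y) / 2) by apply Rmin_r.
assert (d0 : 0 < d) by (unfold d; repeat apply Rmin_pos; lra).
destruct (phi_cont x (z - e) Hx ltac:(lra) (mkposreal d d0)) as [ra Hra]; simpl in Hra.
destruct (phi_cont x (z + e) Hx ltac:(lra) (mkposreal d d0)) as [rb Hrb]; simpl in Hrb.
set (r := Rmin (Rmin ra rb) (Rmin d (Rmin (Rmin (x - i1) (i2 - x)) (Rmin (y - y1) (y2 - y))))).
assert (r0 : 0 < r) by (unfold r; repeat apply Rmin_pos; try apply cond_pos; lra).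
assert (Hr : r <= ra /\ r <= rb /\ r <= d /\ r <= x - i1 /\ r <= i2 - x /\ r <= y - y1 /\ r <= y2 - y).
{ unfold r. repeat split;
  repeat (apply Rle_refl || (eapply Rle_trans; [apply Rmin_l|]; apply Rle_refl) ||
   (eapply Rle_trans; [apply Rmin_l|]; apply Rmin_l) ||
   (eapply Rle_trans; [apply Rmin_l|]; apply Rmin_r) || (eapply Rle_trans; [apply Rmin_r|])). }
exists (mkposreal r r0); simpl. intros u v Hu Hv.
assert (A1 := Hra u (z - e) ltac:(lra) ltac:(rewrite Rminus_diag, Rabs_R0; apply cond_pos)).
assert (A2 := Hrb u (z + e) ltac:(lra) ltac:(rewrite Rminus_diag, Rabs_R0; apply cond_pos)).
apply Rabs_lt_between in Hu. apply Rabs_lt_between in Hv.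
apply Rabs_lt_between in A1. apply Rabs_lt_between in A2.
assert (B : z - e < Z u v < z + e) by (apply fiber_inverse_between; lra).
apply Rabs_lt_between. lra.
Qed.

(** Implicit differentiation. The inverse is first shown to satisfy a Lipschitz estimate at the
    point, so that the remainder of [phi], small relative to [|dx| + |dz|], is also small relative
    to [|dx| + |dy|]. *)
Lemma fiber_inverse_differentiable x y p1 :
  i1 < x < i2 -> y1 < y < y2 ->
  differentiable_pt_lim phi x (Z x y) p1 (phi2 x (Z x y)) ->
  differentiable_pt_lim Z x y (- p1 / phi2 x (Z x y)) (/ phi2 x (Z x y)).
Proof.
intros Hx Hy Hd eps. destruct (fiber_inverse_spec x y Hx Hy) as [Hz He].
set (z := Z x y) in *. set (B := phi2 x z) in *.
assert (HB : 0 < B) by (apply phi2_pos; auto).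
pose proof (cond_pos eps) as Hep. pose proof (Rabs_pos p1) as Hp1.
(* [C] is the Lipschitz constant obtained by solving [B |dz| <= |dy| + |p1| |dx| + B/2 (|dx| +
   |dz|)] for [|dz|]. *)
set (C := 2 / B * (1 + Rabs p1 + B / 2)).
assert (HC : 0 < C).
{ unfold C. apply Rmult_lt_0_compat; [apply Rdiv_lt_0_compat|]; lra. }
(* The bound [B / 2] lets the error in [|dz|] be absorbed on the left; the other one leaves exactly
   [eps * M] after division by [B]. *)
set (e := Rmin (B / 2) (eps * B / (1 + C))).
assert (e1 : e <= B / 2) by apply Rmin_l.
assert (e2 : e <= eps * B / (1 + C)) by apply Rmin_r.
assert (e0 : 0 < e).
{ unfold e; apply Rmin_pos. lra. apply Rdiv_lt_0_compat; [apply Rmult_lt_0_compat|]; lra. }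
destruct (Hd (mkposreal e e0)) as [d Hdd]; simpl in Hdd.
destruct (fiber_inverse_continuity x y Hx Hy d) as [r Hr].
set (rr := Rmin (Rmin d r) (Rmin (Rmin (x - i1) (i2 - x)) (Rmin (y - y1) (y2 - y)))).
assert (r0 : 0 < rr) by (unfold rr; repeat apply Rmin_pos; try apply cond_pos; lra).
assert (Hrr : rr <= d /\ rr <= r /\ rr <= x - i1 /\ rr <= i2 - x /\ rr <= y - y1 /\ rr <= y2 - y).
{ unfold rr. repeat split;
  repeat (apply Rle_refl || (eapply Rle_trans; [apply Rmin_l|]; apply Rle_refl) ||
   (eapply Rle_trans; [apply Rmin_l|]; apply Rmin_l) ||
   (eapply Rle_trans; [apply Rmin_l|]; apply Rmin_r) || (eapply Rle_trans; [apply Rmin_r|])). }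
exists (mkposreal rr r0); simpl. intros u v Hu Hv.
assert (K := Hdd u (Z u v) ltac:(lra) ltac:(apply Hr; lra)).
assert (Hub : i1 < u < i2) by (apply Rabs_lt_between in Hu; lra).
assert (Hvb : y1 < v < y2) by (apply Rabs_lt_between in Hv; lra).
destruct (fiber_inverse_spec u v Hub Hvb) as [_ Ev].
rewrite Ev, He in K. fold z.
set (dz := Z u v - z) in *. set (dx := u - x) in *. set (dy := v - y) in *.
pose proof (Rmax_l (Rabs dx) (Rabs dy)). pose proof (Rmax_r (Rabs dx) (Rabs dy)).
set (M := Rmax (Rabs dx) (Rabs dy)) in *.
pose proof (Rabs_pos dx). pose proof (Rabs_pos dy). pose proof (Rabs_pos dz).
assert (K' : Rabs (dy - (p1 * dx + B * dz)) <= e * (Rabs dx + Rabs dz)).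
{ eapply Rle_trans. exact K. apply Rmult_le_compat_l. lra. apply Rmax_lub; lra. }
assert (T : B * Rabs dz <= Rabs dy + Rabs p1 * Rabs dx + Rabs (dy - (p1 * dx + B * dz))).
{ rewrite <- (Rabs_pos_eq B) at 1 by lra. rewrite <- !Rabs_mult.
  replace (B * dz) with (dy - p1 * dx - (dy - (p1 * dx + B * dz))) at 1 by ring.
  unfold Rminus at 1. eapply Rle_trans. apply Rabs_triang. rewrite Rabs_Ropp.
  apply Rplus_le_compat_r. unfold Rminus. eapply Rle_trans. apply Rabs_triang.
  rewrite Rabs_Ropp. lra. }
assert (T2 : e * (Rabs dx + Rabs dz) <= B / 2 * (Rabs dx + Rabs dz))
  by (apply Rmult_le_compat_r; lra).
assert (T3 : Rabs p1 * Rabs dx <= Rabs p1 * M) by (apply Rmult_le_compat_l; lra).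
assert (T4 : B / 2 * Rabs dx <= B / 2 * M) by (apply Rmult_le_compat_l; lra).
assert (T5 : Rabs dz <= C * M).
{ unfold C. apply (Rmult_le_reg_l (B / 2)). lra.
  replace (B / 2 * (2 / B * (1 + Rabs p1 + B / 2) * M)) with ((1 + Rabs p1 + B / 2) * M)
    by (field; lra). lra. }
replace (dz - (- p1 / B * dx + / B * dy)) with (- / B * (dy - (p1 * dx + B * dz)))
  by (field; lra).
rewrite Rabs_mult, Rabs_Ropp, Rabs_inv, (Rabs_pos_eq B) by lra.
apply (Rmult_le_reg_l B). lra. rewrite <- Rmult_assoc, Rinv_r, Rmult_1_l by lra.
eapply Rle_trans. exact K'.
apply Rle_trans with (e * ((1 + C) * M)). apply Rmult_le_compat_l; lra.
apply Rle_trans with (eps * B / (1 + C) * ((1 + C) * M)).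
- apply Rmult_le_compat_r. apply Rmult_le_pos; lra. lra.
- right. field. lra.
Qed.

End FiberInverse.

(** * Tangencies of families of graphs *)

(** The regularity a tangency asks for: joint differentiability for the unfolding speed, a
    continuous fibre derivative [f2] to invert fibrewise and to follow critical points, and a
    pointwise second fibre derivative for the quadratic contact. *)
Definition fiberwise_C2 (i1 i2 j1 j2 : R) (f f1 f2 f22 : R -> R -> R) : Prop :=
  forall x y, i1 < x < i2 -> j1 < y < j2 ->
    differentiable_pt_lim f x y (f1 x y) (f2 x y) /\
    continuity_2d_pt f2 x y /\ is_derive (f2 x) y (f22 x y).

Lemma fiberwise_C2_restrict i1 i2 j1 j2 i1' i2' j1' j2' f f1 f2 f22 :
  i1 <= i1' -> i2' <= i2 -> j1 <= j1' -> j2' <= j2 ->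
  fiberwise_C2 i1 i2 j1 j2 f f1 f2 f22 -> fiberwise_C2 i1' i2' j1' j2' f f1 f2 f22.
Proof. intros H1 H2 H3 H4 H x y Hx Hy. apply H; lra. Qed.

(** The curves [z |-> (c x z, phi x z)] become graphs over their second coordinate. The formulas are
    the chain rule with [Z] having partials [- phi1 / phi2] and [1 / phi2]. *)
Lemma fiberwise_C2_graph i1 i2 j1 j2 y1 y2 phi phi1 phi2 phi22 c c1 c2 c22 :
  fiberwise_C2 i1 i2 j1 j2 phi phi1 phi2 phi22 ->
  fiberwise_C2 i1 i2 j1 j2 c c1 c2 c22 ->
  (forall x z, i1 < x < i2 -> j1 < z < j2 -> 0 < phi2 x z) ->
  (forall x y, i1 < x < i2 -> y1 < y < y2 -> exists z, j1 < z < j2 /\ phi x z = y) ->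
  let Z := fiber_inverse phi j1 j2 in
  fiberwise_C2 i1 i2 y1 y2 (fun x y => c x (Z x y))
    (fun x y => c1 x (Z x y) - c2 x (Z x y) * phi1 x (Z x y) / phi2 x (Z x y))
    (fun x y => c2 x (Z x y) / phi2 x (Z x y))
    (fun x y => (c22 x (Z x y) * phi2 x (Z x y) - c2 x (Z x y) * phi22 x (Z x y))
                / phi2 x (Z x y) ^ 3).
Proof.
intros Hphi Hc Hpos Honto Z x y Hx Hy.
assert (HC : forall x z, i1 < x < i2 -> j1 < z < j2 -> continuity_2d_pt phi x z).
{ intros u z Hu Hz. eapply differentiable_pt_lim_continuity. apply (Hphi u z Hu Hz). }
assert (HD : forall x z, i1 < x < i2 -> j1 < z < j2 -> is_derive (phi x) z (phi2 x z)).
{ intros u z Hu Hz. eapply differentiable_pt_lim_is_derive_snd. apply (Hphi u z Hu Hz). }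
destruct (fiber_inverse_spec i1 i2 j1 j2 y1 y2 phi Honto x y Hx Hy) as [Hz He].
fold Z in Hz, He.
destruct (Hphi x (Z x y) Hx Hz) as [P1 [P2 P3]].
destruct (Hc x (Z x y) Hx Hz) as [C1 [C2 C3]].
assert (P0 := Hpos x (Z x y) Hx Hz).
assert (ZC := fiber_inverse_continuity i1 i2 j1 j2 y1 y2 phi phi2 HC HD Hpos Honto x y Hx Hy).
assert (ZD := fiber_inverse_differentiable i1 i2 j1 j2 y1 y2 phi phi2 HC HD Hpos Honto
  x y _ Hx Hy P1).
fold Z in ZC, ZD.
assert (Zy := differentiable_pt_lim_is_derive_snd _ _ _ _ _ ZD).
split; [|split].
- assert (Id : differentiable_pt_lim (fun u _ => u) x y 1 0)
    by (apply (differentiable_pt_lim_proj1_0 (fun u => u)), derivable_pt_lim_id).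
  pose proof (differentiable_pt_lim_comp c (fun u _ => u) Z x y _ _ _ _ _ _ C1 Id ZD) as K.
  match type of K with differentiable_pt_lim _ _ _ ?p ?q =>
    replace (c1 x (Z x y) - c2 x (Z x y) * phi1 x (Z x y) / phi2 x (Z x y)) with p
      by (field; lra);
    replace (c2 x (Z x y) / phi2 x (Z x y)) with q by (field; lra) end.
  exact K.
- apply (continuity_2d_pt_mult (fun u v => c2 u (Z u v)) (fun u v => / phi2 u (Z u v))).
  + apply continuity_2d_pt_comp; auto. apply continuity_2d_pt_id1.
  + apply continuity_2d_pt_inv; [|lra].
    apply continuity_2d_pt_comp; auto. apply continuity_2d_pt_id1.
- assert (D1 := is_derive_comp (c2 x) (Z x) y _ _ C3 Zy).
  assert (D2 := is_derive_comp (phi2 x) (Z x) y _ _ P3 Zy).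
  assert (D3 := is_derive_div _ _ y _ _ D1 D2 ltac:(lra)).
  match type of D3 with is_derive _ _ ?p =>
    replace ((c22 x (Z x y) * phi2 x (Z x y) - c2 x (Z x y) * phi22 x (Z x y))
                / phi2 x (Z x y) ^ 3) with p end.
  + exact D3.
  + unfold scal; simpl; unfold mult; simpl. field. lra.
Qed.

Lemma IVT_open (f : R -> R) p q y :
  p < q -> (forall z, p <= z <= q -> continuity_pt f z) -> f p < y < f q ->
  exists z, p < z < q /\ f z = y.
Proof.
intros Hpq Hc Hy.
destruct (IVT_interv (fun z => f z - y) p q) as [z [Hz E]].
- intros a Ha. apply continuity_pt_minus. apply Hc, Ha.
  apply continuity_pt_const. intros ? ?. reflexivity.
- exact Hpq.
- lra.
- lra.
- exists z. split; [|lra].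
  destruct Hz as [[Hz1|<-] [Hz2|Hz2]]; try lra; subst; lra.
Qed.

(* The maximum of [g l] over the fibre is attained at the zero of [g2 l],
   which depends continuously on [l]; the tangency parameter is a zero of the maximum. *)
Lemma fold_tangency_exists i1 i2 y1 y2 la lb ya yb yc G g g1 g2 g22 :
  fiberwise_C2 i1 i2 y1 y2 g g1 g2 g22 ->
  i1 < la -> la < lb -> lb < i2 -> y1 < ya -> ya <= yc <= yb -> ya < yb -> yb < y2 ->
  (forall l y, i1 < l < i2 -> y1 < y < y2 -> g22 l y < 0) ->
  (forall l y, i1 < l < i2 -> y1 < y < y2 -> Rabs (g2 l y) <= G) ->
  (forall l, i1 < l < i2 -> 0 < g2 l ya) ->
  (forall l, i1 < l < i2 -> g2 l yb < 0) ->
  g la yc + G * (yb - ya) < 0 -> 0 < g lb yc - G * (yb - ya) ->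
  exists l y, la <= l <= lb /\ ya < y < yb /\ g l y = 0 /\ g2 l y = 0.
Proof.
intros Hg H1 H2 H3 H4 H5 H6 H7 Hneg HG Hya Hyb Hla Hlb.
set (phi := fun l y => - g2 l y).
assert (PC : forall x z, i1 < x < i2 -> ya < z < yb -> continuity_2d_pt phi x z).
{ intros x z Hx Hz. apply continuity_2d_pt_opp. apply Hg; lra. }
assert (PD : forall x z, i1 < x < i2 -> ya < z < yb -> is_derive (phi x) z (- g22 x z)).
{ intros x z Hx Hz. apply @is_derive_opp. apply Hg; lra. }
assert (PP : forall x z, i1 < x < i2 -> ya < z < yb -> 0 < - g22 x z).
{ intros x z Hx Hz. specialize (Hneg x z Hx ltac:(lra)). lra. }
assert (PO : forall x, i1 < x < i2 -> exists z, ya < z < yb /\ phi x z = 0).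
{ intros x Hx. apply (IVT_open (phi x)); auto.
  - intros z Hz. eapply is_derive_continuity_pt. apply @is_derive_opp. apply Hg; lra.
  - unfold phi. specialize (Hya x Hx). specialize (Hyb x Hx). lra. }
set (Y := fun l => fiber_inverse phi ya yb l 0).
assert (YS : forall l, i1 < l < i2 -> ya < Y l < yb /\ phi l (Y l) = 0).
{ intros l Hl. unfold Y, fiber_inverse.
  apply (epsilon_spec (inhabits 0) (fun z => ya < z < yb /\ phi l z = 0)).
  apply PO, Hl. }
assert (gC : forall x y, i1 < x < i2 -> y1 < y < y2 -> continuity_2d_pt g x y).
{ intros x y Hx Hy. eapply differentiable_pt_lim_continuity. apply Hg; auto. }
(* [fiber_inverse_continuity] asks for a whole interval of attained values, whereas only the value 0
   is known to be attained on every fibre; the bracketing argument is therefore repeated for this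
   value. *)
assert (YC : forall l, i1 < l < i2 -> continuity_pt Y l).
{ intros l Hl eps Heps. destruct (YS l Hl) as [Hy E].
  set (e := Rmin (eps / 2) (Rmin ((Y l - ya) / 2) ((yb - Y l) / 2))).
  assert (e1 : e <= eps / 2) by apply Rmin_l.
  assert (e2 : e <= (Y l - ya) / 2) by (eapply Rle_trans; [apply Rmin_r | apply Rmin_l]).
  assert (e3 : e <= (yb - Y l) / 2) by (eapply Rle_trans; [apply Rmin_r | apply Rmin_r]).
  assert (e0 : 0 < e) by (unfold e; repeat apply Rmin_pos; lra).
  assert (inc : forall x z z', i1 < x < i2 -> ya < z -> z < z' -> z' < yb -> phi x z < phi x z').
  { intros x z z' Hx. apply (is_derive_pos_increasing (phi x) (fun z => - g22 x z) ya yb); auto. }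
  assert (L := inc l (Y l - e) (Y l) Hl ltac:(lra) ltac:(lra) ltac:(lra)).
  assert (U := inc l (Y l) (Y l + e) Hl ltac:(lra) ltac:(lra) ltac:(lra)).
  set (d := Rmin (- phi l (Y l - e)) (phi l (Y l + e))).
  assert (d1 : d <= - phi l (Y l - e)) by apply Rmin_l.
  assert (d2 : d <= phi l (Y l + e)) by apply Rmin_r.
  assert (d0 : 0 < d) by (unfold d; apply Rmin_pos; lra).
  destruct (PC l (Y l - e) Hl ltac:(lra) (mkposreal d d0)) as [ra Hra]; simpl in Hra.
  destruct (PC l (Y l + e) Hl ltac:(lra) (mkposreal d d0)) as [rb Hrb]; simpl in Hrb.
  exists (Rmin (Rmin ra rb) (Rmin (l - i1) (i2 - l))).
  split. repeat apply Rmin_pos; try apply cond_pos; lra.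
  intros u [_ Hu]. simpl in *. unfold Rdist in *.
  pose proof (Rmin_l (Rmin ra rb) (Rmin (l - i1) (i2 - l))).
  pose proof (Rmin_r (Rmin ra rb) (Rmin (l - i1) (i2 - l))).
  pose proof (Rmin_l ra rb). pose proof (Rmin_r ra rb).
  pose proof (Rmin_l (l - i1) (i2 - l)). pose proof (Rmin_r (l - i1) (i2 - l)).
  assert (A1 := Hra u (Y l - e) ltac:(lra) ltac:(rewrite Rminus_diag, Rabs_R0; apply cond_pos)).
  assert (A2 := Hrb u (Y l + e) ltac:(lra) ltac:(rewrite Rminus_diag, Rabs_R0; apply cond_pos)).
  apply Rabs_lt_between in Hu.
  apply Rabs_lt_between in A1. apply Rabs_lt_between in A2.
  destruct (YS u ltac:(lra)) as [Hyu Eu].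
  assert (B1 : Y l - e < Y u).
  { apply Rnot_le_lt. intros [K|K].
    - pose proof (inc u (Y u) (Y l - e) ltac:(lra) ltac:(lra) K ltac:(lra)). lra.
    - rewrite <- K in *. lra. }
  assert (B2 : Y u < Y l + e).
  { apply Rnot_le_lt. intros [K|K].
    - pose proof (inc u (Y l + e) (Y u) ltac:(lra) ltac:(lra) K ltac:(lra)). lra.
    - rewrite K in *. lra. }
  apply Rabs_lt_between. lra. }
(* Within the fibre segment [g] varies by at most [G * (yb - ya)], so the signs assumed at [yc] for
   [la] and [lb] pass to the maxima. *)
assert (MV : forall l y, i1 < l < i2 -> ya < y < yb -> Rabs (g l y - g l yc) <= G * (yb - ya)).
{ intros l y Hl Hy.
  assert (Q : forall w, Rmin yc y <= w <= Rmax yc y -> ya <= w <= yb).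
  { intros w Hw. unfold Rmin, Rmax in Hw. destruct (Rle_dec yc y); lra. }
  destruct (MVT_gen (g l) yc y (g2 l)) as [c [Hc1 Hc2]].
  - intros w Hw. assert (ya <= w <= yb) by (apply Q; lra).
    eapply differentiable_pt_lim_is_derive_snd. apply Hg; lra.
  - intros w Hw. specialize (Q w Hw). eapply is_derive_continuity_pt.
    eapply differentiable_pt_lim_is_derive_snd. apply Hg; lra.
  - specialize (Q c Hc1). rewrite Hc2, Rabs_mult. apply Rmult_le_compat; try apply Rabs_pos.
    apply HG; lra. apply Rabs_le_between. lra. }
destruct (IVT_interv (fun l => g l (Y l)) la lb) as [l [Hl E]].
- intros l Hl eps Heps. destruct (YS l ltac:(lra)) as [Hy _].
  destruct (gC l (Y l) ltac:(lra) ltac:(lra) (mkposreal eps Heps)) as [d Hd]; simpl in Hd.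
  destruct (YC l ltac:(lra) d (cond_pos d)) as [d' [Hd' K]].
  exists (Rmin d d'). split. apply Rmin_pos; [apply cond_pos | exact Hd'].
  intros u [Hu1 Hu2]. simpl in *. unfold Rdist in *.
  pose proof (Rmin_l d d'). pose proof (Rmin_r d d').
  apply Hd. lra. apply K. split; auto; lra.
- exact H2.
- destruct (YS la ltac:(lra)) as [Hy _].
  pose proof (MV la (Y la) ltac:(lra) Hy) as K. apply Rabs_le_between in K. lra.
- destruct (YS lb ltac:(lra)) as [Hy _].
  pose proof (MV lb (Y lb) ltac:(lra) Hy) as K. apply Rabs_le_between in K. lra.
- exists l, (Y l). destruct (YS l ltac:(lra)) as [Hy Ey].
  repeat split; try lra. unfold phi in Ey. lra.
Qed.

(** Both coordinates of a graph point in a rotated frame have this form, with [(p, r)] equal to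
    [(cos th, sin th)] or [(- sin th, cos th)]. *)
Lemma fiberwise_C2_affine i1 i2 j1 j2 h h1 h2 h22 p k r s :
  fiberwise_C2 i1 i2 j1 j2 h h1 h2 h22 ->
  fiberwise_C2 i1 i2 j1 j2 (fun x y => (h x y - k) * p + (y - s) * r)
    (fun x y => h1 x y * p) (fun x y => h2 x y * p + r) (fun x y => h22 x y * p).
Proof.
intros H x y Hx Hy. destruct (H x y Hx Hy) as [D [C D2]]. split; [|split].
- intros eps.
  assert (He : 0 < eps / (1 + Rabs p)).
  { apply Rdiv_lt_0_compat. apply cond_pos. pose proof (Rabs_pos p). lra. }
  destruct (D (mkposreal _ He)) as [d Hd]; simpl in Hd.
  exists d. intros u v Hu Hv. specialize (Hd u v Hu Hv).
  match goal with |- Rabs ?e <= _ => replace e with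
   (p * (h u v - h x y - (h1 x y * (u - x) + h2 x y * (v - y)))) by ring end.
  rewrite Rabs_mult. pose proof (Rabs_pos p).
  apply Rle_trans with (Rabs p * (eps / (1 + Rabs p) * Rmax (Rabs (u - x)) (Rabs (v - y)))).
  apply Rmult_le_compat_l; auto.
  assert (0 <= Rmax (Rabs (u - x)) (Rabs (v - y)))
    by (eapply Rle_trans; [apply (Rabs_pos (u - x)) | apply Rmax_l]).
  rewrite <- Rmult_assoc. apply Rmult_le_compat_r; auto.
  apply (Rmult_le_reg_r (1 + Rabs p)). lra.
  replace (Rabs p * (eps / (1 + Rabs p)) * (1 + Rabs p)) with (Rabs p * eps) by (field; lra).
  pose proof (cond_pos eps). nra.
- apply continuity_2d_pt_plus. apply continuity_2d_pt_mult; auto.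
  apply continuity_2d_pt_const. apply continuity_2d_pt_const.
- replace (h22 x y * p) with (h22 x y * p + 0) by ring.
  apply @is_derive_plus. 2: apply @is_derive_const.
  replace (h22 x y * p) with (p * h22 x y) by ring.
  apply (is_derive_ext (fun t => p * h2 x t)). intros t. apply Rmult_comm.
  apply (is_derive_scal (h2 x) y p). exact D2.
Qed.

Lemma continuity_2d_pt_pos f x y :
  continuity_2d_pt f x y -> 0 < f x y -> locally_2d (fun u v => 0 < f u v) x y.
Proof.
intros C H. destruct (C (mkposreal _ H)) as [d Hd]; simpl in Hd.
exists d. intros u v Hu Hv. specialize (Hd u v Hu Hv). apply Rabs_lt_between in Hd. lra.
Qed.

(** A graph [x = h a y] with slope [m] at the base point has unit tangent [(m, 1) / n], where
    [n^2 = 1 + m^2]; this is the first frame vector. Inverting the tangential coordinate in [y]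
    rewrites the curves as graphs over the tangent. The factor [/ n ^ 3] is that of the curvature
    formula, and the minus signs arise because the second frame vector has first component
    [- / n]. *)
Lemma rotated_graph i1 i2 y1 y2 h h1 h2 h22 a0 y0 th n :
  fiberwise_C2 i1 i2 y1 y2 h h1 h2 h22 ->
  i1 < a0 < i2 -> y1 < y0 < y2 ->
  0 < n -> cos th = h2 a0 y0 / n -> sin th = / n ->
  exists d eps f, 0 < d /\ 0 < eps /\
    (forall a, Rabs (a - a0) < d -> i1 < a < i2) /\
    (forall a x, Rabs (a - a0) < d -> Rabs x < eps ->
      continuity_2d_pt f a x /\
      exists y, y1 < y < y2 /\ frame_pt (h a0 y0, y0) th x (f a x) = (h a y, y)) /\
    f a0 0 = 0 /\
    twice_deriv_at (f a0) 0 0 (- h22 a0 y0 / n ^ 3) /\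
    derivable_pt_lim (fun a => f a 0) a0 (- h1 a0 y0 / n).
Proof.
intros Hh Ha Hy Hn Hc Hs.
set (m := h2 a0 y0) in *. set (cs := cos th) in *. set (sn := sin th) in *.
assert (CS : sn * sn + cs * cs = 1) by exact (sin2_cos2 th).
assert (Nm : n * n = 1 + m * m).
{ rewrite Hs, Hc in CS. apply (Rmult_eq_compat_r (n * n)) in CS.
  replace ((/ n * / n + m / n * (m / n)) * (n * n)) with (1 + m * m) in CS by (field; lra). lra. }
(* [al] and [be] are the tangential and the normal coordinate relative to the base point. *)
set (al := fun x y => (h x y - h a0 y0) * cs + (y - y0) * sn).
set (be := fun x y => (h x y - h a0 y0) * (- sn) + (y - y0) * cs).
assert (Hal := fiberwise_C2_affine _ _ _ _ _ _ _ _ cs (h a0 y0) sn y0 Hh).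
assert (Hbe := fiberwise_C2_affine _ _ _ _ _ _ _ _ (- sn) (h a0 y0) cs y0 Hh).
fold al in Hal. fold be in Hbe.
set (al2 := fun x y => h2 x y * cs + sn) in *.
assert (A2 : al2 a0 y0 = n).
{ unfold al2. fold m. rewrite Hc, Hs. apply (Rmult_eq_reg_r n). 2: lra.
  replace ((m * (m / n) + / n) * n) with (1 + m * m) by (field; lra). lra. }
destruct (continuity_2d_pt_pos al2 a0 y0) as [r Hr].
{ apply (Hal a0 y0 Ha Hy). } { lra. }
set (e := Rmin r (Rmin (Rmin (a0 - i1) (i2 - a0)) (Rmin (y0 - y1) (y2 - y0))) / 2).
assert (He : 0 < e /\ e < r /\ e < a0 - i1 /\ e < i2 - a0 /\ e < y0 - y1 /\ e < y2 - y0).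
{ unfold e. set (q := Rmin r _).
  assert (0 < q) by (unfold q; repeat apply Rmin_pos; try apply cond_pos; lra).
  assert (q <= r) by apply Rmin_l.
  assert (q <= Rmin (Rmin (a0 - i1) (i2 - a0)) (Rmin (y0 - y1) (y2 - y0))) by apply Rmin_r.
  pose proof (Rmin_l (Rmin (a0 - i1) (i2 - a0)) (Rmin (y0 - y1) (y2 - y0))).
  pose proof (Rmin_r (Rmin (a0 - i1) (i2 - a0)) (Rmin (y0 - y1) (y2 - y0))).
  pose proof (Rmin_l (a0 - i1) (i2 - a0)). pose proof (Rmin_r (a0 - i1) (i2 - a0)).
  pose proof (Rmin_l (y0 - y1) (y2 - y0)). pose proof (Rmin_r (y0 - y1) (y2 - y0)). lra. }
assert (inc : forall x, Rabs (x - a0) < r -> i1 < x < i2 -> forall z z', y0 - e <= z -> z < z' -> z' <= y0 + e ->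
   al x z < al x z').
{ intros x Hx Hx' z z' Hz Hzz Hz'.
  destruct He as [He0 [He1 [He2 [He3 [He4 He5]]]]].
  set (e' := Rmin r (Rmin (y0 - y1) (y2 - y0))).
  assert (e < e') by (unfold e'; repeat apply Rmin_glb_lt; lra).
  assert (e' <= r) by apply Rmin_l.
  assert (e' <= Rmin (y0 - y1) (y2 - y0)) by apply Rmin_r.
  pose proof (Rmin_l (y0 - y1) (y2 - y0)). pose proof (Rmin_r (y0 - y1) (y2 - y0)).
  apply (is_derive_pos_increasing (al x) (al2 x) (y0 - e') (y0 + e')); try lra.
  - intros w Hw. eapply differentiable_pt_lim_is_derive_snd. apply Hal; lra.
  - intros w Hw. apply Hr; auto. apply Rabs_lt_between. lra. }
assert (al0 : al a0 y0 = 0) by (unfold al; ring).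
destruct He as [He0 [He1 [He2 [He3 [He4 He5]]]]].
assert (L := inc a0 ltac:(rewrite Rminus_diag, Rabs_R0; apply cond_pos) Ha (y0 - e) y0 ltac:(lra) ltac:(lra) ltac:(lra)).
assert (U := inc a0 ltac:(rewrite Rminus_diag, Rabs_R0; apply cond_pos) Ha y0 (y0 + e) ltac:(lra) ltac:(lra) ltac:(lra)).
set (eps := Rmin (- al a0 (y0 - e)) (al a0 (y0 + e)) / 2).
assert (E0 : 0 < eps).
{ unfold eps. apply Rdiv_lt_0_compat; [apply Rmin_pos|]; lra. }
assert (E1 : 2 * eps <= - al a0 (y0 - e) /\ 2 * eps <= al a0 (y0 + e)).
{ unfold eps. pose proof (Rmin_l (- al a0 (y0 - e)) (al a0 (y0 + e))).
  pose proof (Rmin_r (- al a0 (y0 - e)) (al a0 (y0 + e))). lra. }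
assert (alC : forall x y, i1 < x < i2 -> y1 < y < y2 -> continuity_2d_pt al x y).
{ intros x y Hx Hy'. eapply differentiable_pt_lim_continuity. apply Hal; auto. }
destruct (alC a0 (y0 - e) Ha ltac:(lra) (mkposreal _ E0)) as [r1 Hr1]; simpl in Hr1.
destruct (alC a0 (y0 + e) Ha ltac:(lra) (mkposreal _ E0)) as [r2 Hr2]; simpl in Hr2.
set (d := Rmin e (Rmin r1 r2)).
assert (d0 : 0 < d) by (unfold d; repeat apply Rmin_pos; try apply cond_pos; lra).
assert (d1 : d <= e) by apply Rmin_l.
assert (d2 : d <= r1) by (eapply Rle_trans; [apply Rmin_r | apply Rmin_l]).
assert (d3 : d <= r2) by (eapply Rle_trans; [apply Rmin_r | apply Rmin_r]).
assert (onto : forall x v, a0 - d < x < a0 + d -> - eps < v < eps ->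
   exists z, y0 - e < z < y0 + e /\ al x z = v).
{ intros x v Hx Hv. apply (IVT_open (al x)). lra.
  - intros z Hz. eapply is_derive_continuity_pt.
    eapply differentiable_pt_lim_is_derive_snd. apply Hal; lra.
  - assert (K1 := Hr1 x (y0 - e) ltac:(apply Rabs_lt_between; lra)
       ltac:(rewrite Rminus_diag, Rabs_R0; apply cond_pos)).
    assert (K2 := Hr2 x (y0 + e) ltac:(apply Rabs_lt_between; lra)
       ltac:(rewrite Rminus_diag, Rabs_R0; apply cond_pos)).
    apply Rabs_lt_between in K1. apply Rabs_lt_between in K2. lra. }
assert (pos : forall x z, a0 - d < x < a0 + d -> y0 - e < z < y0 + e -> 0 < al2 x z).
{ intros x z Hx Hz. apply Hr; apply Rabs_lt_between; lra. }
assert (Hal' := fiberwise_C2_restrict i1 i2 y1 y2 (a0 - d) (a0 + d) (y0 - e) (y0 + e) al _ _ _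
  ltac:(lra) ltac:(lra) ltac:(lra) ltac:(lra) Hal).
assert (Hbe' := fiberwise_C2_restrict i1 i2 y1 y2 (a0 - d) (a0 + d) (y0 - e) (y0 + e) be _ _ _
  ltac:(lra) ltac:(lra) ltac:(lra) ltac:(lra) Hbe).
assert (F := fiberwise_C2_graph _ _ _ _ (- eps) eps _ _ _ _ _ _ _ _ Hal' Hbe' pos onto).
set (Z := fiber_inverse al (y0 - e) (y0 + e)) in *.
assert (ZS := fiber_inverse_spec (a0 - d) (a0 + d) (y0 - e) (y0 + e) (- eps) eps al onto).
fold Z in ZS.
assert (Z0 : Z a0 0 = y0).
{ apply (fiber_inverse_unique (a0 - d) (a0 + d) (y0 - e) (y0 + e) (- eps) eps al al2); auto; try lra.
  intros x z Hx Hz. eapply differentiable_pt_lim_is_derive_snd. apply Hal'; auto. }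
(* The normal coordinate is stationary in [y] at the base point; this gives the horizontal tangent
   and removes the contribution of the moving [Z] from both remaining derivatives. *)
assert (B2 : h2 a0 y0 * - sn + cs = 0) by (fold m; rewrite Hc, Hs; field; lra).
exists d, eps, (fun x v => be x (Z x v)).
split; [exact d0|]. split; [exact E0|]. split; [|split; [|split; [|split]]].
- intros a Haa. apply Rabs_lt_between in Haa. lra.
- intros a x Haa Hx. apply Rabs_lt_between in Haa. apply Rabs_lt_between in Hx.
  destruct (F a x ltac:(lra) ltac:(lra)) as [F1 _].
  split. eapply differentiable_pt_lim_continuity; exact F1.
  destruct (ZS a x ltac:(lra) ltac:(lra)) as [Hz Ez].
  exists (Z a x). split. lra.
  unfold frame_pt. simpl. fold cs sn. rewrite <- Ez at 1 3. unfold al, be.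
  f_equal.
  + replace (h a0 y0 + ((h a (Z a x) - h a0 y0) * cs + (Z a x - y0) * sn) * cs -
      ((h a (Z a x) - h a0 y0) * - sn + (Z a x - y0) * cs) * sn)
     with (h a0 y0 + (h a (Z a x) - h a0 y0) * (sn * sn + cs * cs)) by ring.
    rewrite CS. ring.
  + replace (y0 + ((h a (Z a x) - h a0 y0) * cs + (Z a x - y0) * sn) * sn +
      ((h a (Z a x) - h a0 y0) * - sn + (Z a x - y0) * cs) * cs)
     with (y0 + (Z a x - y0) * (sn * sn + cs * cs)) by ring.
    rewrite CS. ring.
- rewrite Z0. unfold be. ring.
- exists eps. split; [exact E0|].
  exists (fun x => (h2 a0 (Z a0 x) * - sn + cs) / al2 a0 (Z a0 x)). split; [|split].
  + intros x Hx. rewrite Rminus_0_r in Hx. apply Rabs_lt_between in Hx.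
    apply is_derive_Reals.
    destruct (F a0 x ltac:(lra) ltac:(lra)) as [F1 _].
    exact (differentiable_pt_lim_is_derive_snd _ _ _ _ _ F1).
  + cbv beta. rewrite Z0, B2. unfold Rdiv; ring.
  + apply is_derive_Reals.
    destruct (F a0 0 ltac:(lra) ltac:(lra)) as [_ [_ F3]]. cbv beta in F3.
    rewrite Z0, B2, A2 in F3.
    replace (- h22 a0 y0 / n ^ 3) with
      ((h22 a0 y0 * - sn * n - 0 * (h22 a0 y0 * cs)) / n ^ 3); [exact F3|].
    rewrite Hs. field. lra.
- apply is_derive_Reals.
  destruct (F a0 0 ltac:(lra) ltac:(lra)) as [F1 _]. cbv beta in F1.
  apply differentiable_pt_lim_is_derive_fst in F1.
  rewrite Z0, B2, A2 in F1.
  replace (- h1 a0 y0 / n) with (h1 a0 y0 * - sn - 0 * (h1 a0 y0 * cs) / n); [exact F1|].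
  rewrite Hs. field. lra.
Qed.

Lemma quadratic_tangency_of_graphs b a0 y0 i1 i2 y1 y2
    hu hu1 hu2 hu22 hs hs1 hs2 hs22 :
  fiberwise_C2 i1 i2 y1 y2 hu hu1 hu2 hu22 ->
  fiberwise_C2 i1 i2 y1 y2 hs hs1 hs2 hs22 ->
  i1 < a0 < i2 -> y1 < y0 < y2 -> y0 <> fix_x a0 b ->
  (forall a, i1 < a < i2 -> forall eta, 0 < eta ->
     exists N, forall n, (N <= n)%nat -> forall y, y1 < y < y2 ->
       dist2 (Nat.iter n (henon a b) (hs a y, y)) (pfix a b) < eta) ->
  (forall a, i1 < a < i2 -> forall eta, 0 < eta ->
     exists N, forall n, (N <= n)%nat -> forall y, y1 < y < y2 ->
       dist2 (Nat.iter n (henon_inv a b) (hu a y, y)) (pfix a b) < eta) ->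
  hu a0 y0 = hs a0 y0 -> hu2 a0 y0 = hs2 a0 y0 ->
  hu22 a0 y0 <> hs22 a0 y0 -> hu1 a0 y0 <> hs1 a0 y0 ->
  quadratic_tangency_generic_unfolding a0 b.
Proof.
intros Hu Hs Ha Hy Hfix Hst Hun E0 E1 E2 E3.
set (m := hu2 a0 y0). set (n := sqrt (1 + m * m)).
assert (P : 0 < 1 + m * m) by nra.
assert (Hn : 0 < n) by (apply sqrt_lt_R0; lra).
assert (Nn : n * n = 1 + m * m) by (apply sqrt_sqrt; lra).
assert (B : -1 <= m / n <= 1).
{ split; apply (Rmult_le_reg_r n); auto; unfold Rdiv; rewrite Rmult_assoc, Rinv_l; nra. }
(* [acos] has values with nonnegative sine, so the sine is [/ n] and not its negative. The slopes
   agree at the tangency, so the same frame serves both curves. *)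
set (th := acos (m / n)).
assert (Hc : cos th = m / n) by (apply cos_acos; exact B).
assert (Hsn : sin th = / n).
{ unfold th. rewrite sin_acos by exact B.
  replace (1 - (m / n)²) with ((/ n)²).
  - apply sqrt_Rsqr. left. apply Rinv_0_lt_compat, Hn.
  - unfold Rsqr. apply (Rmult_eq_reg_r (n * n)). 2: nra.
    replace ((1 - m / n * (m / n)) * (n * n)) with (n * n - m * m) by (field; lra).
    rewrite Nn at 2. field. lra. }
destruct (rotated_graph _ _ _ _ _ _ _ _ a0 y0 th n Hu Ha Hy Hn Hc Hsn)
  as [du [eu [fu [U1 [U2 [U3 [U4 [U5 [U6 U7]]]]]]]]].
assert (Hc' : cos th = hs2 a0 y0 / n) by (rewrite <- E1; exact Hc).
destruct (rotated_graph _ _ _ _ _ _ _ _ a0 y0 th n Hs Ha Hy Hn Hc' Hsn)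
  as [ds [es [fs [S1 [S2 [S3 [S4 [S5 [S6 S7]]]]]]]]].
assert (M1 := Rmin_l eu es). assert (M2 := Rmin_r eu es).
assert (M3 := Rmin_l du ds). assert (M4 := Rmin_r du ds).
exists (hu a0 y0, y0), th, (Rmin eu es), (Rmin du ds), fs, fu.
split; [apply Rmin_pos; auto|]. split; [apply Rmin_pos; auto|].
split; [|split; [|split; [|split; [|split; [|split; [|split]]]]]]; auto.
- unfold pfix. intros K. injection K. intros. congruence.
- intros a Haa. split.
  + intros eta Heta. destruct (Hst a (S3 a ltac:(lra)) eta Heta) as [N HN].
    exists N. intros k Hk x Hx. rewrite E0.
    destruct (S4 a x ltac:(lra) ltac:(lra)) as [_ [y [Hy' ->]]]. auto.
  + intros eta Heta. destruct (Hun a (U3 a ltac:(lra)) eta Heta) as [N HN].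
    exists N. intros k Hk x Hx.
    destruct (U4 a x ltac:(lra) ltac:(lra)) as [_ [y [Hy' ->]]]. auto.
- intros a x Haa Hx eta Heta.
  destruct (S4 a x ltac:(lra) ltac:(lra)) as [C _].
  destruct (C (mkposreal _ Heta)) as [d Hd]. exists d. split; [apply cond_pos|]. auto.
- intros a x Haa Hx eta Heta.
  destruct (U4 a x ltac:(lra) ltac:(lra)) as [C _].
  destruct (C (mkposreal _ Heta)) as [d Hd]. exists d. split; [apply cond_pos|]. auto.
- exists (- hs22 a0 y0 / n ^ 3), (- hu22 a0 y0 / n ^ 3).
  split; [exact S6|]. split; [exact U6|].
  replace (- hu22 a0 y0 / n ^ 3 - - hs22 a0 y0 / n ^ 3) with
    ((hs22 a0 y0 - hu22 a0 y0) * / n ^ 3) by (field; lra).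
  apply Rmult_integral_contrapositive. split. lra.
  apply Rinv_neq_0_compat, pow_nonzero. lra.
- exists (- hu1 a0 y0 / n - - hs1 a0 y0 / n). split.
  + apply derivable_pt_lim_minus; auto.
  + replace (- hu1 a0 y0 / n - - hs1 a0 y0 / n) with ((hs1 a0 y0 - hu1 a0 y0) * / n)
      by (field; lra).
    apply Rmult_integral_contrapositive. split. lra. apply Rinv_neq_0_compat. lra.
Qed.

(** * Families of power series *)

Lemma geometric_tail (a : nat -> R) M r N :
  0 <= r < 1 -> (forall k, (N < k)%nat -> Rabs (a k) <= M * r ^ k) ->
  ex_series a /\ Rabs (Series a - sum_f_R0 a N) <= M * r ^ S N / (1 - r).
Proof.
intros Hr Ha.
set (b := fun k => a (S N + k)%nat).
set (g := fun k => (M * r ^ S N) * r ^ k).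
assert (Hg : is_series g (M * r ^ S N / (1 - r))).
{ apply (is_series_scal_l (M * r ^ S N) (fun k => r ^ k)). apply is_series_geom.
  rewrite Rabs_pos_eq; lra. }
assert (Hbg : forall k, Rabs (b k) <= g k).
{ intros k. unfold b, g. rewrite Rmult_assoc, <- pow_add. apply Ha. lia. }
assert (Eg : ex_series g) by (eexists; exact Hg).
assert (Eb : ex_series (fun k => Rabs (b k))).
{ apply (@ex_series_le R_AbsRing R_CompleteNormedModule _ g); auto. intros k.
  unfold norm; simpl. unfold abs; simpl. rewrite Rabs_Rabsolu. apply Hbg. }
assert (Ea : ex_series a) by (apply (ex_series_incr_n a (S N)), ex_series_Rabs; exact Eb).
split. exact Ea.
rewrite (Series_incr_n a (S N)) by (auto; lia). simpl pred.
replace (sum_f_R0 a N + Series (fun k => a (S N + k)%nat) - sum_f_R0 a N) with (Series b)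
  by (unfold b; ring).
eapply Rle_trans. apply Series_Rabs, Eb.
rewrite <- (is_series_unique _ _ Hg).
apply Series_le; auto. intros k; split; [apply Rabs_pos | apply Hbg].
Qed.

Lemma pow_Rabs_le t rho k : Rabs t <= rho -> Rabs (t ^ k) <= rho ^ k.
Proof. intros H. rewrite <- RPow_abs. apply pow_incr. split; [apply Rabs_pos|exact H]. Qed.

Lemma coef_pow_bound c t M theta rho k :
  Rabs c <= M * theta ^ k -> Rabs t <= rho -> Rabs (c * t ^ k) <= M * (theta * rho) ^ k.
Proof.
intros Hc Ht. rewrite Rabs_mult, Rpow_mult_distr, <- Rmult_assoc.
apply Rmult_le_compat; try apply Rabs_pos; auto. apply pow_Rabs_le, Ht.
Qed.

Lemma PSeries_tail (a : nat -> R) M theta rho t N :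
  (forall k, (N < k)%nat -> Rabs (a k) <= M * theta ^ k) ->
  Rabs t <= rho -> 0 <= theta -> theta * rho < 1 ->
  Rabs (PSeries a t - sum_f_R0 (fun k => a k * t ^ k) N)
    <= M * (theta * rho) ^ S N / (1 - theta * rho).
Proof.
intros Ha Ht H0 H1.
apply (geometric_tail (fun k => a k * t ^ k)).
- split; auto. apply Rmult_le_pos; auto. pose proof (Rabs_pos t). lra.
- intros k Hk. apply coef_pow_bound; auto.
Qed.

Lemma CV_radius_geometric (a : nat -> R) M theta t :
  0 < theta -> (forall k, Rabs (a k) <= M * theta ^ k) -> theta * Rabs t < 1 ->
  Rbar_lt (Rabs t) (CV_radius a).
Proof.
intros Hth Ha Ht.
apply Rbar_lt_le_trans with (/ theta).
- simpl. apply (Rmult_lt_reg_l theta); auto. rewrite Rinv_r; lra.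
- apply CV_radius_bounded. exists M. intros n.
  eapply Rle_trans. apply (coef_pow_bound _ _ M theta (/ theta)). apply Ha.
  rewrite Rabs_pos_eq. lra. left. apply Rinv_0_lt_compat, Hth.
  rewrite Rinv_r, pow1 by lra. lra.
Qed.

Lemma geometric_eventually_small C r eps :
  0 <= r < 1 -> 0 < eps -> exists N, C * r ^ S N < eps.
Proof.
intros Hr He.
destruct (pow_lt_1_zero r ltac:(rewrite Rabs_pos_eq; lra) (eps / (1 + Rabs C))) as [N HN].
{ apply Rdiv_lt_0_compat; auto. pose proof (Rabs_pos C). lra. }
exists N. specialize (HN (S N) ltac:(lia)). pose proof (Rabs_pos C).
eapply Rle_lt_trans. apply Rle_abs. rewrite Rabs_mult.
apply Rle_lt_trans with ((1 + Rabs C) * Rabs (r ^ S N)).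
- apply Rmult_le_compat_r. apply Rabs_pos. lra.
- replace eps with ((1 + Rabs C) * (eps / (1 + Rabs C))) by (field; lra).
  apply Rmult_lt_compat_l; lra.
Qed.

Lemma continuity_2d_pt_sum (F : nat -> R -> R -> R) x y N :
  (forall k, continuity_2d_pt (F k) x y) ->
  continuity_2d_pt (fun u v => sum_f_R0 (fun k => F k u v) N) x y.
Proof.
intros H. induction N; simpl. apply H. apply continuity_2d_pt_plus; auto.
Qed.

Lemma continuity_2d_pt_pow_snd x y k : continuity_2d_pt (fun _ v => v ^ k) x y.
Proof.
induction k; simpl. apply continuity_2d_pt_const.
apply continuity_2d_pt_mult; auto. apply continuity_2d_pt_id2.
Qed.

Section PowerSeriesFamily.

Variables (i1 i2 M theta : R) (e de : nat -> R -> R).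
Hypothesis theta_pos : 0 < theta.
Hypothesis e_bound : forall k x, i1 < x < i2 -> Rabs (e k x) <= M * theta ^ k.
Hypothesis e_derive : forall k x, i1 < x < i2 -> is_derive (e k) x (de k x).

Lemma PSeries_family_continuity x t :
  i1 < x < i2 -> theta * Rabs t < 1 ->
  continuity_2d_pt (fun u v => PSeries (fun k => e k u) v) x t.
Proof.
intros Hx Ht eps. pose proof (cond_pos eps) as Hep.
(* Half the distance from [|t|] to [/ theta]: every argument within [del] of [t] stays in the disc
   of radius [rho], where the tails are uniformly geometric. *)
set (del := (/ theta - Rabs t) / 2).
assert (Hd : 0 < del).
{ unfold del. assert (Rabs t < / theta). { apply (Rmult_lt_reg_l theta); auto. rewrite Rinv_r; lra. } lra. }
set (rho := Rabs t + del).
assert (Hr : theta * rho < 1).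
{ apply (Rmult_lt_reg_l (/ theta)). apply Rinv_0_lt_compat, theta_pos.
  rewrite <- Rmult_assoc, Rinv_l, Rmult_1_l, Rmult_1_r by lra. unfold rho, del in *. lra. }
assert (Hr0 : 0 <= theta * rho).
{ apply Rmult_le_pos. lra. unfold rho. pose proof (Rabs_pos t). lra. }
destruct (geometric_eventually_small (M / (1 - theta * rho)) (theta * rho) (eps / 3)
  ltac:(lra) ltac:(lra)) as [N HN].
assert (C : continuity_2d_pt (fun u v => sum_f_R0 (fun k => e k u * v ^ k) N) x t).
{ apply (continuity_2d_pt_sum (fun k u v => e k u * v ^ k)). intros k.
  apply continuity_2d_pt_mult. 2: apply continuity_2d_pt_pow_snd.
  apply (continuity_1d_2d_pt_comp (e k) (fun u _ => u)).
  eapply is_derive_continuity_pt, e_derive, Hx. apply continuity_2d_pt_id1. }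
assert (He3 : 0 < eps / 3) by lra.
destruct (C (mkposreal _ He3)) as [d1 Hd1]; simpl in Hd1.
set (dd := Rmin d1 (Rmin del (Rmin (x - i1) (i2 - x)))).
assert (dd0 : 0 < dd) by (unfold dd; repeat apply Rmin_pos; try apply cond_pos; lra).
assert (q1 : dd <= d1) by apply Rmin_l.
assert (q2 : dd <= Rmin del (Rmin (x - i1) (i2 - x))) by apply Rmin_r.
pose proof (Rmin_l del (Rmin (x - i1) (i2 - x))).
pose proof (Rmin_r del (Rmin (x - i1) (i2 - x))).
pose proof (Rmin_l (x - i1) (i2 - x)). pose proof (Rmin_r (x - i1) (i2 - x)).
exists (mkposreal _ dd0); simpl. intros u v Hu Hv.
assert (Hu' : i1 < u < i2) by (apply Rabs_lt_between in Hu; lra).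
assert (Hv' : Rabs v <= rho).
{ unfold rho. replace v with (t + (v - t)) by ring. eapply Rle_trans. apply Rabs_triang. lra. }
assert (Ht' : Rabs t <= rho) by (unfold rho; lra).
assert (T1 := PSeries_tail (fun k => e k u) M theta rho v N (fun k _ => e_bound k u Hu') Hv'
  ltac:(lra) Hr).
assert (T2 := PSeries_tail (fun k => e k x) M theta rho t N (fun k _ => e_bound k x Hx) Ht'
  ltac:(lra) Hr).
assert (T3 := Hd1 u v ltac:(lra) ltac:(lra)).
replace (M * (theta * rho) ^ S N / (1 - theta * rho)) with
  (M / (1 - theta * rho) * (theta * rho) ^ S N) in T1, T2 by (field; lra).
set (s1 := sum_f_R0 (fun k => e k u * v ^ k) N) in *.
set (s2 := sum_f_R0 (fun k => e k x * t ^ k) N) in *.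
cbv beta in *.
apply Rabs_lt_between in T3. apply Rabs_le_between in T1. apply Rabs_le_between in T2.
apply Rabs_lt_between. lra.
Qed.

Hypothesis de_bound : forall k x, i1 < x < i2 -> Rabs (de k x) <= M * theta ^ k.

Lemma coef_lipschitz k x x' :
  i1 < x < i2 -> i1 < x' < i2 ->
  Rabs (e k x' - e k x) <= M * theta ^ k * Rabs (x' - x).
Proof.
intros Hx Hx'.
assert (Q : forall w, Rmin x x' <= w <= Rmax x x' -> i1 < w < i2).
{ intros w Hw. unfold Rmin, Rmax in Hw. destruct (Rle_dec x x'); lra. }
destruct (MVT_gen (e k) x x' (de k)) as [c [Hc1 Hc2]].
- intros w Hw. apply e_derive, Q. lra.
- intros w Hw. eapply is_derive_continuity_pt, e_derive, Q, Hw.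
- rewrite Hc2, Rabs_mult. apply Rmult_le_compat_r. apply Rabs_pos. apply de_bound, Q, Hc1.
Qed.

(* The coefficients are Lipschitz with geometric constants, so the difference quotients
   converge dominatedly and no regularity of [de] is used. *)
Lemma PSeries_family_derive_param x t :
  i1 < x < i2 -> theta * Rabs t < 1 ->
  is_derive (fun u => PSeries (fun k => e k u) t) x (PSeries (fun k => de k x) t).
Proof.
intros Hx Ht. apply is_derive_Reals. intros eps Hep.
set (r := theta * Rabs t) in *.
assert (Hr0 : 0 <= r) by (apply Rmult_le_pos; [lra | apply Rabs_pos]).
destruct (geometric_eventually_small (2 * M / (1 - r)) r (eps / 2)
  ltac:(lra) ltac:(lra)) as [N HN].
assert (C : derivable_pt_lim (fun u => sum_f_R0 (fun k => e k u * t ^ k) N) x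
   (sum_f_R0 (fun k => de k x * t ^ k) N)).
{ assert (K : forall k, derivable_pt_lim (fun u => e k u * t ^ k) x (de k x * t ^ k)).
  { intros k. replace (de k x * t ^ k) with (de k x * t ^ k + e k x * 0) by ring.
    apply derivable_pt_lim_mult. apply is_derive_Reals, e_derive, Hx.
    apply derivable_pt_lim_const. }
  clear HN. induction N; simpl. apply K. apply derivable_pt_lim_plus; auto. }
destruct (C (eps / 2) ltac:(lra)) as [d Hd].
set (dd := Rmin d (Rmin (x - i1) (i2 - x))).
assert (dd0 : 0 < dd) by (unfold dd; repeat apply Rmin_pos; try apply cond_pos; lra).
assert (q1 : dd <= d) by apply Rmin_l.
assert (q2 : dd <= Rmin (x - i1) (i2 - x)) by apply Rmin_r.
pose proof (Rmin_l (x - i1) (i2 - x)). pose proof (Rmin_r (x - i1) (i2 - x)).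
exists (mkposreal _ dd0); simpl. intros h Hh0 Hh.
assert (Hx' : i1 < x + h < i2) by (apply Rabs_lt_between in Hh; lra).
specialize (Hd h Hh0 ltac:(lra)).
set (c := fun k => (e k (x + h) - e k x) / h - de k x).
assert (Hc : forall k, Rabs (c k * t ^ k) <= 2 * M * r ^ k).
{ intros k. apply coef_pow_bound. 2: apply Rle_refl.
  unfold c. unfold Rminus at 1. eapply Rle_trans. apply Rabs_triang. rewrite Rabs_Ropp.
  assert (Rabs ((e k (x + h) - e k x) / h) <= M * theta ^ k).
  { unfold Rdiv. rewrite Rabs_mult, Rabs_inv.
    apply (Rmult_le_reg_r (Rabs h)). apply Rabs_pos_lt, Hh0.
    rewrite Rmult_assoc, Rinv_l, Rmult_1_r by (apply Rabs_no_R0, Hh0).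
    replace h with (x + h - x) at 2 by ring. apply coef_lipschitz; auto. }
  pose proof (de_bound k x Hx). lra. }
destruct (geometric_tail (fun k => c k * t ^ k) (2 * M) r N ltac:(lra) (fun k _ => Hc k)) as [Ec Tc].
assert (X : forall u, i1 < u < i2 -> ex_series (fun k => e k u * t ^ k)).
{ intros u Hu. apply (geometric_tail _ M r 0 ltac:(lra)). intros k _.
  apply coef_pow_bound. apply e_bound, Hu. apply Rle_refl. }
assert (Y : ex_series (fun k => de k x * t ^ k)).
{ apply (geometric_tail _ M r 0 ltac:(lra)). intros k _.
  apply coef_pow_bound. apply de_bound, Hx. apply Rle_refl. }
assert (E1 : Series (fun k => c k * t ^ k) =
   (PSeries (fun k => e k (x + h)) t - PSeries (fun k => e k x) t) / h - PSeries (fun k => de k x) t).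
{ unfold PSeries. rewrite <- Series_minus by (apply X; auto).
  unfold Rdiv at 1. rewrite <- Series_scal_r.
  rewrite <- Series_minus; auto.
  - apply Series_ext. intros k. unfold c. field. exact Hh0.
  - apply ex_series_scal_r. apply (ex_series_minus (fun k => e k (x + h) * t ^ k)); apply X; auto. }
assert (E2 : sum_f_R0 (fun k => c k * t ^ k) N =
   (sum_f_R0 (fun k => e k (x + h) * t ^ k) N - sum_f_R0 (fun k => e k x * t ^ k) N) / h
    - sum_f_R0 (fun k => de k x * t ^ k) N).
{ clear - Hh0. induction N; simpl; [|rewrite IHN]; unfold c; field; exact Hh0. }
rewrite <- E1. rewrite <- E2 in Hd.
replace (2 * M * r ^ S N / (1 - r)) with (2 * M / (1 - r) * r ^ S N) in Tc by (field; lra).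
apply Rabs_le_between in Tc. apply Rabs_lt_between in Hd. apply Rabs_lt_between. lra.
Qed.

End PowerSeriesFamily.

Lemma INR_le_pow2 k : INR k <= 2 ^ k.
Proof.
induction k. simpl. lra. rewrite S_INR. simpl. pose proof (pow_R1_Rle 2 k ltac:(lra)). lra.
Qed.

(** The factor [k + 1] of differentiation is estimated by [2 ^ (k + 1)]. Bounds thus remain purely
    geometric, at the price of doubling the rate with each derivative. *)
Lemma PS_derive_bound (a : nat -> R) M theta :
  0 <= theta -> (forall k, Rabs (a k) <= M * theta ^ k) ->
  forall k, Rabs (PS_derive a k) <= 2 * M * theta * (2 * theta) ^ k.
Proof.
intros Hth Ha k. unfold PS_derive. rewrite Rabs_mult, (Rabs_pos_eq (INR (S k))) by apply pos_INR.
replace (2 * M * theta * (2 * theta) ^ k) with (2 ^ S k * (M * theta ^ S k))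
  by (rewrite Rpow_mult_distr; simpl; ring).
apply Rmult_le_compat; auto. apply pos_INR. apply Rabs_pos. apply INR_le_pow2.
Qed.

Lemma PSeries_fiberwise_C2 i1 i2 M theta rho (e de : nat -> R -> R) :
  0 < theta -> 2 * theta * rho <= 1 ->
  (forall k x, i1 < x < i2 -> Rabs (e k x) <= M * theta ^ k) ->
  (forall k x, i1 < x < i2 -> Rabs (de k x) <= M * theta ^ k) ->
  (forall k x, i1 < x < i2 -> is_derive (e k) x (de k x)) ->
  fiberwise_C2 i1 i2 (- rho) rho
    (fun x t => PSeries (fun k => e k x) t)
    (fun x t => PSeries (fun k => de k x) t)
    (fun x t => PSeries (PS_derive (fun k => e k x)) t)
    (fun x t => PSeries (PS_derive (PS_derive (fun k => e k x))) t).
Proof.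
intros Hth Hrho He Hde Hd x t Hx Ht.
assert (Ht1 : 2 * theta * Rabs t < 1).
{ apply Rabs_lt_between in Ht. apply Rlt_le_trans with (2 * theta * rho); auto.
  apply Rmult_lt_compat_l; lra. }
assert (Ht2 : forall s, 2 * theta * Rabs s < 1 -> theta * Rabs s < 1).
{ intros s Hs. pose proof (Rabs_pos s). nra. }
assert (C2 : continuity_2d_pt (fun u v => PSeries (PS_derive (fun k => e k u)) v) x t).
{ apply (PSeries_family_continuity i1 i2 (2 * M * theta) (2 * theta)
    (fun k u => PS_derive (fun k => e k u) k) (fun k u => PS_derive (fun k => de k u) k)); auto.
  - lra.
  - intros k u Hu. apply (PS_derive_bound (fun k => e k u)). lra. intros j. apply He, Hu.
  - intros k u Hu. unfold PS_derive. apply (is_derive_scal (e (S k)) u (INR (S k))). apply Hd, Hu. }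
split; [|split]; auto.
- apply (differentiable_pt_lim_of_partials (fun x t => PSeries (fun k => e k x) t)
    (fun x t => PSeries (PS_derive (fun k => e k x)) t)); auto.
  + set (dd := Rmin (Rmin (x - i1) (i2 - x)) (rho - Rabs t)).
    assert (R0 : Rabs t < rho) by (apply Rabs_lt_between in Ht; auto).
    assert (d0 : 0 < dd) by (unfold dd; repeat apply Rmin_pos; lra).
    pose proof (Rmin_l (Rmin (x - i1) (i2 - x)) (rho - Rabs t)).
    pose proof (Rmin_r (Rmin (x - i1) (i2 - x)) (rho - Rabs t)).
    pose proof (Rmin_l (x - i1) (i2 - x)). pose proof (Rmin_r (x - i1) (i2 - x)).
    exists (mkposreal dd d0). simpl. fold dd in H, H0. intros u v Hu Hv. apply is_derive_PSeries.
    apply Rabs_lt_between in Hu.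
    assert (Rabs v < rho).
    { replace v with (t + (v - t)) by ring. eapply Rle_lt_trans. apply Rabs_triang. lra. }
    apply (CV_radius_geometric _ M theta); auto. intros k. apply He; lra.
    apply Ht2. apply Rlt_le_trans with (2 * theta * rho); auto. apply Rmult_lt_compat_l; lra.
  + apply (PSeries_family_derive_param i1 i2 M theta e de); auto.
- apply is_derive_PSeries. apply (CV_radius_geometric _ (2 * M * theta) (2 * theta)); auto. lra.
  intros k. apply PS_derive_bound. lra. intros j. apply He, Hx.
Qed.

(** * Taylor coefficients of the invariant manifolds *)

(** Abstracting the operations lets one and the same program be run over the reals, for the proofs,
    and over intervals, for the computation; enclosure then follows by induction on the program. *)
Record arith (T : Type) := Arith {
  aadd : T -> T -> T; amul : T -> T -> T; aopp : T -> T; ainv : T -> T; aint : Z -> T }.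
Arguments aadd {T}. Arguments amul {T}. Arguments aopp {T}. Arguments ainv {T}.
Arguments aint {T}.

Definition Rarith : arith R := Arith R Rplus Rmult Ropp Rinv IZR.

Section Coefficients.

Variables (T : Type) (o : arith T) (nu beta kappa : T).

Fixpoint dot (l m : list T) : T :=
  match l, m with
  | x :: l, y :: m => aadd o (amul o x y) (dot l m)
  | _, _ => aint o 0
  end.

(** The sum of the two multipliers, which is minus twice the coordinate of the fixed point. *)
Definition root_sum : T := aadd o nu (amul o beta (ainv o nu)).
Definition root_sum_derive : T :=
  aadd o (aint o 1) (aopp o (amul o beta (amul o (ainv o nu) (ainv o nu)))).

(* Returns e_n, ..., e_1, their derivatives in nu, nu^n and nu^-n. The recursion
   (nu^k + beta/nu^k - nu - beta/nu) e_k = - sum_(0<i<k) e_i e_(k-i) is the invariance equation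
   at order k, with b = - beta and with a, X(0) expressed through nu; e_1 = kappa is free. *)
Fixpoint coefs (n : nat) : list T * list T * T * T :=
  match n with
  | O => (nil, nil, aint o 1, aint o 1)
  | S m =>
    let '(l, dl, p, ip) := coefs m in
    let p := amul o p nu in
    let ip := amul o ip (ainv o nu) in
    match m with
    | O => (kappa :: nil, aint o 0 :: nil, p, ip)
    | S _ =>
      let id := ainv o (aadd o (aadd o p (amul o beta ip)) (aopp o root_sum)) in
      let dd := aadd o (amul o (amul o (aint o (Z.of_nat n)) (ainv o nu))
                          (aadd o p (aopp o (amul o beta ip)))) (aopp o root_sum_derive) in
      let e := aopp o (amul o (dot l (rev l)) id) in
      let de := aopp o (amul o (aadd o (aadd o (dot dl (rev l)) (dot l (rev dl)))
                                   (amul o dd e)) id) in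
      (e :: l, de :: dl, p, ip)
    end
  end.

End Coefficients.

Definition ecoef (beta kappa : R) (k : nat) (nu : R) : R :=
  hd 0 (fst (fst (fst (coefs R Rarith nu beta kappa k)))).
Definition decoef (beta kappa : R) (k : nat) (nu : R) : R :=
  hd 0 (snd (fst (fst (coefs R Rarith nu beta kappa k)))).
Definition divisor (beta : R) (k : nat) (nu : R) : R :=
  nu ^ k + beta * (/ nu) ^ k - (nu + beta * / nu).
Definition ddivisor (beta : R) (k : nat) (nu : R) : R :=
  INR k * / nu * (nu ^ k - beta * (/ nu) ^ k) - (1 - beta * (/ nu * / nu)).
(* sum of f_j g_(k-j) over 0 < j < k; junk for k < 2, where k - 2 truncates *)
Definition inner_conv (f g : nat -> R) (k : nat) : R :=
  sum_f_R0 (fun i => f (k - 1 - i)%nat * g (S i)) (k - 2).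

Lemma coefs_eq beta kappa nu n :
  coefs R Rarith nu beta kappa n =
  (rev (map (fun k => ecoef beta kappa k nu) (seq 1 n)),
   rev (map (fun k => decoef beta kappa k nu) (seq 1 n)), nu ^ n, (/ nu) ^ n).
Proof.
induction n as [|n IH]. reflexivity.
rewrite seq_S, !map_app, !rev_app_distr.
replace (map (fun k => ecoef beta kappa k nu) ((1 + n)%nat :: nil)) with
  (hd 0 (fst (fst (fst (coefs R Rarith nu beta kappa (S n))))) :: nil) by reflexivity.
replace (map (fun k => decoef beta kappa k nu) ((1 + n)%nat :: nil)) with
  (hd 0 (snd (fst (fst (coefs R Rarith nu beta kappa (S n))))) :: nil) by reflexivity.
cbn [coefs]. rewrite IH. clear IH. destruct n as [|m].
- simpl. f_equal; [f_equal|]; ring.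
- cbn [fst snd hd rev app]. apply f_equal2; [apply f_equal2; [reflexivity|]|]; simpl; ring.
Qed.

Lemma dot_inner_conv f g m :
  dot R Rarith (rev (map f (seq 1 (S m)))) (map g (seq 1 (S m))) = inner_conv f g (S (S m)).
Proof.
unfold inner_conv. replace (S (S m) - 2)%nat with m by lia.
(* Removing both heads shortens the reversed list at its top degree but shifts the start of the
   other one; hence the induction is over all starting indices [s]. *)
assert (G : forall l s, dot R Rarith (rev (map f (seq 1 (S l)))) (map g (seq s (S l))) =
  sum_f_R0 (fun i => f (S l - i)%nat * g (s + i)%nat) l).
{ induction l as [|l IH]; intros s.
  - simpl. rewrite Nat.add_0_r. ring.
  - rewrite (seq_S (S l) 1), map_app, rev_app_distr.
    change (seq s (S (S l))) with (s :: seq (S s) (S l)).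
    cbn [map rev app dot]. change (rev (map f (seq 1 (S l)))) with (rev (map f (seq 1 (S l)))).
    rewrite IH. rewrite (decomp_sum _ (S l)) by lia. cbn [pred aadd amul Rarith].
    rewrite Nat.add_0_r. replace (1 + S l)%nat with (S (S l) - 0)%nat by lia. f_equal.
    apply sum_eq. intros i Hi. replace (S s + i)%nat with (s + S i)%nat by lia.
    replace (S (S l) - S i)%nat with (S l - i)%nat by lia. reflexivity. }
rewrite G. apply sum_eq. intros i Hi. replace (S (S m) - 1 - i)%nat with (S m - i)%nat by lia. reflexivity.
Qed.

Lemma ecoef_0 beta kappa nu : ecoef beta kappa 0 nu = 0.
Proof. reflexivity. Qed.
Lemma ecoef_1 beta kappa nu : ecoef beta kappa 1 nu = kappa.
Proof. reflexivity. Qed.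

Lemma ecoef_rec beta kappa nu k : (2 <= k)%nat ->
  ecoef beta kappa k nu =
  - (inner_conv (fun j => ecoef beta kappa j nu) (fun j => ecoef beta kappa j nu) k
     * / divisor beta k nu).
Proof.
intros Hk. destruct k as [|[|m]]; try lia.
unfold ecoef at 1. cbn [coefs].
pose proof (coefs_eq beta kappa nu (S m)) as K. cbn [coefs] in K. rewrite K. clear K.
cbn [fst snd hd].
rewrite rev_involutive, dot_inner_conv. cbn [aopp amul ainv aadd Rarith].
unfold root_sum, divisor. cbn [aopp amul ainv aadd Rarith].
replace (nu ^ S m * nu) with (nu ^ S (S m)) by (simpl; ring).
replace ((/ nu) ^ S m * / nu) with ((/ nu) ^ S (S m)) by (simpl; ring).
reflexivity.
Qed.

Lemma decoef_rec beta kappa nu k : (2 <= k)%nat ->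
  decoef beta kappa k nu =
  - ((inner_conv (fun j => decoef beta kappa j nu) (fun j => ecoef beta kappa j nu) k +
      inner_conv (fun j => ecoef beta kappa j nu) (fun j => decoef beta kappa j nu) k +
      ddivisor beta k nu * ecoef beta kappa k nu) * / divisor beta k nu).
Proof.
intros Hk. rewrite (ecoef_rec _ _ _ _ Hk). destruct k as [|[|m]]; try lia.
unfold decoef at 1. cbn [coefs].
pose proof (coefs_eq beta kappa nu (S m)) as K. cbn [coefs] in K. rewrite K. clear K.
cbn [fst snd hd].
rewrite !rev_involutive, !dot_inner_conv. cbn [aopp amul ainv aadd aint Rarith].
unfold root_sum, root_sum_derive. cbn [aopp amul ainv aadd aint Rarith].
unfold divisor, ddivisor. rewrite INR_IZR_INZ.
replace (nu ^ S m * nu) with (nu ^ S (S m)) by (simpl; ring).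
replace ((/ nu) ^ S m * / nu) with ((/ nu) ^ S (S m)) by (simpl; ring).
reflexivity.
Qed.

(** The two end terms of the Cauchy product contain [f 0] and vanish. For the Taylor coefficients
    this is what makes the equation of order [k] linear in the coefficient of order [k]. *)
Lemma inner_conv_mult f k : (2 <= k)%nat -> f 0%nat = 0 -> PS_mult f f k = inner_conv f f k.
Proof.
intros Hk H0. destruct k as [|[|m]]; try lia. unfold PS_mult, inner_conv.
rewrite decomp_sum by lia. cbn [pred]. rewrite H0.
replace (S (S m) - 2)%nat with m by lia. cbn [sum_f_R0].
replace (S (S m) - S (S m))%nat with 0%nat by lia. rewrite H0.
rewrite Rmult_0_l, Rmult_0_r, Rplus_0_l, Rplus_0_r.
apply sum_eq. intros i Hi. rewrite Rmult_comm.
replace (S (S m) - S i)%nat with (S (S m) - 1 - i)%nat by lia. reflexivity.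
Qed.

(** Crude ranges around the two multipliers, about 3.858 and 1/12.86, joined in one predicate so
    that all estimates on coefficients are proved for both manifolds at once. *)
Definition admissible (beta nu : R) : Prop :=
  29/100 <= beta <= 31/100 /\ (3 <= nu <= 4 \/ / 13 <= nu <= / 12).

Lemma admissible_pos beta nu : admissible beta nu -> 0 < nu /\ / 4 <= / nu <= 13.
Proof.
intros [_ [H|H]]; assert (0 < nu) by lra; split; auto.
- split. apply Rinv_le_contravar; lra.
  rewrite <- (Rinv_inv 13). apply Rinv_le_contravar; lra.
- split. apply Rinv_le_contravar; lra.
  rewrite <- (Rinv_inv 13). apply Rinv_le_contravar; lra.
Qed.

(** Absence of resonance: the divisor factors as [(nu^k - nu) (nu^k - beta/nu) / nu^k], and for
    [k >= 2] the power [nu^k] is above both multipliers in the unstable case and below both in the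
    stable case. *)
Lemma divisor_pos beta nu k : admissible beta nu -> (2 <= k)%nat -> 0 < divisor beta k nu.
Proof.
intros Ha Hk. destruct (admissible_pos _ _ Ha) as [Hn Hi].
assert (Hp : 0 < nu ^ k) by (apply pow_lt; auto).
replace (divisor beta k nu) with ((nu ^ k - nu) * (nu ^ k - beta * / nu) * / nu ^ k).
2:{ unfold divisor. rewrite pow_inv. field. split; lra. }
apply Rmult_lt_0_compat. 2: apply Rinv_0_lt_compat, Hp.
destruct k as [|[|k]]; try lia. destruct Ha as [Hb [H|H]].
- pose proof (pow_R1_Rle nu k ltac:(lra)) as Q. change (nu ^ S (S k)) with (nu * (nu * nu ^ k)) in *.
  assert (nu <= nu * nu ^ k) by nra.
  assert (/ nu <= / 3) by (apply Rinv_le_contravar; lra).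
  apply Rmult_lt_0_compat; nra.
- assert (Q : nu ^ k <= 1) by (rewrite <- (pow1 k); apply pow_incr; lra).
  pose proof (pow_lt nu k Hn).
  change (nu ^ S (S k)) with (nu * (nu * nu ^ k)) in *.
  assert (nu * nu ^ k <= / 12) by nra.
  assert (12 <= / nu). { rewrite <- (Rinv_inv 12). apply Rinv_le_contravar; lra. }
  replace ((nu * (nu * nu ^ k) - nu) * (nu * (nu * nu ^ k) - beta * / nu)) with
   ((nu - nu * (nu * nu ^ k)) * (beta * / nu - nu * (nu * nu ^ k))) by ring.
  apply Rmult_lt_0_compat; nra.
Qed.

Lemma divisor_derive beta nu k : 0 < nu -> is_derive (divisor beta k) nu (ddivisor beta k nu).
Proof.
intros Hn. unfold divisor, ddivisor. auto_derive. lra.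
destruct k. simpl. field. lra.
simpl pred. simpl pow. rewrite !pow_inv. field. split. lra. apply pow_nonzero. lra.
Qed.

Lemma inner_conv_derive (f g df dg : nat -> R -> R) k nu : (2 <= k)%nat ->
  (forall j, (j < k)%nat -> is_derive (f j) nu (df j nu)) ->
  (forall j, (j < k)%nat -> is_derive (g j) nu (dg j nu)) ->
  is_derive (fun u => inner_conv (fun j => f j u) (fun j => g j u) k) nu
    (inner_conv (fun j => df j nu) (fun j => g j nu) k +
     inner_conv (fun j => f j nu) (fun j => dg j nu) k).
Proof.
intros Hk Hf Hg. unfold inner_conv. rewrite <- sum_plus.
assert (G : forall n, (n <= k - 2)%nat ->
  is_derive (fun u => sum_f_R0 (fun i => f (k - 1 - i)%nat u * g (S i) u) n) nu
   (sum_f_R0 (fun l => df (k - 1 - l)%nat nu * g (S l) nu + f (k - 1 - l)%nat nu * dg (S l) nu) n)).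
{ assert (K : forall i, (i <= k - 2)%nat -> is_derive (fun u => f (k - 1 - i)%nat u * g (S i) u) nu
    (df (k - 1 - i)%nat nu * g (S i) nu + f (k - 1 - i)%nat nu * dg (S i) nu)).
  { intros i Hi. apply (is_derive_mult (f (k - 1 - i)%nat) (g (S i))).
    apply Hf; lia. apply Hg; lia. intros; apply Rmult_comm. }
  induction n; intros Hn; simpl. apply K; lia.
  apply @is_derive_plus. apply IHn; lia. apply K; lia. }
apply G. lia.
Qed.

Lemma ecoef_derive i1 i2 beta kappa :
  (forall nu, i1 < nu < i2 -> admissible beta nu) ->
  forall k nu, i1 < nu < i2 -> is_derive (ecoef beta kappa k) nu (decoef beta kappa k nu).
Proof.
intros Ha k. induction k as [k IH] using (well_founded_induction lt_wf). intros nu Hnu.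
destruct k as [|[|k]];
  [exact (is_derive_const (0 : R) nu) | exact (is_derive_const kappa nu) |].
set (n := S (S k)) in *. assert (Hk : (2 <= n)%nat) by (unfold n; lia).
assert (HD := divisor_pos _ _ n (Ha nu Hnu) Hk).
destruct (admissible_pos _ _ (Ha nu Hnu)) as [Hn _].
apply (is_derive_ext_loc (fun u => - (inner_conv (fun j => ecoef beta kappa j u)
   (fun j => ecoef beta kappa j u) n * / divisor beta n u))).
{ apply filter_forall. intros u. symmetry. apply ecoef_rec, Hk. }
assert (D1 := inner_conv_derive (ecoef beta kappa) (ecoef beta kappa) (decoef beta kappa)
  (decoef beta kappa) n nu Hk (fun j Hj => IH j Hj nu Hnu) (fun j Hj => IH j Hj nu Hnu)).
assert (D2 := is_derive_inv _ _ _ (divisor_derive beta nu n Hn) ltac:(lra)).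
assert (D3 := is_derive_mult _ _ nu _ _ D1 D2 (fun a b => Rmult_comm a b)).
apply @is_derive_opp in D3.
match type of D3 with is_derive _ _ ?v => replace (decoef beta kappa n nu) with v end.
- exact D3.
- rewrite (decoef_rec _ _ _ _ Hk). rewrite (ecoef_rec beta kappa nu n Hk) at 1.
  unfold opp, plus, mult; simpl. field. lra.
Qed.

Lemma inner_conv_bound f g A B q k : (2 <= k)%nat -> 0 <= A -> 0 <= q ->
  (forall j, (j < k)%nat -> Rabs (f j) <= A * q ^ j) ->
  (forall j, (j < k)%nat -> Rabs (g j) <= B * q ^ j) ->
  Rabs (inner_conv f g k) <= INR (k - 1) * (A * B * q ^ k).
Proof.
intros Hk HA Hq Hf Hg. unfold inner_conv.
eapply Rle_trans. apply sum_f_R0_triangle.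
replace (INR (k - 1)) with (INR (S (k - 2))) by (f_equal; lia).
rewrite Rmult_comm, <- sum_cte.
apply sum_Rle. intros i Hi. rewrite Rabs_mult.
replace (A * B * q ^ k) with ((A * q ^ (k - 1 - i)) * (B * q ^ S i)).
- apply Rmult_le_compat; try apply Rabs_pos. apply Hf; lia. apply Hg; lia.
- replace (q ^ k) with (q ^ (k - 1 - i) * q ^ S i) by (rewrite <- pow_add; f_equal; lia). ring.
Qed.

Lemma pow3_lower k : (21 <= k)%nat -> 16777216 * INR k <= 3 ^ k.
Proof.
induction 1 as [|k Hk IH].
- rewrite INR_IZR_INZ. simpl Z.of_nat. lra.
- rewrite S_INR. simpl pow. assert (21 <= INR k) by (apply (le_INR 21) in Hk; simpl in Hk; lra). lra.
Qed.

Lemma pow2_lower k : (21 <= k)%nat -> 32 * INR k <= 2 ^ k.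
Proof.
induction 1 as [|k Hk IH].
- rewrite INR_IZR_INZ. simpl Z.of_nat. lra.
- rewrite S_INR. simpl pow. assert (21 <= INR k) by (apply (le_INR 21) in Hk; simpl in Hk; lra). lra.
Qed.

Lemma divisor_sum_lower beta nu k : admissible beta nu -> (21 <= k)%nat ->
  3 ^ k <= nu ^ k + beta * (/ nu) ^ k.
Proof.
intros Ha Hk. destruct (admissible_pos _ _ Ha) as [Hn Hi].
pose proof (pow_lt nu k Hn). pose proof (pow_lt (/ nu) k ltac:(lra)).
destruct Ha as [Hb [H'|H']].
- assert (3 ^ k <= nu ^ k) by (apply pow_incr; lra). nra.
- assert (12 <= / nu). { rewrite <- (Rinv_inv 12). apply Rinv_le_contravar; lra. }
  assert (12 ^ k <= (/ nu) ^ k) by (apply pow_incr; lra).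
  (* The spare factor [4 ^ k] compensates for the small [beta]. *)
  replace 12 with (3 * 4) in H2 by ring. rewrite Rpow_mult_distr in H2.
  pose proof (pow_lt 3 k ltac:(lra)).
  assert (4 <= 4 ^ k). { replace 4 with (4 ^ 1) at 1 by ring. apply Rle_pow; try lra. lia. }
  nra.
Qed.

(** The leading part of the divisor differentiates to at most [k / nu <= 13 k] times itself; passing
    from 13 to 16 absorbs the lower-order terms, as the divisor exceeds 1000. *)
Lemma divisor_bounds beta nu k : admissible beta nu -> (21 <= k)%nat ->
  4194304 * INR (k - 1) <= divisor beta k nu /\
  Rabs (ddivisor beta k nu) <= 16 * INR k * divisor beta k nu.
Proof.
intros Ha Hk. destruct (admissible_pos _ _ Ha) as [Hn Hi].
pose proof (divisor_sum_lower _ _ _ Ha Hk) as L. pose proof (pow3_lower k Hk) as L3.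
assert (Hp : 0 < nu ^ k) by (apply pow_lt; auto).
assert (Hq : 0 < (/ nu) ^ k) by (apply pow_lt; lra).
assert (Hb : 29/100 <= beta <= 31/100) by apply Ha.
assert (HK : 21 <= INR k) by (apply (le_INR 21) in Hk; simpl in Hk; lra).
assert (Tr : nu + beta * / nu <= 9) by (destruct Ha as [_ [?|?]]; nra).
rewrite minus_INR by lia. change (INR 1) with 1.
split. unfold divisor. lra.
assert (Tb : 0 <= beta * (/ nu * / nu) <= 60).
{ assert (0 <= / nu * / nu <= 169) by nra. nra. }
set (Q := beta * (/ nu) ^ k) in *. assert (HQ : 0 < Q) by (unfold Q; apply Rmult_lt_0_compat; lra).
assert (HD : nu ^ k + Q <= divisor beta k nu + 9) by (unfold divisor; fold Q; lra).
assert (HD2 : 1000 <= divisor beta k nu) by (unfold divisor; fold Q; lra).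
unfold ddivisor. fold Q. unfold Rminus at 1. eapply Rle_trans. apply Rabs_triang.
rewrite Rabs_mult, Rabs_mult, (Rabs_pos_eq (INR k)), (Rabs_pos_eq (/ nu)) by lra.
assert (A1 : Rabs (nu ^ k - Q) <= divisor beta k nu + 9) by (apply Rabs_le_between; lra).
assert (A2 : Rabs (- (1 - beta * (/ nu * / nu))) <= 60) by (apply Rabs_le_between; lra).
assert (A3 : INR k * / nu * Rabs (nu ^ k - Q) <= INR k * 13 * (divisor beta k nu + 9)).
{ apply Rmult_le_compat; try apply Rabs_pos; auto.
  apply Rmult_le_pos; lra. apply Rmult_le_compat_l; lra. }
nra.
Qed.

(** The constant is 2^20. The derivative gets the slower rate 1/8 because differentiating the
    divisor costs a factor of order [k], which the quotient [2 ^ k] of the two rates pays for. *)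
Definition head_bounds (beta kappa nu : R) : Prop :=
  forall k, (k <= 20)%nat -> Rabs (ecoef beta kappa k nu) <= 1048576 * (/ 16) ^ k /\
    Rabs (decoef beta kappa k nu) <= 1048576 * (/ 8) ^ k.

Definition bounded_coefs (beta kappa nu : R) : Prop :=
  forall k, Rabs (ecoef beta kappa k nu) <= 1048576 * (/ 16) ^ k /\
    Rabs (decoef beta kappa k nu) <= 1048576 * (/ 8) ^ k.

(* Beyond degree 20 the divisors exceed 2^22 (k - 1), which absorbs the quadratic
   convolution of bounds with constant 2^20. *)
Lemma coef_bounds beta kappa nu :
  admissible beta nu -> head_bounds beta kappa nu -> bounded_coefs beta kappa nu.
Proof.
intros Ha Hh k. induction k as [k IH] using (well_founded_induction lt_wf).
destruct (Nat.le_gt_cases k 20) as [H20|H20]. apply Hh, H20.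
set (K := 1048576) in *.
assert (Hk : (2 <= k)%nat) by lia.
destruct (divisor_bounds beta nu k Ha ltac:(lia)) as [D1 D2].
assert (HD := divisor_pos beta nu k Ha Hk).
set (D := divisor beta k nu) in *.
assert (P16 : 0 < (/ 16) ^ k) by (apply pow_lt; lra).
assert (P8 : 0 < (/ 8) ^ k) by (apply pow_lt; lra).
assert (P816 : (/ 8) ^ k = 2 ^ k * (/ 16) ^ k) by (rewrite <- Rpow_mult_distr; f_equal; field).
assert (P2 := pow2_lower k ltac:(lia)).
assert (B1 : Rabs (ecoef beta kappa k nu) <= K * (/ 16) ^ k).
{ rewrite ecoef_rec by exact Hk. fold D.
  rewrite Rabs_Ropp, Rabs_mult, Rabs_inv, (Rabs_pos_eq D) by lra.
  apply (Rmult_le_reg_r D). exact HD. rewrite Rmult_assoc, Rinv_l, Rmult_1_r by lra.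
  eapply Rle_trans. apply (inner_conv_bound _ _ K K (/ 16)); auto; try (unfold K; lra).
  intros j Hj; apply IH, Hj. intros j Hj; apply IH, Hj.
  pose proof (pos_INR (k - 1)). unfold K.
  replace (INR (k - 1) * (1048576 * 1048576 * (/ 16) ^ k)) with
    (1048576 * (/ 16) ^ k * (1048576 * INR (k - 1))) by ring.
  apply Rmult_le_compat_l; lra. }
split. exact B1.
assert (W : forall j, (j < k)%nat -> Rabs (ecoef beta kappa j nu) <= K * (/ 8) ^ j).
{ intros j Hj. eapply Rle_trans. apply IH, Hj. apply Rmult_le_compat_l. unfold K; lra.
  apply pow_incr. lra. }
assert (W' : forall j, (j < k)%nat -> Rabs (decoef beta kappa j nu) <= K * (/ 8) ^ j).
{ intros j Hj. apply IH, Hj. }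
rewrite decoef_rec by exact Hk. fold D.
rewrite Rabs_Ropp, Rabs_mult, Rabs_inv, (Rabs_pos_eq D) by lra.
apply (Rmult_le_reg_r D). exact HD. rewrite Rmult_assoc, Rinv_l, Rmult_1_r by lra.
assert (C1 := inner_conv_bound _ _ K K (/ 8) k Hk ltac:(unfold K; lra) ltac:(lra) W W').
assert (C2 := inner_conv_bound _ _ K K (/ 8) k Hk ltac:(unfold K; lra) ltac:(lra) W' W).
cbv beta in C1, C2.
assert (C3 : Rabs (ddivisor beta k nu * ecoef beta kappa k nu) <=
  16 * INR k * D * (K * (/ 16) ^ k)).
{ rewrite Rabs_mult. apply Rmult_le_compat; auto; apply Rabs_pos. }
eapply Rle_trans. apply Rabs_triang.
eapply Rle_trans. apply Rplus_le_compat_r, Rabs_triang.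
(* The budget [D * (K * (/ 8) ^ k)] is shared out: one half to the derivative of the divisor, by
   [32 k <= 2^k], and one quarter to each of the two convolutions. *)
assert (C4 : 16 * INR k * D * (K * (/ 16) ^ k) <= / 2 * D * (K * (/ 8) ^ k)).
{ rewrite P816. replace (/ 2 * D * (K * (2 ^ k * (/ 16) ^ k))) with
   (/ 2 * 2 ^ k * (D * (K * (/ 16) ^ k))) by ring.
  replace (16 * INR k * D * (K * (/ 16) ^ k)) with (16 * INR k * (D * (K * (/ 16) ^ k))) by ring.
  apply Rmult_le_compat_r. repeat apply Rmult_le_pos; unfold K; lra. lra. }
assert (C5 : INR (k - 1) * (K * K * (/ 8) ^ k) <= / 4 * D * (K * (/ 8) ^ k)).
{ replace (INR (k - 1) * (K * K * (/ 8) ^ k)) with (K * INR (k - 1) * (K * (/ 8) ^ k)) by ring.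
  apply Rmult_le_compat_r. apply Rmult_le_pos; unfold K; lra. unfold K; lra. }
lra.
Qed.

(** * Dynamics on the invariant manifolds *)

Definition fixp (beta nu : R) : R := - (nu + beta * / nu) / 2.
Definition dfixp (beta nu : R) : R := - (1 - beta * (/ nu * / nu)) / 2.
Definition E0 (beta kappa nu t : R) : R := PSeries (fun k => ecoef beta kappa k nu) t.
Definition E1 (beta kappa nu t : R) : R := PSeries (PS_derive (fun k => ecoef beta kappa k nu)) t.
Definition E2 (beta kappa nu t : R) : R :=
  PSeries (PS_derive (PS_derive (fun k => ecoef beta kappa k nu))) t.
Definition En (beta kappa nu t : R) : R := PSeries (fun k => decoef beta kappa k nu) t.
Definition X (beta kappa nu t : R) : R := fixp beta nu + E0 beta kappa nu t.
Definition curve (beta kappa nu w : R) : R * R :=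
  (X beta kappa nu (nu * w), X beta kappa nu w).
(* the parameter a for which nu is a multiplier of the fixed point, when b = - beta *)
Definition param (beta nu : R) : R :=
  fixp beta nu + fixp beta nu ^ 2 + beta * fixp beta nu.

(** Invariance of the curve after subtraction of the fixed point. At each order the square
    contributes [- divisor * e_k], which is what the recursion prescribes; the bounds [< 16] keep
    all three arguments within the guaranteed radius of convergence. *)
Lemma functional_equation beta kappa nu s :
  admissible beta nu -> bounded_coefs beta kappa nu ->
  Rabs s < 16 -> Rabs (nu * s) < 16 -> Rabs (s * / nu) < 16 ->
  E0 beta kappa nu (nu * s) + beta * E0 beta kappa nu (s * / nu) + E0 beta kappa nu s ^ 2 =
  (nu + beta * / nu) * E0 beta kappa nu s.
Proof.
intros Ha Hc H1 H2 H3. destruct (admissible_pos _ _ Ha) as [Hn _].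
set (e := fun k => ecoef beta kappa k nu).
assert (He : forall k, Rabs (e k) <= 1048576 * (/ 16) ^ k) by (intros k; apply Hc).
assert (Ex : forall t, Rabs t < 16 -> ex_series (fun k => e k * t ^ k)).
{ intros t Ht. apply (geometric_tail _ 1048576 (/ 16 * Rabs t) 0).
  pose proof (Rabs_pos t). lra. intros k _. apply coef_pow_bound. apply He. apply Rle_refl. }
assert (Sq : E0 beta kappa nu s ^ 2 = Series (fun k => - (divisor beta k nu * e k) * s ^ k)).
{ assert (CV : Rbar_lt (Rabs s) (CV_radius e)).
  { apply (CV_radius_geometric _ 1048576 (/ 16)); auto; lra. }
  replace (E0 beta kappa nu s ^ 2) with (PSeries e s * PSeries e s) by (unfold E0, e; ring).
  rewrite <- PSeries_mult by exact CV. unfold PSeries. apply Series_ext. intros k. f_equal.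
  (* The recursion starts at order 2. Order 0 holds as [e_0 = 0], and order 1 because the divisor
     vanishes there, whatever [kappa] is. *)
  destruct k as [|[|k]].
  - unfold PS_mult, e; simpl. rewrite ecoef_0. ring.
  - unfold PS_mult, e; simpl. rewrite ecoef_0, ecoef_1. unfold divisor. field. lra.
  - rewrite inner_conv_mult; [|lia|reflexivity].
    assert (D := divisor_pos beta nu (S (S k)) Ha ltac:(lia)).
    assert (Rk : e (S (S k)) = - (inner_conv e e (S (S k)) * / divisor beta (S (S k)) nu))
      by (apply ecoef_rec; lia).
    rewrite Rk. field. lra. }
assert (A1 : E0 beta kappa nu (nu * s) = Series (fun k => e k * (nu ^ k) * s ^ k)).
{ unfold E0, PSeries. apply Series_ext. intros k. rewrite Rpow_mult_distr. unfold e. ring. }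
assert (A2 : beta * E0 beta kappa nu (s * / nu) = Series (fun k => beta * (e k * (s * / nu) ^ k))).
{ unfold E0, PSeries. rewrite <- Series_scal_l. reflexivity. }
assert (A3 : (nu + beta * / nu) * E0 beta kappa nu s =
  Series (fun k => (nu + beta * / nu) * (e k * s ^ k))).
{ unfold E0, PSeries. rewrite <- Series_scal_l. reflexivity. }
assert (X1 : ex_series (fun k => e k * (nu ^ k) * s ^ k)).
{ apply (ex_series_ext (fun k => e k * (nu * s) ^ k)); auto.
  intros k. rewrite Rpow_mult_distr. symmetry. apply Rmult_assoc. }
assert (X2 : ex_series (fun k => beta * (e k * (s * / nu) ^ k))).
{ apply (ex_series_scal_l beta (fun k => e k * (s * / nu) ^ k)). auto. }
assert (X3 : ex_series (fun k => (nu + beta * / nu) * (e k * s ^ k))).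
{ apply (ex_series_scal_l (nu + beta * / nu) (fun k => e k * s ^ k)). auto. }
assert (S12 : E0 beta kappa nu (nu * s) + beta * E0 beta kappa nu (s * / nu) =
  Series (fun k => e k * (nu ^ k) * s ^ k + beta * (e k * (s * / nu) ^ k))).
{ rewrite A1, A2, Series_plus; auto. }
assert (X12 : ex_series (fun k => e k * (nu ^ k) * s ^ k + beta * (e k * (s * / nu) ^ k))).
{ apply (ex_series_plus (fun k => e k * (nu ^ k) * s ^ k)); auto. }
assert (Sq' : E0 beta kappa nu s ^ 2 = Series (fun k => (nu + beta * / nu) * (e k * s ^ k) -
   (e k * (nu ^ k) * s ^ k + beta * (e k * (s * / nu) ^ k)))).
{ rewrite Sq. apply Series_ext. intros k. unfold divisor. rewrite Rpow_mult_distr. ring. }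
rewrite Series_minus, <- A3, <- S12 in Sq' by auto. lra.
Qed.

Lemma henon_curve beta kappa nu w :
  admissible beta nu -> nu <= 1 -> bounded_coefs beta kappa nu -> Rabs w < 16 ->
  henon (param beta nu) (- beta) (curve beta kappa nu w) = curve beta kappa nu (nu * w).
Proof.
intros Ha Hle Hc Hw. destruct (admissible_pos _ _ Ha) as [Hn _].
assert (H1 : Rabs (nu * w) < 16).
{ rewrite Rabs_mult, (Rabs_pos_eq nu) by lra. pose proof (Rabs_pos w). nra. }
assert (H2 : Rabs (nu * (nu * w)) < 16).
{ rewrite Rabs_mult, (Rabs_pos_eq nu) by lra. pose proof (Rabs_pos (nu * w)). nra. }
assert (E : nu * w * / nu = w) by (field; lra).
assert (F := functional_equation beta kappa nu (nu * w) Ha Hc H1 H2 ltac:(rewrite E; lra)).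
rewrite E in F. unfold henon, curve. cbn [fst snd]. f_equal.
unfold X, param. assert (T : nu + beta * / nu = - 2 * fixp beta nu) by (unfold fixp; field; lra).
rewrite T in F. nra.
Qed.

(** Along the unstable manifold the expanding point [nu * w] enters the functional equation, so
    [nu <= 4] cuts the radius 16 down to 4. *)
Lemma henon_inv_curve beta kappa nu w :
  admissible beta nu -> 3 <= nu -> bounded_coefs beta kappa nu -> Rabs w < 4 ->
  henon_inv (param beta nu) (- beta) (curve beta kappa nu w) = curve beta kappa nu (/ nu * w).
Proof.
intros Ha Hge Hc Hw. destruct (admissible_pos _ _ Ha) as [Hn _].
assert (Hb : 0 < beta) by (destruct Ha; lra).
assert (Hn4 : nu <= 4) by (destruct Ha as [_ [?|?]]; lra).
assert (Hi : / nu <= 1) by (rewrite <- Rinv_1; apply Rinv_le_contravar; lra).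
assert (Hi0 : 0 < / nu) by (apply Rinv_0_lt_compat; lra).
assert (H1 : Rabs (nu * w) < 16).
{ rewrite Rabs_mult, (Rabs_pos_eq nu) by lra. pose proof (Rabs_pos w). nra. }
assert (H2 : Rabs (w * / nu) < 16).
{ rewrite Rabs_mult, (Rabs_pos_eq (/ nu)) by lra. pose proof (Rabs_pos w). nra. }
assert (F := functional_equation beta kappa nu w Ha Hc ltac:(lra) H1 H2).
unfold henon_inv, curve. cbn [fst snd].
replace (nu * (/ nu * w)) with w by (field; lra). f_equal.
rewrite (Rmult_comm (/ nu) w).
apply (Rmult_eq_reg_r (- beta)); [|lra].
unfold Rdiv. rewrite Rmult_assoc, Rinv_l, Rmult_1_r by lra.
unfold X, param. assert (T : nu + beta * / nu = - 2 * fixp beta nu) by (unfold fixp; field; lra).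
rewrite T in F. nra.
Qed.

Lemma iter_scaled_curve (F : R * R -> R * R) beta kappa nu r rho n :
  0 <= r <= 1 ->
  (forall w, Rabs w < rho -> F (curve beta kappa nu w) = curve beta kappa nu (r * w)) ->
  forall w, Rabs w < rho ->
  Nat.iter n F (curve beta kappa nu w) = curve beta kappa nu (r ^ n * w).
Proof.
intros Hr HF w Hw. induction n; simpl.
- rewrite Rmult_1_l. reflexivity.
- rewrite IHn, HF. f_equal. ring.
  rewrite Rabs_mult, (Rabs_pos_eq (r ^ n)) by (apply pow_le; lra).
  assert (r ^ n <= 1) by (rewrite <- (pow1 n); apply pow_incr; lra).
  pose proof (Rabs_pos w). pose proof (pow_le r n ltac:(lra)). nra.
Qed.

Lemma dist2_lt_of_coordinates x y p q eta :
  Rabs (x - p) < eta / 2 -> Rabs (y - q) < eta / 2 -> dist2 (x, y) (p, q) < eta.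
Proof.
intros H1 H2. unfold dist2. cbn [fst snd].
pose proof (Rabs_pos (x - p)). assert (0 < eta) by lra.
rewrite <- (sqrt_Rsqr eta) by lra. apply sqrt_lt_1.
- pose proof (pow2_ge_0 (x - p)). pose proof (pow2_ge_0 (y - q)). lra.
- apply Rle_0_sqr.
- unfold Rsqr. rewrite <- (pow2_abs (x - p)), <- (pow2_abs (y - q)).
  pose proof (Rabs_pos (y - q)). nra.
Qed.

Lemma curve_contraction beta kappa nu r eta :
  admissible beta nu -> bounded_coefs beta kappa nu -> 0 <= r < 1 -> 0 < eta ->
  exists N, forall n, (N <= n)%nat -> forall w, Rabs w < 4 ->
    dist2 (curve beta kappa nu (r ^ n * w)) (fixp beta nu, fixp beta nu) < eta.
Proof.
intros Ha Hc Hr Heta. destruct (admissible_pos _ _ Ha) as [Hn _].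
assert (Hn4 : nu <= 4).
{ destruct Ha as [_ [?|[? H]]]; [lra|].
  assert (/ 12 <= 1) by (rewrite <- Rinv_1; apply Rinv_le_contravar; lra). lra. }
assert (C : continuity_pt (E0 beta kappa nu) 0).
{ apply PSeries_continuity. apply (CV_radius_geometric _ 1048576 (/ 16)). lra. apply Hc.
  rewrite Rabs_R0. lra. }
destruct (C (eta / 2) ltac:(lra)) as [d [Hd Hcd]]. simpl in Hcd. unfold Rdist in Hcd.
assert (Z0 : E0 beta kappa nu 0 = 0) by (unfold E0; rewrite PSeries_0; reflexivity).
assert (Hcd' : forall t, Rabs t < d -> Rabs (E0 beta kappa nu t) < eta / 2).
{ intros t Ht. destruct (Req_dec t 0) as [->|Hne].
  - rewrite Z0, Rabs_R0. lra.
  - rewrite <- (Rminus_0_r (E0 beta kappa nu t)), <- Z0. apply Hcd. split.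
    split; [exact I | auto]. rewrite Rminus_0_r. exact Ht. }
(* The 16 covers [|w| < 4] times [nu <= 4] in the first coordinate. *)
destruct (pow_lt_1_zero r ltac:(rewrite Rabs_pos_eq; lra) (d / 16)) as [N HN]. lra.
exists N. intros n Hn' w Hw. specialize (HN n Hn').
unfold curve, X. apply dist2_lt_of_coordinates.
- match goal with |- Rabs (?a + ?b - ?a) < _ => replace (a + b - a) with b by ring end.
  apply Hcd'. rewrite !Rabs_mult, (Rabs_pos_eq nu) by lra.
  pose proof (Rabs_pos w). pose proof (Rabs_pos (r ^ n)).
  assert (Rabs (r ^ n) * Rabs w <= Rabs (r ^ n) * 4) by nra. nra.
- match goal with |- Rabs (?a + ?b - ?a) < _ => replace (a + b - a) with b by ring end.
  apply Hcd'. rewrite !Rabs_mult.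
  pose proof (Rabs_pos w). pose proof (Rabs_pos (r ^ n)). nra.
Qed.

(** The discriminant is the square of [2 * fixp + 1 + beta], which is negative because the sum of
    the multipliers is at least 3. This selects the root with the minus sign, the one in the
    definition of [fix_x]. *)
Lemma fix_x_param beta nu : admissible beta nu -> fix_x (param beta nu) (- beta) = fixp beta nu.
Proof.
intros Ha. destruct (admissible_pos _ _ Ha) as [Hn Hi].
assert (T : 3 <= nu + beta * / nu).
{ destruct Ha as [Hb [?|?]]. nra.
  assert (12 <= / nu). { rewrite <- (Rinv_inv 12). apply Rinv_le_contravar; lra. } nra. }
assert (Hb : beta <= 31/100) by apply Ha.
unfold fix_x.
replace ((- beta - 1) ^ 2 + 4 * param beta nu) with ((- (2 * fixp beta nu + 1 + beta))²)
  by (unfold param, Rsqr; ring).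
rewrite sqrt_Rsqr.
- field.
- unfold fixp. lra.
Qed.

(** Both coefficient families are treated at the weaker rate 1/8; radius 4 is then the largest with
    [2 * theta * rho <= 1]. *)
Lemma X_fiberwise_C2 beta kappa i1 i2 :
  (forall nu, i1 < nu < i2 -> admissible beta nu /\ bounded_coefs beta kappa nu) ->
  fiberwise_C2 i1 i2 (-4) 4 (E0 beta kappa) (En beta kappa) (E1 beta kappa) (E2 beta kappa).
Proof.
intros H.
apply (PSeries_fiberwise_C2 i1 i2 1048576 (/ 8) 4 (ecoef beta kappa) (decoef beta kappa)).
- lra.
- lra.
- intros k nu Hnu. eapply Rle_trans. apply (H nu Hnu).
  apply Rmult_le_compat_l. lra. apply pow_incr. lra.
- intros k nu Hnu. apply (H nu Hnu).
- intros k nu Hnu. apply (ecoef_derive i1 i2); auto. intros; apply H; auto.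
Qed.

(** * Regularity of the manifolds as families of graphs *)

Lemma fixp_derive beta nu : 0 < nu -> is_derive (fixp beta) nu (dfixp beta nu).
Proof.
intros Hn. unfold fixp, dfixp. auto_derive. lra. field. lra.
Qed.

Lemma differentiable_pt_lim_fst f x y l :
  is_derive f x l -> differentiable_pt_lim (fun u _ => f u) x y l 0.
Proof. intros H. apply differentiable_pt_lim_proj1_0, is_derive_Reals, H. Qed.

Lemma differentiable_pt_lim_lin f g x y fx fy gx gy p q :
  differentiable_pt_lim f x y fx fy -> differentiable_pt_lim g x y gx gy ->
  differentiable_pt_lim (fun u v => p * f u v + q * g u v) x y
    (p * fx + q * gx) (p * fy + q * gy).
Proof.
intros Hf Hg.
apply (differentiable_pt_lim_comp (fun s t => p * s + q * t) f g x y p q fx fy gx gy); auto.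
intros eps. exists (mkposreal 1 Rlt_0_1). intros u v _ _.
match goal with |- Rabs ?z <= _ => replace z with 0 by ring end. rewrite Rabs_R0.
apply Rmult_le_pos. left; apply cond_pos.
eapply Rle_trans. apply Rabs_pos. apply Rmax_l.
Qed.

Lemma fiberwise_C2_shift i1 i2 j1 j2 f f1 f2 f22 p dp :
  fiberwise_C2 i1 i2 j1 j2 f f1 f2 f22 ->
  (forall x, i1 < x < i2 -> is_derive p x (dp x)) ->
  fiberwise_C2 i1 i2 j1 j2 (fun x y => p x + f x y) (fun x y => dp x + f1 x y) f2 f22.
Proof.
intros H Hp x y Hx Hy. destruct (H x y Hx Hy) as [H1 H2]. split; auto.
pose proof (differentiable_pt_lim_lin _ _ x y _ _ _ _ 1 1
  (differentiable_pt_lim_fst p x y _ (Hp x Hx)) H1) as K.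
replace (1 * dp x + 1 * f1 x y) with (dp x + f1 x y) in K by ring.
replace (1 * 0 + 1 * f2 x y) with (f2 x y) in K by ring.
revert K. apply differentiable_pt_lim_ext. apply locally_2d_forall. intros; ring.
Qed.

Lemma fiberwise_C2_minus i1 i2 j1 j2 f f1 f2 f22 g g1 g2 g22 :
  fiberwise_C2 i1 i2 j1 j2 f f1 f2 f22 ->
  fiberwise_C2 i1 i2 j1 j2 g g1 g2 g22 ->
  fiberwise_C2 i1 i2 j1 j2 (fun x y => f x y - g x y) (fun x y => f1 x y - g1 x y)
    (fun x y => f2 x y - g2 x y) (fun x y => f22 x y - g22 x y).
Proof.
intros Hf Hg x y Hx Hy.
destruct (Hf x y Hx Hy) as [F1 [F2 F3]]. destruct (Hg x y Hx Hy) as [G1 [G2 G3]].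
split; [|split].
- pose proof (differentiable_pt_lim_lin _ _ x y _ _ _ _ 1 (-1) F1 G1) as K.
  replace (1 * f1 x y + -1 * g1 x y) with (f1 x y - g1 x y) in K by ring.
  replace (1 * f2 x y + -1 * g2 x y) with (f2 x y - g2 x y) in K by ring.
  revert K. apply differentiable_pt_lim_ext. apply locally_2d_forall. intros; ring.
- apply continuity_2d_pt_minus; auto.
- apply @is_derive_minus; auto.
Qed.

Lemma fiberwise_C2_reparam i1 i2 k1 k2 j1 j2 f f1 f2 f22 m dm :
  fiberwise_C2 i1 i2 j1 j2 f f1 f2 f22 ->
  (forall x, k1 < x < k2 -> i1 < m x < i2 /\ is_derive m x (dm x)) ->
  fiberwise_C2 k1 k2 j1 j2 (fun x y => f (m x) y) (fun x y => f1 (m x) y * dm x)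
    (fun x y => f2 (m x) y) (fun x y => f22 (m x) y).
Proof.
intros H Hm x y Hx Hy. destruct (Hm x Hx) as [Hmx Hdm].
destruct (H (m x) y Hmx Hy) as [F1 [F2 F3]]. split; [|split]; auto.
- pose proof (differentiable_pt_lim_fst m x y _ Hdm) as K1.
  assert (K2 : differentiable_pt_lim (fun _ v => v) x y 0 1).
  { intros eps. exists (mkposreal 1 Rlt_0_1). intros u v _ _.
    match goal with |- Rabs ?z <= _ => replace z with 0 by ring end. rewrite Rabs_R0.
    apply Rmult_le_pos. left; apply cond_pos.
    eapply Rle_trans. apply Rabs_pos. apply Rmax_l. }
  pose proof (differentiable_pt_lim_comp f (fun u _ => m u) (fun _ v => v) x y _ _ _ _ _ _ F1 K1 K2) as K.
  match type of K with differentiable_pt_lim _ _ _ ?p ?q =>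
    replace p with (f1 (m x) y * dm x) in K by ring;
    replace q with (f2 (m x) y) in K by ring end.
  exact K.
- apply (continuity_2d_pt_comp f2 (fun u _ => m u) (fun _ v => v)); auto.
  apply (continuity_1d_2d_pt_comp m (fun u _ => u)). eapply is_derive_continuity_pt, Hdm.
  apply continuity_2d_pt_id1. apply continuity_2d_pt_id2.
Qed.

(** Covers the first coordinate of [curve], where the multiplier enters through the coefficients and
    through the argument [nu * w]. *)
Lemma fiberwise_C2_scaled i1 i2 j1 j2 k1 k2 f f1 f2 f22 :
  fiberwise_C2 i1 i2 k1 k2 f f1 f2 f22 ->
  (forall x y, i1 < x < i2 -> j1 < y < j2 -> k1 < x * y < k2) ->
  fiberwise_C2 i1 i2 j1 j2 (fun x y => f x (x * y))
    (fun x y => f1 x (x * y) + y * f2 x (x * y))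
    (fun x y => x * f2 x (x * y)) (fun x y => x * x * f22 x (x * y)).
Proof.
intros H Hk x y Hx Hy. destruct (H x (x * y) Hx (Hk x y Hx Hy)) as [F1 [F2 F3]].
assert (CM : continuity_2d_pt (fun u v => u * v) x y).
{ apply continuity_2d_pt_mult. apply continuity_2d_pt_id1. apply continuity_2d_pt_id2. }
assert (DL : is_derive (fun v => x * v) y x).
{ auto_derive; auto. ring. }
assert (DM : differentiable_pt_lim (fun u v => u * v) x y y x).
{ apply (differentiable_pt_lim_of_partials (fun u v => u * v) (fun u v => u)).
  - apply locally_2d_forall. intros u v. auto_derive; auto. ring.
  - apply continuity_2d_pt_id1.
  - auto_derive; auto. ring. }
split; [|split].
- pose proof (differentiable_pt_lim_fst (fun u => u) x y 1 (is_derive_id x)) as K1.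
  pose proof (differentiable_pt_lim_comp f (fun u _ => u) (fun u v => u * v) x y _ _ _ _ _ _ F1 K1 DM) as K.
  match type of K with differentiable_pt_lim _ _ _ ?p ?q =>
    replace p with (f1 x (x * y) + y * f2 x (x * y)) in K by ring;
    replace q with (x * f2 x (x * y)) in K by ring end.
  exact K.
- apply continuity_2d_pt_mult. apply continuity_2d_pt_id1.
  apply continuity_2d_pt_comp; auto. apply continuity_2d_pt_id1.
- replace (x * x * f22 x (x * y)) with (x * (x * f22 x (x * y))) by ring.
  apply (is_derive_scal (fun v => f2 x (x * v)) y x).
  exact (is_derive_comp (f2 x) (fun v => x * v) y _ _ F3 DL).
Qed.

(** For the graph x = h(nu, y) traced by [curve], [slope] and [bend] are the first two y-derivatives
    and [drift] is the nu-derivative at fixed y. They are expressed in the curve parameter [w], so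
    that intervals can be inserted without computing the inverse of [X]. *)
Definition slope (beta kappa nu w : R) : R :=
  nu * E1 beta kappa nu (nu * w) / E1 beta kappa nu w.
Definition bend (beta kappa nu w : R) : R :=
  (nu * nu * E2 beta kappa nu (nu * w) * E1 beta kappa nu w -
   nu * E1 beta kappa nu (nu * w) * E2 beta kappa nu w) / E1 beta kappa nu w ^ 3.
Definition drift (beta kappa nu w : R) : R :=
  dfixp beta nu + (En beta kappa nu (nu * w) + w * E1 beta kappa nu (nu * w)) -
  nu * E1 beta kappa nu (nu * w) * (dfixp beta nu + En beta kappa nu w) / E1 beta kappa nu w.

(** The last conclusion is the link to numerics: the inverse [Z] is never computed, but it is
    located between any two parameters whose second coordinates bracket [y]. *)
Lemma manifold_graph beta kappa i1 i2 w1 w2 y1 y2 :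
  (forall nu, i1 < nu < i2 -> admissible beta nu /\ bounded_coefs beta kappa nu) ->
  -4 < w1 -> w1 < w2 -> w2 < 4 ->
  (forall nu w, i1 < nu < i2 -> w1 <= w <= w2 -> -4 < nu * w < 4 /\ 0 < E1 beta kappa nu w) ->
  (forall nu, i1 < nu < i2 -> X beta kappa nu w1 < y1 /\ y2 < X beta kappa nu w2) ->
  let Z := fiber_inverse (X beta kappa) w1 w2 in
  fiberwise_C2 i1 i2 y1 y2 (fun nu y => X beta kappa nu (nu * Z nu y))
    (fun nu y => drift beta kappa nu (Z nu y))
    (fun nu y => slope beta kappa nu (Z nu y))
    (fun nu y => bend beta kappa nu (Z nu y)) /\
  (forall nu y, i1 < nu < i2 -> y1 < y < y2 ->
     w1 < Z nu y < w2 /\ X beta kappa nu (Z nu y) = y) /\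
  (forall nu y u v, i1 < nu < i2 -> y1 < y < y2 -> w1 < u < w2 -> w1 < v < w2 ->
     X beta kappa nu u < y < X beta kappa nu v -> u < Z nu y < v).
Proof.
intros Had Hw1 Hw Hw2 Hpos Hy Z.
assert (HE := X_fiberwise_C2 beta kappa i1 i2 Had).
assert (Hfix : forall nu, i1 < nu < i2 -> is_derive (fixp beta) nu (dfixp beta nu)).
{ intros nu Hnu. apply fixp_derive. apply (admissible_pos beta). apply Had, Hnu. }
assert (HX := fiberwise_C2_shift _ _ _ _ _ _ _ _ _ _ HE Hfix).
assert (HX' := fiberwise_C2_restrict _ _ _ _ i1 i2 w1 w2 _ _ _ _ (Rle_refl _) (Rle_refl _)
   (Rlt_le _ _ Hw1) (Rlt_le _ _ Hw2) HX).
assert (Hsc := fiberwise_C2_scaled i1 i2 w1 w2 (-4) 4 _ _ _ _ HE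
   (fun nu w H1 H2 => proj1 (Hpos nu w H1 (conj (Rlt_le _ _ (proj1 H2)) (Rlt_le _ _ (proj2 H2)))))).
assert (HcX := fiberwise_C2_shift _ _ _ _ _ _ _ _ _ _ Hsc Hfix).
assert (P : forall nu w, i1 < nu < i2 -> w1 < w < w2 -> 0 < E1 beta kappa nu w).
{ intros nu w H1 H2. apply Hpos; auto; lra. }
assert (O : forall nu y, i1 < nu < i2 -> y1 < y < y2 ->
   exists w, w1 < w < w2 /\ X beta kappa nu w = y).
{ intros nu y Hnu Hyy. apply (IVT_open (X beta kappa nu)); auto.
  - intros z Hz. eapply is_derive_continuity_pt.
    eapply differentiable_pt_lim_is_derive_snd. apply HX; lra.
  - specialize (Hy nu Hnu). lra. }
assert (G := fiberwise_C2_graph i1 i2 w1 w2 y1 y2 _ _ _ _ _ _ _ _ HX' HcX P O).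
split; [|split].
- exact G.
- apply (fiber_inverse_spec i1 i2 w1 w2 y1 y2 (X beta kappa) O).
- intros nu y u v Hnu Hyy Hu Hv Huv.
  apply (fiber_inverse_between i1 i2 w1 w2 y1 y2 (X beta kappa) (E1 beta kappa)); auto.
  intros x z Hx Hz. eapply differentiable_pt_lim_is_derive_snd. apply HX'; auto.
Qed.

(** * Interval arithmetic *)

(* An interval [l, h] scaled by 2^100; [None] is the whole line, so that [contains] holds
   vacuously after an inversion of an interval around 0. *)
Definition itv := option (Z * Z).
Definition scale : Z := Eval vm_compute in (2 ^ 100)%Z.
Definition dy (z : Z) : R := IZR z / IZR scale.
Definition contains (i : itv) (x : R) : Prop :=
  match i with None => True | Some (l, h) => dy l <= x <= dy h end.

Definition ilift2 (f : Z * Z -> Z * Z -> itv) (i j : itv) : itv :=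
  match i, j with Some u, Some v => f u v | _, _ => None end.
Definition iadd : itv -> itv -> itv :=
  ilift2 (fun u v => Some (fst u + fst v, snd u + snd v)%Z).
Definition iopp (i : itv) : itv :=
  match i with Some (l, h) => Some (- h, - l)%Z | None => None end.
Definition down_round (z : Z) : Z := Z.shiftr z 100.
Definition up_round (z : Z) : Z := (- Z.shiftr (- z) 100)%Z.
Definition imul : itv -> itv -> itv :=
  ilift2 (fun u v =>
    let '(a, b) := u in let '(c, d) := v in
    let p := (a * c)%Z in let q := (a * d)%Z in
    let r := (b * c)%Z in let s := (b * d)%Z in
    Some (down_round (Z.min (Z.min p q) (Z.min r s)), up_round (Z.max (Z.max p q) (Z.max r s)))).
(** Outward rounding: integer division is the floor, and negating before and after it gives the
    ceiling. *)
Definition iinv_pos (l h : Z) : itv :=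
  Some (scale * scale / h, - (- (scale * scale) / l))%Z.
Definition iinv (i : itv) : itv :=
  match i with
  | Some (l, h) =>
    if (0 <? l)%Z then iinv_pos l h
    else if (h <? 0)%Z then iopp (iinv_pos (- h) (- l)) else None
  | None => None
  end.
Definition iint (k : Z) : itv := Some (k * scale, k * scale)%Z.
Definition Iarith : arith itv := Arith itv iadd imul iopp iinv iint.

Lemma scale_pos : 0 < IZR scale.
Proof. apply IZR_lt. reflexivity. Qed.

Lemma dy_le x y : (x <= y)%Z -> dy x <= dy y.
Proof.
intros H. apply Rmult_le_compat_r. left; apply Rinv_0_lt_compat, scale_pos. apply IZR_le, H.
Qed.

Lemma dy_lt x y : (x < y)%Z -> dy x < dy y.
Proof.
intros H. apply Rmult_lt_compat_r. apply Rinv_0_lt_compat, scale_pos. apply IZR_lt, H.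
Qed.

Lemma dy_scaled x z : dy x <= z <-> IZR x <= z * IZR scale.
Proof.
pose proof scale_pos as S. unfold dy. split; intros H.
- apply (Rmult_le_compat_r (IZR scale)) in H; [|lra].
  unfold Rdiv in H. rewrite Rmult_assoc, Rinv_l, Rmult_1_r in H; lra.
- apply (Rmult_le_reg_r (IZR scale)); auto.
  unfold Rdiv. rewrite Rmult_assoc, Rinv_l, Rmult_1_r; lra.
Qed.

Lemma dy_scaled' x z : z <= dy x <-> z * IZR scale <= IZR x.
Proof.
pose proof scale_pos as S. unfold dy. split; intros H.
- apply (Rmult_le_compat_r (IZR scale)) in H; [|lra].
  unfold Rdiv in H. rewrite Rmult_assoc, Rinv_l, Rmult_1_r in H; lra.
- apply (Rmult_le_reg_r (IZR scale)); auto.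
  unfold Rdiv. rewrite Rmult_assoc, Rinv_l, Rmult_1_r; lra.
Qed.

Lemma contains_add i j x y : contains i x -> contains j y -> contains (iadd i j) (x + y).
Proof.
destruct i as [[a b]|], j as [[c d]|]; simpl; auto. unfold dy. rewrite !plus_IZR. lra.
Qed.

Lemma contains_opp i x : contains i x -> contains (iopp i) (- x).
Proof.
destruct i as [[a b]|]; simpl; auto. unfold dy. rewrite !opp_IZR. lra.
Qed.

Lemma down_round_le z : IZR (down_round z) * IZR scale <= IZR z.
Proof.
rewrite <- mult_IZR. apply IZR_le. unfold down_round. rewrite Z.shiftr_div_pow2 by lia.
change (2 ^ 100)%Z with scale. rewrite Z.mul_comm. apply Z.mul_div_le. reflexivity.
Qed.

Lemma up_round_ge z : IZR z <= IZR (up_round z) * IZR scale.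
Proof.
pose proof (down_round_le (- z)) as H. unfold up_round, down_round in *. rewrite opp_IZR in *. lra.
Qed.

Lemma mult_between a b c d x y m M : a <= x <= b -> c <= y <= d ->
  m <= a * c -> m <= a * d -> m <= b * c -> m <= b * d ->
  a * c <= M -> a * d <= M -> b * c <= M -> b * d <= M -> m <= x * y <= M.
Proof.
intros Hx Hy. intros.
destruct (Rle_dec 0 y); destruct (Rle_dec 0 a); destruct (Rle_dec 0 b); try lra; split;
try nra.
Qed.

Lemma contains_mul i j x y : contains i x -> contains j y -> contains (imul i j) (x * y).
Proof.
destruct i as [[a b]|], j as [[c d]|]; simpl; auto.
rewrite !dy_scaled, !dy_scaled'. intros Hx Hy. pose proof scale_pos as S.
set (p := (a * c)%Z). set (q := (a * d)%Z). set (r := (b * c)%Z). set (s := (b * d)%Z).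
set (m := Z.min (Z.min p q) (Z.min r s)). set (M := Z.max (Z.max p q) (Z.max r s)).
assert (K : IZR m <= (x * IZR scale) * (y * IZR scale) <= IZR M).
{ apply (mult_between (IZR a) (IZR b) (IZR c) (IZR d)); auto; rewrite <- mult_IZR;
  apply IZR_le; unfold m, M, p, q, r, s; lia. }
pose proof (down_round_le m). pose proof (up_round_ge M).
split; apply (Rmult_le_reg_r (IZR scale)); auto; lra.
Qed.

Lemma div_floor_le n d : (0 < d)%Z -> IZR (n / d) <= IZR n / IZR d.
Proof.
intros Hd. assert (0 < IZR d) by (apply IZR_lt; auto).
apply (Rmult_le_reg_r (IZR d)); auto. unfold Rdiv. rewrite Rmult_assoc, Rinv_l, Rmult_1_r by lra.
rewrite <- mult_IZR. apply IZR_le. rewrite Z.mul_comm. apply Z.mul_div_le, Hd.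
Qed.

Lemma contains_inv_pos l h x : (0 < l)%Z -> dy l <= x <= dy h -> contains (iinv_pos l h) (/ x).
Proof.
intros Hl. unfold iinv_pos, contains. rewrite !dy_scaled, !dy_scaled'. intros Hx.
pose proof scale_pos as S. assert (L : 0 < IZR l) by (apply IZR_lt; auto).
assert (Px : 0 < x * IZR scale) by lra.
assert (H : 0 < IZR h) by lra.
assert (x0 : 0 < x) by nra.
assert (E : / x * IZR scale = IZR (scale * scale) / (x * IZR scale)).
{ rewrite mult_IZR. field. lra. }
assert (SS : 0 < IZR (scale * scale)) by (rewrite mult_IZR; nra).
rewrite E. split.
- eapply Rle_trans. apply div_floor_le. apply lt_IZR; auto.
  apply Rmult_le_compat_l. lra. apply Rinv_le_contravar; lra.
- rewrite opp_IZR.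
  pose proof (div_floor_le (- (scale * scale)) l Hl) as K. rewrite opp_IZR in K.
  assert (IZR (scale * scale) / (x * IZR scale) <= IZR (scale * scale) / IZR l).
  { apply Rmult_le_compat_l. lra. apply Rinv_le_contravar; lra. }
  unfold Rdiv in *. lra.
Qed.

Lemma contains_inv i x : contains i x -> contains (iinv i) (/ x).
Proof.
destruct i as [[l h]|]; simpl; auto. intros Hx.
destruct (Z.ltb_spec 0 l) as [Hl|Hl]. apply contains_inv_pos; auto.
destruct (Z.ltb_spec h 0) as [Hh|Hh]; [|exact I].
replace (/ x) with (- / - x) by (rewrite Rinv_opp; ring).
apply (contains_opp (iinv_pos (- h) (- l))), contains_inv_pos. lia.
unfold dy in *. rewrite !opp_IZR. lra.
Qed.

Lemma contains_int k : contains (iint k) (IZR k).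
Proof.
simpl. unfold dy. rewrite mult_IZR. pose proof scale_pos.
replace (IZR k * IZR scale / IZR scale) with (IZR k) by (field; lra). lra.
Qed.

Lemma contains_dot l m l' m' : Forall2 contains l l' -> Forall2 contains m m' ->
  contains (dot itv Iarith l m) (dot R Rarith l' m').
Proof.
intros H. revert m m'. induction H; intros m m' [|]; simpl;
  try (apply (contains_int 0)).
apply contains_add; auto. apply contains_mul; auto.
Qed.

Lemma Forall2_rev {A B} (P : A -> B -> Prop) l m : Forall2 P l m -> Forall2 P (rev l) (rev m).
Proof.
induction 1; simpl; auto. apply Forall2_app; auto.
Qed.

Lemma contains_root_sum inu ib nu b : contains inu nu -> contains ib b ->
  contains (root_sum itv Iarith inu ib) (nu + b * / nu).
Proof.
intros. unfold root_sum. simpl.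
apply contains_add; auto. apply contains_mul; auto. apply contains_inv; auto.
Qed.

Lemma contains_root_sum_derive inu ib nu b : contains inu nu -> contains ib b ->
  contains (root_sum_derive itv Iarith inu ib) (1 + - (b * (/ nu * / nu))).
Proof.
intros. unfold root_sum_derive. cbn [aadd amul aopp ainv aint Iarith].
apply contains_add. apply (contains_int 1).
apply contains_opp, contains_mul; auto. apply contains_mul; apply contains_inv; auto.
Qed.

Lemma contains_coefs inu ib ik nu b k n :
  contains inu nu -> contains ib b -> contains ik k ->
  let '(l, dl, p, ip) := coefs itv Iarith inu ib ik n in
  let '(l', dl', p', ip') := coefs R Rarith nu b k n in
  Forall2 contains l l' /\ Forall2 contains dl dl' /\ contains p p' /\ contains ip ip'.
Proof.
intros Hn Hb Hk. induction n as [|n IH].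
- cbn [coefs]. split; [|split; [|split]]; auto; apply (contains_int 1).
- cbn [coefs].
  destruct (coefs itv Iarith inu ib ik n) as [[[l dl] p] ip].
  destruct (coefs R Rarith nu b k n) as [[[l' dl'] p'] ip'].
  destruct IH as [Hl [Hdl [Hp Hip]]].
  assert (P : contains (amul Iarith p inu) (amul Rarith p' nu)) by (apply contains_mul; auto).
  assert (IP : contains (amul Iarith ip (ainv Iarith inu)) (amul Rarith ip' (ainv Rarith nu)))
    by (apply contains_mul, contains_inv; auto).
  destruct n as [|n].
  + split; [|split; [|split]]; auto; constructor; auto. apply (contains_int 0).
  + set (q := amul Iarith p inu) in *. set (q' := amul Rarith p' nu) in *.
    set (iq := amul Iarith ip (ainv Iarith inu)) in *.
    set (iq' := amul Rarith ip' (ainv Rarith nu)) in *.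
    set (D := ainv Iarith (aadd Iarith (aadd Iarith q (amul Iarith ib iq))
       (aopp Iarith (root_sum itv Iarith inu ib)))).
    set (D' := ainv Rarith (aadd Rarith (aadd Rarith q' (amul Rarith b iq'))
       (aopp Rarith (root_sum R Rarith nu b)))).
    assert (HD : contains D D').
    { apply contains_inv, contains_add. apply contains_add; auto. apply contains_mul; auto.
      apply contains_opp, contains_root_sum; auto. }
    set (e := aopp Iarith (amul Iarith (dot itv Iarith l (rev l)) D)).
    set (e' := aopp Rarith (amul Rarith (dot R Rarith l' (rev l')) D')).
    assert (He : contains e e').
    { apply contains_opp, contains_mul; auto. apply contains_dot; auto. apply Forall2_rev; auto. }
    split; [|split; [|split]]; auto; constructor; auto.
    apply contains_opp, contains_mul; auto. apply contains_add.
    { apply contains_add; apply contains_dot; auto; apply Forall2_rev; auto. }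
    apply contains_mul; auto. apply contains_add.
    { apply contains_mul. apply contains_mul. apply contains_int. apply contains_inv; auto.
      apply contains_add; auto. apply contains_opp, contains_mul; auto. }
    apply contains_opp, contains_root_sum_derive; auto.
Qed.

(** * Enclosures of truncated series and of their remainders *)

Section Polynomials.
Variables (T : Type) (o : arith T).
(* coefficient lists start with the leading coefficient *)
Fixpoint poly_acc (l : list T) (t acc : T) : T :=
  match l with nil => acc | a :: l => poly_acc l t (aadd o (amul o acc t) a) end.
Definition poly (l : list T) (t : T) : T := poly_acc l t (aint o 0).
(** In leading-first order the length of the tail is the degree of the head. *)
Fixpoint dpoly (l : list T) : list T :=
  match l with
  | nil => nil
  | a :: l' => match l' with
    | nil => nil
    | _ => amul o (aint o (Z.of_nat (length l'))) a :: dpoly l' end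
  end.
End Polynomials.

Lemma contains_poly l l' i t : Forall2 contains l l' -> contains i t ->
  contains (poly itv Iarith l i) (poly R Rarith l' t).
Proof.
intros H Ht. unfold poly.
assert (G : forall a a', contains a a' ->
   contains (poly_acc itv Iarith l i a) (poly_acc R Rarith l' t a')).
{ induction H; intros a a' Ha; simpl; auto. apply IHForall2.
  apply contains_add; auto. apply contains_mul; auto. }
apply G. apply (contains_int 0).
Qed.

Lemma contains_dpoly l l' : Forall2 contains l l' ->
  Forall2 contains (dpoly itv Iarith l) (dpoly R Rarith l').
Proof.
induction 1 as [|a a' l l' Ha H IH]. constructor.
destruct H as [|b b' l l' Hb H]. constructor.
assert (E : length (b :: l) = length (b' :: l')) by (simpl; f_equal; eapply Forall2_length; eauto).
change (dpoly itv Iarith (a :: b :: l)) with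
  (imul (iint (Z.of_nat (length (b :: l)))) a :: dpoly itv Iarith (b :: l)).
change (dpoly R Rarith (a' :: b' :: l')) with
  (IZR (Z.of_nat (length (b' :: l'))) * a' :: dpoly R Rarith (b' :: l')).
constructor; auto. rewrite E. apply contains_mul; auto. apply contains_int.
Qed.

(** Degrees [n - 1] down to 0, the order in which [coefs] accumulates its lists. *)
Definition down_list (a : nat -> R) (n : nat) : list R := rev (map a (seq 0 n)).

Lemma down_list_S a n : down_list a (S n) = a n :: down_list a n.
Proof. unfold down_list. rewrite seq_S, map_app, rev_app_distr. reflexivity. Qed.

Lemma poly_down_list a n t :
  poly R Rarith (down_list a (S n)) t = sum_f_R0 (fun k => a k * t ^ k) n.
Proof.
assert (G : forall m acc, poly_acc R Rarith (down_list a (S m)) t acc =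
  acc * t ^ S m + sum_f_R0 (fun k => a k * t ^ k) m).
{ induction m; intros acc; rewrite down_list_S; cbn [poly_acc aadd amul Rarith].
  - simpl. ring.
  - rewrite IHm. cbn [sum_f_R0]. simpl. ring. }
unfold poly. rewrite G. simpl. ring.
Qed.

Lemma dpoly_down_list a n : dpoly R Rarith (down_list a (S n)) = down_list (PS_derive a) n.
Proof.
induction n. reflexivity.
rewrite down_list_S. rewrite (down_list_S (PS_derive a)), <- IHn.
assert (E : length (down_list a (S n)) = S n)
  by (unfold down_list; rewrite length_rev, length_map, length_seq; reflexivity).
destruct (down_list a (S n)) as [|x l] eqn:El; [discriminate|].
cbn [dpoly]. cbn [dpoly] in IHn. f_equal. rewrite E. cbn [amul aint Rarith].
unfold PS_derive. rewrite INR_IZR_INZ. reflexivity.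
Qed.

(** [coefs] stops at degree 1; the appended zero is the coefficient of degree 0. *)
Definition tables (inu ib ik : itv) : list itv * list itv :=
  let '(l, dl, _, _) := coefs itv Iarith inu ib ik 20 in
  (l ++ iint 0 :: nil, dl ++ iint 0 :: nil).

Lemma contains_tables inu ib kap nu b :
  contains inu nu -> contains ib b ->
  Forall2 contains (fst (tables inu ib (iint kap))) (down_list (fun k => ecoef b (IZR kap) k nu) 21) /\
  Forall2 contains (snd (tables inu ib (iint kap))) (down_list (fun k => decoef b (IZR kap) k nu) 21).
Proof.
intros Hn Hb. pose proof (contains_coefs inu ib (iint kap) nu b (IZR kap) 20 Hn Hb (contains_int kap)) as H.
rewrite coefs_eq in H. unfold tables.
destruct (coefs itv Iarith inu ib (iint kap) 20) as [[[l dl] p] ip].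
destruct H as [H1 [H2 _]]. cbn [fst snd].
split; (apply Forall2_app; [assumption|]); constructor; auto; apply (contains_int 0).
Qed.

Definition symm (z : Z) : itv := Some (- z, z)%Z.

Lemma contains_symm z x : Rabs x <= dy z -> contains (symm z) x.
Proof.
intros H. apply Rabs_le_between in H. simpl. unfold dy in *. rewrite opp_IZR. lra.
Qed.

(** The length of the tail is the degree of the entry, and 120 = 20 + 100 combines the constant 2^20
    with the scale 2^100. Steps 4 and 3 give the rates 1/16 and 1/8. *)
Fixpoint head_check (step : Z) (l : list itv) : bool :=
  match l with
  | nil => true
  | i :: l =>
    let m := (2 ^ (120 - step * Z.of_nat (length l)))%Z in
    andb match i with Some (a, b) => andb (- m <=? a)%Z (b <=? m)%Z | None => false end
      (head_check step l)
  end.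

Lemma head_check_sound step a n l : (0 < step)%Z -> (step * Z.of_nat n <= 120)%Z ->
  Forall2 contains l (down_list a (S n)) -> head_check step l = true ->
  forall k, (k <= n)%nat -> Rabs (a k) <= 1048576 * (/ IZR (2 ^ step)) ^ k.
Proof.
intros Hs. revert l. induction n as [|n IH]; intros l Hn H Hc k Hk.
1: assert (k = 0%nat) as -> by lia.
all: rewrite down_list_S in H; inversion H as [|i x l' m Hi Hl]; subst;
  cbn [head_check] in Hc; apply andb_prop in Hc; destruct Hc as [Hc1 Hc2];
  destruct i as [[u v]|]; [|discriminate];
  apply andb_prop in Hc1; destruct Hc1 as [C1 C2];
  apply Z.leb_le in C1; apply Z.leb_le in C2.
- inversion Hl; subst. cbn [length] in C1, C2. rewrite Z.mul_0_r, Z.sub_0_r in C1, C2.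
  change (2 ^ 120)%Z with (1048576 * scale)%Z in C1, C2.
  apply dy_le in C1. apply dy_le in C2. cbn [contains] in Hi.
  assert (Z2 : dy (1048576 * scale) = 1048576).
  { unfold dy. rewrite mult_IZR. field. pose proof scale_pos. lra. }
  assert (Z1 : dy (- (1048576 * scale)) = - 1048576).
  { unfold dy in *. rewrite opp_IZR. unfold Rdiv in *. lra. }
  rewrite pow_O, Rmult_1_r. apply Rabs_le_between. lra.
- destruct (Nat.eq_dec k (S n)) as [->|Hne]; [|apply (IH l'); auto; lia].
  assert (Len : length l' = S n).
  { erewrite Forall2_length by exact Hl. unfold down_list.
    rewrite length_rev, length_map, length_seq. reflexivity. }
  rewrite Len in C1, C2. set (m' := (2 ^ (120 - step * Z.of_nat (S n)))%Z) in *.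
  assert (Em : dy m' = 1048576 * (/ IZR (2 ^ step)) ^ S n).
  { assert (P : 0 < IZR (2 ^ step)) by (apply IZR_lt, Z.pow_pos_nonneg; lia).
    rewrite pow_inv. assert (P' := pow_lt _ (S n) P). pose proof scale_pos.
    apply (Rmult_eq_reg_r (IZR scale * IZR (2 ^ step) ^ S n)); [|nra].
    replace (dy m' * (IZR scale * IZR (2 ^ step) ^ S n)) with (IZR m' * IZR (2 ^ step) ^ S n)
      by (unfold dy; field; lra).
    replace (1048576 * / IZR (2 ^ step) ^ S n * (IZR scale * IZR (2 ^ step) ^ S n)) with
      (1048576 * IZR scale) by (field; lra).
    rewrite pow_IZR, <- !mult_IZR. f_equal. unfold m'.
    rewrite <- Z.pow_mul_r, <- Z.pow_add_r by lia.
    replace (120 - step * Z.of_nat (S n) + step * Z.of_nat (S n))%Z with 120%Z by lia.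
    reflexivity. }
  simpl in Hi. apply dy_le in C1. apply dy_le in C2.
  assert (Eo : dy (- m') = - dy m') by (unfold dy; rewrite opp_IZR; unfold Rdiv; ring).
  rewrite <- Em. apply Rabs_le_between. lra.
Qed.

Record enclosure := Enclosure {
  enc_y : itv; enc_x : itv; enc_dy : itv; enc_slope : itv; enc_bend : itv; enc_drift : itv }.

Definition half : itv := Some (scale / 2, scale / 2)%Z.

Lemma contains_half : contains half (/ 2).
Proof.
assert (E : dy (scale / 2) = / 2).
{ unfold dy. pose proof scale_pos. change scale with (2 * (scale / 2))%Z at 2.
  rewrite mult_IZR. field. apply not_0_IZR. discriminate. }
unfold half, contains. rewrite E. lra.
Qed.

(* The constants 2^-61, 2^-40, 2^-20, 2^-40 (scaled) bound the remainders after degree 20 of the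
   series and its derivatives on |t| <= 17/16, see [tail_E0] to [tail_E2]. *)
Definition enclose (tab : list itv * list itv) (nu b w : itv) : enclosure :=
  let (l, dl) := tab in
  let l1 := dpoly itv Iarith l in
  let l2 := dpoly itv Iarith l1 in
  let v := imul nu w in
  let e0 := fun t => iadd (poly itv Iarith l t) (symm (2 ^ 39)) in
  let e1 := fun t => iadd (poly itv Iarith l1 t) (symm (2 ^ 60)) in
  let e2 := fun t => iadd (poly itv Iarith l2 t) (symm (2 ^ 80)) in
  let en := fun t => iadd (poly itv Iarith dl t) (symm (2 ^ 60)) in
  let fx := imul (iopp (root_sum itv Iarith nu b)) half in
  let dfx := imul (iopp (root_sum_derive itv Iarith nu b)) half in
  let d := e1 w in
  let id := iinv d in
  let s := imul nu (e1 v) in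
  {| enc_y := iadd fx (e0 w); enc_x := iadd fx (e0 v); enc_dy := d;
     enc_slope := imul s id;
     enc_bend := imul (iadd (imul (imul (imul nu nu) (e2 v)) d) (iopp (imul s (e2 w))))
                   (imul id (imul id id));
     enc_drift := iadd (iadd dfx (iadd (en v) (imul w (e1 v))))
                    (iopp (imul (imul s (iadd dfx (en w))) id)) |}.

Lemma tail_E0 b kap nu t : bounded_coefs b kap nu -> Rabs t <= 17/16 ->
  Rabs (E0 b kap nu t - sum_f_R0 (fun k => ecoef b kap k nu * t ^ k) 20) <= dy (2 ^ 39).
Proof.
intros H Ht. eapply Rle_trans.
apply (PSeries_tail (fun k => ecoef b kap k nu) 1048576 (/ 16) (17/16)); try lra.
intros k _; apply H.
unfold dy, scale. simpl. lra.
Qed.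

Lemma tail_En b kap nu t : bounded_coefs b kap nu -> Rabs t <= 17/16 ->
  Rabs (En b kap nu t - sum_f_R0 (fun k => decoef b kap k nu * t ^ k) 20) <= dy (2 ^ 60).
Proof.
intros H Ht. eapply Rle_trans.
apply (PSeries_tail (fun k => decoef b kap k nu) 1048576 (/ 8) (17/16)); try lra.
intros k _; apply H.
unfold dy, scale. simpl. lra.
Qed.

(** Each derivative doubles the rate of decay 1/16 and lowers the degree of the truncated polynomial
    by one; hence 19 here and 18 in [tail_E2]. *)
Lemma tail_E1 b kap nu t : bounded_coefs b kap nu -> Rabs t <= 17/16 ->
  Rabs (E1 b kap nu t - sum_f_R0 (fun k => PS_derive (fun k => ecoef b kap k nu) k * t ^ k) 19)
    <= dy (2 ^ 60).
Proof.
intros H Ht. eapply Rle_trans.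
apply (PSeries_tail _ (2 * 1048576 * / 16) (2 * / 16) (17/16)); try lra.
intros k _; apply PS_derive_bound. lra. intros j. apply H.
unfold dy, scale. simpl. lra.
Qed.

Lemma tail_E2 b kap nu t : bounded_coefs b kap nu -> Rabs t <= 17/16 ->
  Rabs (E2 b kap nu t -
    sum_f_R0 (fun k => PS_derive (PS_derive (fun k => ecoef b kap k nu)) k * t ^ k) 18)
    <= dy (2 ^ 80).
Proof.
intros H Ht. eapply Rle_trans.
apply (PSeries_tail _ (2 * (2 * 1048576 * / 16) * (2 * / 16)) (2 * (2 * / 16)) (17/16)); try lra.
intros k _; apply PS_derive_bound. lra. apply PS_derive_bound. lra. intros j. apply H.
unfold dy, scale. simpl. lra.
Qed.

Lemma contains_approx i z p q : contains i p -> Rabs (q - p) <= dy z ->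
  contains (iadd i (symm z)) q.
Proof.
intros Hi Hz. replace q with (p + (q - p)) by ring.
apply contains_add; auto. apply contains_symm; auto.
Qed.

Lemma enclose_sound inu ib iw kap nu b w :
  contains inu nu -> contains ib b -> contains iw w ->
  bounded_coefs b (IZR kap) nu -> Rabs w <= 17/16 -> Rabs (nu * w) <= 17/16 ->
  let d := enclose (tables inu ib (iint kap)) inu ib iw in
  contains (enc_y d) (X b (IZR kap) nu w) /\
  contains (enc_x d) (X b (IZR kap) nu (nu * w)) /\
  contains (enc_dy d) (E1 b (IZR kap) nu w) /\
  contains (enc_slope d) (slope b (IZR kap) nu w) /\
  contains (enc_bend d) (bend b (IZR kap) nu w) /\
  contains (enc_drift d) (drift b (IZR kap) nu w).
Proof.
intros Hn Hb Hw Hc Hw1 Hv1.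
destruct (contains_tables inu ib kap nu b Hn Hb) as [T1 T2].
unfold enclose. destruct (tables inu ib (iint kap)) as [l dl]. cbn [fst snd] in T1, T2.
assert (T3 := contains_dpoly _ _ T1). rewrite dpoly_down_list in T3.
assert (T4 := contains_dpoly _ _ T3). rewrite dpoly_down_list in T4.
assert (Hv : contains (imul inu iw) (nu * w)) by (apply contains_mul; auto).
assert (A0 : forall i t, contains i t -> Rabs t <= 17/16 ->
   contains (iadd (poly itv Iarith l i) (symm (2 ^ 39))) (E0 b (IZR kap) nu t)).
{ intros i t Hi Ht. eapply contains_approx. apply contains_poly; eauto.
  rewrite poly_down_list. apply tail_E0; auto. }
assert (A1 : forall i t, contains i t -> Rabs t <= 17/16 ->
   contains (iadd (poly itv Iarith (dpoly itv Iarith l) i) (symm (2 ^ 60))) (E1 b (IZR kap) nu t)).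
{ intros i t Hi Ht. eapply contains_approx. apply contains_poly; eauto.
  rewrite poly_down_list. apply tail_E1; auto. }
assert (A2 : forall i t, contains i t -> Rabs t <= 17/16 ->
   contains (iadd (poly itv Iarith (dpoly itv Iarith (dpoly itv Iarith l)) i) (symm (2 ^ 80)))
     (E2 b (IZR kap) nu t)).
{ intros i t Hi Ht. eapply contains_approx. apply contains_poly; eauto.
  rewrite poly_down_list. apply tail_E2; auto. }
assert (AN : forall i t, contains i t -> Rabs t <= 17/16 ->
   contains (iadd (poly itv Iarith dl i) (symm (2 ^ 60))) (En b (IZR kap) nu t)).
{ intros i t Hi Ht. eapply contains_approx. apply contains_poly; eauto.
  rewrite poly_down_list. apply tail_En; auto. }
clear T1 T2 T3 T4.
assert (Hh := contains_half).
assert (Fx : contains (imul (iopp (root_sum itv Iarith inu ib)) half) (fixp b nu)).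
{ unfold fixp, Rdiv. apply contains_mul; auto. apply contains_opp, contains_root_sum; auto. }
assert (DFx : contains (imul (iopp (root_sum_derive itv Iarith inu ib)) half) (dfixp b nu)).
{ unfold dfixp, Rdiv. apply contains_mul; auto. apply contains_opp, contains_root_sum_derive; auto. }
assert (I1 := contains_inv _ _ (A1 _ _ Hw Hw1)).
assert (S1 := contains_mul _ _ _ _ Hn (A1 _ _ Hv Hv1)).
cbn zeta. cbn [enc_y enc_x enc_dy enc_slope enc_bend enc_drift].
split; [|split; [|split; [|split; [|split]]]].
- apply contains_add; auto.
- apply contains_add; auto.
- auto.
- apply contains_mul; auto.
- unfold bend, Rdiv. apply contains_mul.
  + apply contains_add. apply contains_mul; auto. apply contains_mul; auto. apply contains_mul; auto.
    apply contains_opp, contains_mul; auto.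
  + replace (/ E1 b (IZR kap) nu w ^ 3) with
     (/ E1 b (IZR kap) nu w * (/ E1 b (IZR kap) nu w * / E1 b (IZR kap) nu w)).
    repeat apply contains_mul; auto.
    simpl. rewrite !Rinv_mult, Rinv_1. ring.
- unfold drift. apply contains_add.
  + apply contains_add; auto. apply contains_add; auto. apply contains_mul; auto.
  + apply contains_opp. unfold Rdiv. apply contains_mul; auto. apply contains_mul; auto.
    apply contains_add; auto.
Qed.

(** * Verified inequalities *)

(* All constants are scaled by 2^100. [c_b1, c_b2] encloses - b = 3/10, [c_L1, c_L2] the unstable
   multiplier 3.8581694..., with c_la, c_lb on either side of the tangency value, [c_M1, c_M2]
   the stable one 0.0777570...; c_y1 < c_ya < c_yc < c_yb < c_y2 surround the second coordinate
   -0.0142485... of the tangency. The c_w constants bracket the parameters w of points with second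
   coordinate in [c_y1, c_y2], equal to c_ya, c_yb, and equal to c_yc for the multiplier c_la
   (suffix c) or c_lb (suffix d), on the unstable (u) and stable (s) manifold. c_G bounds the
   difference of the slopes on the box; c_A1, c_A2 bound the parameter a. *)
Definition c_b1 : Z := 380295180068468693683950938790.
Definition c_b2 : Z := 380295180068468947214070984436.
Definition c_L1 : Z := 4890810758426099869386303606480.
Definition c_L2 : Z := 4890810758431170471787216524086.
Definition c_la : Z := 4890810758427367519986531835882.
Definition c_lb : Z := 4890810758429902821186988294685.
Definition c_M1 : Z := 98568813452100253717210096775.
Definition c_M2 : Z := 98568813452353783837255742655.
Definition c_y1 : Z := (-18062265276983540537268944745).
Definition c_ya : Z := (-18062252600477538254974929778).
Definition c_yc : Z := (-18062239923971535972680914810).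
Definition c_yb : Z := (-18062227247465533690386899843).
Definition c_y2 : Z := (-18062214570959531408092884876).
Definition c_wu1 : Z := 311241920097509359470826702282.
Definition c_wu2 : Z := 311241928825172307133517018165.
Definition c_wua1 : Z := 311241922380790531530147197662.
Definition c_wua2 : Z := 311241922385861133931060115268.
Definition c_wub1 : Z := 311241926536820506607618698108.
Definition c_wub2 : Z := 311241926541891109008531615714.
Definition c_wuc1 : Z := 311241924461282557747660928366.
Definition c_wuc2 : Z := 311241924461307910759665492954.
Definition c_wud1 : Z := 311241924461373722135123336161.
Definition c_wud2 : Z := 311241924461399075147127900749.
Definition c_ws1 : Z := (-1268599048940367207970100917396).
Definition c_ws2 : Z := (-1268599047590576383504120258323).
Definition c_wsa1 : Z := (-1268599048612203575705790767235).
Definition c_wsa2 : Z := (-1268599048561497551696661591175).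
Definition c_wsb1 : Z := (-1268599047969446040245799977427).
Definition c_wsb2 : Z := (-1268599047918740016236670801368).
Definition c_wsc1 : Z := (-1268599048264844799008957190566).
Definition c_wsc2 : Z := (-1268599048264819445996952625978).
Definition c_wsd1 : Z := (-1268599048266124146082823002993).
Definition c_wsd2 : Z := (-1268599048266098793070818438405).
Definition c_G : Z := 2417851639229258349412352.
Definition c_A1 : Z := 1666349670298615002248164966854.
Definition c_A2 : Z := 1666372488009419110377391907511.

Definition ipt (z : Z) : itv := Some (z, z).
Definition ilt (i j : itv) : bool :=
  match i, j with Some (_, h), Some (l, _) => (h <? l)%Z | _, _ => false end.

Lemma contains_ipt z : contains (ipt z) (dy z).
Proof. simpl. lra. Qed.

Lemma ilt_sound i j x y : contains i x -> contains j y -> ilt i j = true -> x < y.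
Proof.
destruct i as [[a b]|], j as [[c d]|]; simpl; try discriminate.
intros Hi Hj H. apply Z.ltb_lt, dy_lt in H. lra.
Qed.

Definition all_true : list bool -> bool := forallb (fun b => b).

Lemma all_true_cons b l : all_true (b :: l) = true -> b = true /\ all_true l = true.
Proof. apply andb_prop. Qed.

Definition ib : itv := Some (c_b1, c_b2).
Definition domain_check (nu w : itv) : bool :=
  all_true (ilt (ipt (- (scale + scale / 16))) w :: ilt w (ipt (scale + scale / 16)) ::
    ilt (ipt (- (scale + scale / 16))) (imul nu w) ::
    ilt (imul nu w) (ipt (scale + scale / 16)) :: nil).

(** Gathers what [coef_bounds] and [manifold_graph] require on a box of parameters and multipliers.
    The last ten conditions bracket the parameters at heights [c_ya] and [c_yb], where the slopes
    are compared later. *)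
Definition manifold_check (tab : list itv * list itv) (nu : itv) (w1 w2 wa1 wa2 wb1 wb2 : Z) : bool :=
  let y := fun w => enc_y (enclose tab nu ib (ipt w)) in
  all_true (head_check 4 (fst tab) :: head_check 3 (snd tab) ::
    domain_check nu (Some (w1, w2)) ::
    ilt (ipt 0) (enc_dy (enclose tab nu ib (Some (w1, w2)))) ::
    ilt (y w1) (ipt c_y1) :: ilt (ipt c_y2) (y w2) ::
    (w1 <? wa1)%Z :: (wa1 <? wa2)%Z :: (wa2 <? w2)%Z ::
    (w1 <? wb1)%Z :: (wb1 <? wb2)%Z :: (wb2 <? w2)%Z ::
    ilt (y wa1) (ipt c_ya) :: ilt (ipt c_ya) (y wa2) ::
    ilt (y wb1) (ipt c_yb) :: ilt (ipt c_yb) (y wb2) :: nil).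

(** For use with a single unstable multiplier: over the whole box [nu_u] the splitting changes sign,
    so its sign can be read off only at fixed values of lambda. *)
Definition thin_check (tab : list itv * list itv) (nu : itv) (w1 w2 wc1 wc2 : Z) : bool :=
  let y := fun w => enc_y (enclose tab nu ib (ipt w)) in
  all_true ((w1 <? wc1)%Z :: (wc1 <? wc2)%Z :: (wc2 <? w2)%Z ::
    ilt (y wc1) (ipt c_yc) :: ilt (ipt c_yc) (y wc2) :: nil).

Definition nu_u : itv := Some (c_L1, c_L2).
Definition nu_s : itv := Some (c_M1, c_M2).
Definition nu_uc : itv := ipt c_la.
Definition nu_ud : itv := ipt c_lb.
(** Even at a fixed unstable multiplier the stable one is an interval, since the product [beta]
    ranges over [ib]. *)
Definition nu_sc : itv := imul ib (iinv nu_uc).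
Definition nu_sd : itv := imul ib (iinv nu_ud).

(* First Taylor coefficients, normalized so that the tangency has parameters |w|, |nu w| <= 1.01;
   the sign makes the second coordinate increasing in w on both manifolds. *)
Definition ku : Z := 10.
Definition ks : Z := (-52).
Definition enc_u (nu : itv) (w1 w2 : Z) := enclose (tables nu ib (iint ku)) nu ib (Some (w1, w2)).
Definition enc_s (nu : itv) (w1 w2 : Z) := enclose (tables nu ib (iint ks)) nu ib (Some (w1, w2)).

Definition iparam (nu : itv) : itv :=
  let f := imul (iopp (root_sum itv Iarith nu ib)) half in
  iadd (iadd f (imul f f)) (imul ib f).

Definition isub (i j : itv) : itv := iadd i (iopp j).

Lemma u_check : manifold_check (tables nu_u ib (iint ku)) nu_u
  c_wu1 c_wu2 c_wua1 c_wua2 c_wub1 c_wub2 = true.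
Proof. vm_compute. reflexivity. Qed.
Lemma s_check : manifold_check (tables nu_s ib (iint ks)) nu_s
  c_ws1 c_ws2 c_wsa1 c_wsa2 c_wsb1 c_wsb2 = true.
Proof. vm_compute. reflexivity. Qed.
Lemma uc_check : thin_check (tables nu_uc ib (iint ku)) nu_uc c_wu1 c_wu2 c_wuc1 c_wuc2 = true.
Proof. vm_compute. reflexivity. Qed.
Lemma ud_check : thin_check (tables nu_ud ib (iint ku)) nu_ud c_wu1 c_wu2 c_wud1 c_wud2 = true.
Proof. vm_compute. reflexivity. Qed.
Lemma sc_check : thin_check (tables nu_sc ib (iint ks)) nu_sc c_ws1 c_ws2 c_wsc1 c_wsc2 = true.
Proof. vm_compute. reflexivity. Qed.
Lemma sd_check : thin_check (tables nu_sd ib (iint ks)) nu_sd c_ws1 c_ws2 c_wsd1 c_wsd2 = true.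
Proof. vm_compute. reflexivity. Qed.

(** The first seven conditions supply the numerical hypotheses of [fold_tangency_exists]. The eighth
    is monotonicity in lambda: the stable multiplier [beta / lambda] has derivative
    [- beta / lambda^2], so the difference of the two motions becomes a sum. The last four place the
    stable multiplier in [nu_s] and the parameter a in its interval. *)
Lemma tangency_check :
  let u := enc_u nu_u c_wu1 c_wu2 in let s := enc_s nu_s c_ws1 c_ws2 in
  all_true (
    ilt (enc_bend u) (enc_bend s) ::
    ilt (isub (enc_slope u) (enc_slope s)) (ipt c_G) ::
    ilt (ipt (- c_G)) (isub (enc_slope u) (enc_slope s)) ::
    ilt (enc_slope (enc_s nu_s c_wsa1 c_wsa2)) (enc_slope (enc_u nu_u c_wua1 c_wua2)) ::
    ilt (enc_slope (enc_u nu_u c_wub1 c_wub2)) (enc_slope (enc_s nu_s c_wsb1 c_wsb2)) ::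
    ilt (iadd (isub (enc_x (enc_u nu_uc c_wuc1 c_wuc2)) (enc_x (enc_s nu_sc c_wsc1 c_wsc2)))
           (imul (ipt c_G) (ipt (c_yb - c_ya)))) (ipt 0) ::
    ilt (imul (ipt c_G) (ipt (c_yb - c_ya)))
        (isub (enc_x (enc_u nu_ud c_wud1 c_wud2)) (enc_x (enc_s nu_sd c_wsd1 c_wsd2))) ::
    ilt (ipt 0) (iadd (enc_drift u) (imul (enc_drift s)
       (imul ib (imul (iinv nu_u) (iinv nu_u))))) ::
    ilt (ipt c_M1) (imul ib (iinv nu_u)) :: ilt (imul ib (iinv nu_u)) (ipt c_M2) ::
    ilt (ipt c_A1) (iparam nu_u) :: ilt (iparam nu_u) (ipt c_A2) :: nil) = true.
Proof. vm_compute. reflexivity. Qed.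

Local Opaque tables enclose head_check.
(** The conjuncts receive the names [K], [K0], [K1], ... in the order of the list, and later proofs
    refer to them by these names. *)
Ltac split_checks H :=
  repeat (let K := fresh "K" in apply all_true_cons in H; destruct H as [K H]).

(** * From the computed checks to properties of the manifolds *)

Lemma contains_mono l h l' h' x : (l' <= l)%Z -> (h <= h')%Z ->
  contains (Some (l, h)) x -> contains (Some (l', h')) x.
Proof. intros H1 H2 H. apply dy_le in H1. apply dy_le in H2. simpl in *. lra. Qed.

Lemma domain_check_sound inu iw nu w : domain_check inu iw = true ->
  contains inu nu -> contains iw w -> Rabs w <= 17/16 /\ Rabs (nu * w) <= 17/16.
Proof.
intros H Hn Hw. unfold domain_check in H. split_checks H.
assert (E1 : dy (scale + scale / 16) = 17/16).
{ unfold dy. pose proof scale_pos.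
  change (scale + scale / 16)%Z with (17 * (scale / 16))%Z.
  change scale with (16 * (scale / 16))%Z at 2.
  rewrite !mult_IZR. field. apply not_0_IZR. discriminate. }
assert (E2 : dy (- (scale + scale / 16)) = - (17/16)).
{ unfold dy in *. rewrite opp_IZR. unfold Rdiv in *. lra. }
assert (Hv := contains_mul _ _ _ _ Hn Hw).
apply (ilt_sound _ _ _ _ (contains_ipt _) Hw) in K.
apply (ilt_sound _ _ _ _ Hw (contains_ipt _)) in K0.
apply (ilt_sound _ _ _ _ (contains_ipt _) Hv) in K1.
apply (ilt_sound _ _ _ _ Hv (contains_ipt _)) in K2.
split; apply Rabs_le_between; lra.
Qed.

Section ManifoldCheck.

Variables (inu : itv) (kap : Z) (w1 w2 wa1 wa2 wb1 wb2 : Z) (i1 i2 beta : R).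
Hypothesis beta_in : contains ib beta.
Hypothesis nu_in : forall nu, i1 < nu < i2 -> contains inu nu.
Hypothesis nu_admissible : forall nu, i1 < nu < i2 -> admissible beta nu.
Hypothesis check : manifold_check (tables inu ib (iint kap)) inu w1 w2 wa1 wa2 wb1 wb2 = true.

Let k := IZR kap.
Let zinv := fiber_inverse (X beta k) (dy w1) (dy w2).

Lemma checked_bounded nu : i1 < nu < i2 -> bounded_coefs beta k nu.
Proof.
intros Hnu. apply coef_bounds. apply nu_admissible, Hnu.
pose proof check as H. unfold manifold_check in H. split_checks H.
destruct (contains_tables inu ib kap nu beta (nu_in nu Hnu) beta_in) as [T1 T2].
intros j Hj. split.
- apply (head_check_sound 4 (fun j => ecoef beta k j nu) 20
    (fst (tables inu ib (iint kap)))); auto; lia.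
- apply (head_check_sound 3 (fun j => decoef beta k j nu) 20
    (snd (tables inu ib (iint kap)))); auto; lia.
Qed.

Lemma checked_domain nu w : i1 < nu < i2 -> dy w1 <= w <= dy w2 ->
  Rabs w <= 17/16 /\ Rabs (nu * w) <= 17/16.
Proof.
intros Hnu Hw. pose proof check as H. unfold manifold_check in H. split_checks H.
apply (domain_check_sound inu (Some (w1, w2))); auto.
Qed.

(** The coefficient bounds and the domain come from the check on the wide interval [inu], while the
    enclosure may be computed on a narrower [inu']. This is what allows the evaluations at one
    unstable multiplier. *)
Lemma checked_enclosure inu' a b nu w :
  i1 < nu < i2 -> contains inu' nu -> (w1 <= a)%Z -> (b <= w2)%Z -> contains (Some (a, b)) w ->
  let d := enclose (tables inu' ib (iint kap)) inu' ib (Some (a, b)) in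
  contains (enc_y d) (X beta k nu w) /\
  contains (enc_x d) (X beta k nu (nu * w)) /\
  contains (enc_dy d) (E1 beta k nu w) /\
  contains (enc_slope d) (slope beta k nu w) /\
  contains (enc_bend d) (bend beta k nu w) /\
  contains (enc_drift d) (drift beta k nu w).
Proof.
intros Hnu Hi Ha Hb Hw.
destruct (checked_domain nu w Hnu (contains_mono _ _ w1 w2 w Ha Hb Hw)) as [D1 D2].
apply enclose_sound; auto. apply checked_bounded, Hnu.
Qed.

Lemma checked_y inu' a nu :
  i1 < nu < i2 -> contains inu' nu -> (w1 <= a)%Z -> (a <= w2)%Z ->
  contains (enc_y (enclose (tables inu' ib (iint kap)) inu' ib (ipt a))) (X beta k nu (dy a)).
Proof.
intros Hnu Hi H1 H2.
exact (proj1 (checked_enclosure inu' a a nu (dy a) Hnu Hi H1 H2 (contains_ipt a))).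
Qed.

Lemma checked_manifold :
  fiberwise_C2 i1 i2 (dy c_y1) (dy c_y2) (fun nu y => X beta k nu (nu * zinv nu y))
    (fun nu y => drift beta k nu (zinv nu y))
    (fun nu y => slope beta k nu (zinv nu y))
    (fun nu y => bend beta k nu (zinv nu y)) /\
  (forall nu y, i1 < nu < i2 -> dy c_y1 < y < dy c_y2 ->
     dy w1 < zinv nu y < dy w2 /\ X beta k nu (zinv nu y) = y) /\
  (forall nu y u v, i1 < nu < i2 -> dy c_y1 < y < dy c_y2 ->
     dy w1 < u < dy w2 -> dy w1 < v < dy w2 ->
     X beta k nu u < y < X beta k nu v -> u < zinv nu y < v).
Proof.
pose proof check as H. unfold manifold_check in H. split_checks H.
apply Z.ltb_lt in K5, K6, K7, K8, K9, K10.
destruct (Rlt_le_dec i1 i2) as [Hi|Hi].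
(* For an empty range of multipliers everything is vacuous; otherwise the midpoint serves to read
   the bounds on [w1] and [w2] off the domain check. *)
2:{ split; [|split]; intro; intros; lra. }
assert (Hw : (w1 < w2)%Z) by lia. apply dy_lt in Hw.
assert (Dom : -4 < dy w1 /\ dy w2 < 4).
{ destruct (checked_domain ((i1 + i2) / 2) (dy w1) ltac:(lra) ltac:(lra)) as [A1 _].
  destruct (checked_domain ((i1 + i2) / 2) (dy w2) ltac:(lra) ltac:(lra)) as [A2 _].
  apply Rabs_le_between in A1. apply Rabs_le_between in A2. lra. }
apply manifold_graph; try lra.
- intros nu Hnu. split; [apply nu_admissible | apply checked_bounded]; exact Hnu.
- intros nu w Hnu Hww. split.
  + destruct (checked_domain nu w Hnu Hww) as [_ A]. apply Rabs_le_between in A. lra.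
  + destruct (checked_enclosure inu w1 w2 nu w Hnu (nu_in nu Hnu) (Z.le_refl _) (Z.le_refl _) Hww)
      as [_ [_ [A _]]].
    apply (ilt_sound _ _ _ _ (contains_ipt _) A) in K2.
    unfold dy in K2. unfold Rdiv in K2. rewrite Rmult_0_l in K2. exact K2.
- intros nu Hnu. split.
  + apply (ilt_sound _ _ _ _ (checked_y inu w1 nu Hnu (nu_in nu Hnu) ltac:(lia) ltac:(lia))
      (contains_ipt _) K3).
  + apply (ilt_sound _ _ _ _ (contains_ipt _)
      (checked_y inu w2 nu Hnu (nu_in nu Hnu) ltac:(lia) ltac:(lia)) K4).
Qed.

Lemma dy_y_order : dy c_y1 < dy c_ya /\ dy c_ya < dy c_yc /\ dy c_yc < dy c_yb /\ dy c_yb < dy c_y2.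
Proof. repeat split; apply dy_lt; reflexivity. Qed.

Lemma checked_box nu y : i1 < nu < i2 -> dy c_y1 < y < dy c_y2 ->
  let d := enclose (tables inu ib (iint kap)) inu ib (Some (w1, w2)) in
  contains (enc_slope d) (slope beta k nu (zinv nu y)) /\
  contains (enc_bend d) (bend beta k nu (zinv nu y)) /\
  contains (enc_drift d) (drift beta k nu (zinv nu y)).
Proof.
intros Hnu Hy. destruct checked_manifold as [_ [S _]].
destruct (S nu y Hnu Hy) as [Hz _].
destruct (checked_enclosure inu w1 w2 nu (zinv nu y) Hnu (nu_in nu Hnu) (Z.le_refl _) (Z.le_refl _)
  ltac:(simpl; lra)) as [_ [_ [_ [A1 [A2 A3]]]]].
split; [exact A1|]. split; [exact A2|exact A3].
Qed.

Lemma checked_slope_ya nu : i1 < nu < i2 ->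
  contains (enc_slope (enclose (tables inu ib (iint kap)) inu ib (Some (wa1, wa2))))
    (slope beta k nu (zinv nu (dy c_ya))).
Proof.
intros Hnu. pose proof check as H. unfold manifold_check in H. split_checks H.
apply Z.ltb_lt in K5, K6, K7, K8, K9, K10. pose proof dy_y_order.
destruct checked_manifold as [_ [_ S]].
assert (A : dy wa1 < zinv nu (dy c_ya) < dy wa2).
2:{ destruct (checked_enclosure inu wa1 wa2 nu (zinv nu (dy c_ya)) Hnu (nu_in nu Hnu) ltac:(lia) ltac:(lia)
      ltac:(simpl; lra)) as [_ [_ [_ [B _]]]]. exact B. }
apply S; auto; try lra; try (split; apply dy_lt; lia). split.
- apply (ilt_sound _ _ _ _ (checked_y inu wa1 nu Hnu (nu_in nu Hnu) ltac:(lia) ltac:(lia))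
      (contains_ipt _)). assumption.
- apply (ilt_sound _ _ _ _ (contains_ipt _)
      (checked_y inu wa2 nu Hnu (nu_in nu Hnu) ltac:(lia) ltac:(lia))). assumption.
Qed.

Lemma checked_slope_yb nu : i1 < nu < i2 ->
  contains (enc_slope (enclose (tables inu ib (iint kap)) inu ib (Some (wb1, wb2))))
    (slope beta k nu (zinv nu (dy c_yb))).
Proof.
intros Hnu. pose proof check as H. unfold manifold_check in H. split_checks H.
apply Z.ltb_lt in K5, K6, K7, K8, K9, K10. pose proof dy_y_order.
destruct checked_manifold as [_ [_ S]].
assert (A : dy wb1 < zinv nu (dy c_yb) < dy wb2).
2:{ destruct (checked_enclosure inu wb1 wb2 nu (zinv nu (dy c_yb)) Hnu (nu_in nu Hnu) ltac:(lia) ltac:(lia)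
      ltac:(simpl; lra)) as [_ [_ [_ [B _]]]]. exact B. }
apply S; auto; try lra; try (split; apply dy_lt; lia). split.
- apply (ilt_sound _ _ _ _ (checked_y inu wb1 nu Hnu (nu_in nu Hnu) ltac:(lia) ltac:(lia))
      (contains_ipt _)). assumption.
- apply (ilt_sound _ _ _ _ (contains_ipt _)
      (checked_y inu wb2 nu Hnu (nu_in nu Hnu) ltac:(lia) ltac:(lia))). assumption.
Qed.

Lemma checked_thin inu' wc1 wc2 nu : i1 < nu < i2 -> contains inu' nu ->
  thin_check (tables inu' ib (iint kap)) inu' w1 w2 wc1 wc2 = true ->
  contains (enc_x (enclose (tables inu' ib (iint kap)) inu' ib (Some (wc1, wc2))))
    (X beta k nu (nu * zinv nu (dy c_yc))).
Proof.
intros Hnu Hi H. unfold thin_check in H. split_checks H.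
apply Z.ltb_lt in K, K0, K1. pose proof dy_y_order.
destruct checked_manifold as [_ [_ S]].
assert (A : dy wc1 < zinv nu (dy c_yc) < dy wc2).
2:{ destruct (checked_enclosure inu' wc1 wc2 nu (zinv nu (dy c_yc)) Hnu Hi ltac:(lia) ltac:(lia)
      ltac:(simpl; lra)) as [_ [B _]]. exact B. }
apply S; auto; try lra; try (split; apply dy_lt; lia). split.
- apply (ilt_sound _ _ _ _ (checked_y inu' wc1 nu Hnu Hi ltac:(lia) ltac:(lia))
      (contains_ipt _)). assumption.
- apply (ilt_sound _ _ _ _ (contains_ipt _)
      (checked_y inu' wc2 nu Hnu Hi ltac:(lia) ltac:(lia))). assumption.
Qed.

End ManifoldCheck.

(** The larger root of [nu^2 + 2 x nu - b = 0], the characteristic equation of the Hénon map at its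
    fixed point, hence the unstable multiplier as a function of a. *)
Definition multiplier (b a : R) : R := - fix_x a b + sqrt (fix_x a b ^ 2 + b).

(** The fixed point is symmetric in the two multipliers, and with it the parameter a. The unstable
    manifold for [nu] and the stable one for [beta / nu] therefore belong to the same map and the
    same point. *)
Lemma fixp_dual beta nu : admissible beta nu -> fixp beta (beta * / nu) = fixp beta nu.
Proof.
intros Ha. destruct (admissible_pos _ _ Ha) as [Hn _]. destruct Ha as [Hb _].
unfold fixp. field. lra.
Qed.

Lemma multiplier_param beta nu : admissible beta nu -> 3 <= nu ->
  multiplier (- beta) (param beta nu) = nu.
Proof.
intros Ha H3. destruct (admissible_pos _ _ Ha) as [Hn _].
unfold multiplier. rewrite fix_x_param by exact Ha.
assert (/ nu <= / 3) by (apply Rinv_le_contravar; lra).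
assert (0 < / nu) by (apply Rinv_0_lt_compat; lra).
destruct Ha as [Hb _].
replace (fixp beta nu ^ 2 + - beta) with (((nu - beta * / nu) / 2)²)
  by (unfold fixp, Rsqr; field; lra).
rewrite sqrt_Rsqr by nra. unfold fixp. field. lra.
Qed.

Lemma fix_x_upper b a : 1 < a -> -31/100 <= b <= -29/100 -> fix_x a b < - 3/2.
Proof.
intros Ha Hb. unfold fix_x.
assert (2 < sqrt ((b - 1) ^ 2 + 4 * a)).
{ rewrite <- (sqrt_Rsqr 2) by lra. apply sqrt_lt_1; unfold Rsqr; nra. }
lra.
Qed.

Lemma multiplier_pos b a : 1 < a -> -31/100 <= b <= -29/100 -> 0 < multiplier b a.
Proof.
intros Ha Hb. pose proof (fix_x_upper b a Ha Hb). unfold multiplier.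
pose proof (sqrt_pos (fix_x a b ^ 2 + b)). lra.
Qed.

Lemma fixp_multiplier b a : 1 < a -> -31/100 <= b <= -29/100 ->
  fixp (- b) (multiplier b a) = fix_x a b.
Proof.
intros Ha Hb. pose proof (fix_x_upper b a Ha Hb) as Hf.
pose proof (multiplier_pos b a Ha Hb) as Hm.
assert (S : sqrt (fix_x a b ^ 2 + b) * sqrt (fix_x a b ^ 2 + b) = fix_x a b ^ 2 + b)
  by (apply sqrt_sqrt; nra).
unfold fixp. apply (Rmult_eq_reg_r (2 * multiplier b a)); [|lra].
replace (- (multiplier b a + - b * / multiplier b a) / 2 * (2 * multiplier b a)) with
  (- (multiplier b a * multiplier b a - b)) by (field; lra).
unfold multiplier in *. nra.
Qed.

Lemma param_multiplier b a : 1 < a -> -31/100 <= b <= -29/100 ->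
  param (- b) (multiplier b a) = a.
Proof.
intros Ha Hb. unfold param. rewrite fixp_multiplier by auto.
assert (S : sqrt ((b - 1) ^ 2 + 4 * a) * sqrt ((b - 1) ^ 2 + 4 * a) = (b - 1) ^ 2 + 4 * a)
  by (apply sqrt_sqrt; nra).
unfold fix_x. nra.
Qed.

(** The fixed point decreases with a, and the multiplier decreases with the fixed point. The
    positive sign makes unfolding in lambda the same as unfolding in a. *)
Lemma multiplier_derive b a : 1 < a -> -31/100 <= b <= -29/100 ->
  exists l, is_derive (multiplier b) a l /\ 0 < l.
Proof.
intros Ha Hb. pose proof (fix_x_upper b a Ha Hb) as Hf.
set (D := (b - 1) ^ 2 + 4 * a). assert (HD : 0 < D) by (unfold D; nra).
assert (SD : 0 < sqrt D) by (apply sqrt_lt_R0, HD).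
assert (F : is_derive (fun a => fix_x a b) a (- / sqrt D)).
{ unfold fix_x. auto_derive. exact HD.
  change ((b - 1) * ((b - 1) * 1) + 4 * a) with D. field. lra. }
set (x := fix_x a b) in *.
assert (HQ : 0 < x ^ 2 + b) by nra.
assert (SQ : 0 < sqrt (x ^ 2 + b)) by (apply sqrt_lt_R0, HQ).
assert (M : is_derive (fun x => - x + sqrt (x ^ 2 + b)) x (- 1 + x / sqrt (x ^ 2 + b))).
{ auto_derive. exact HQ. change (x * (x * 1) + b) with (x ^ 2 + b). field. lra. }
exists (- / sqrt D * (- 1 + x / sqrt (x ^ 2 + b))). split.
- exact (is_derive_comp (fun x => - x + sqrt (x ^ 2 + b)) (fun a => fix_x a b) a _ _ M F).
- assert (0 < / sqrt D) by (apply Rinv_0_lt_compat, SD).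
  assert (x / sqrt (x ^ 2 + b) < 0).
  { unfold Rdiv. assert (0 < / sqrt (x ^ 2 + b)) by (apply Rinv_0_lt_compat, SQ). nra. }
  nra.
Qed.

Lemma admissible_u b nu : dy c_b1 < - b < dy c_b2 -> dy c_L1 < nu < dy c_L2 ->
  admissible (- b) nu.
Proof.
unfold dy, c_b1, c_b2, c_L1, c_L2, scale. intros. unfold admissible. lra.
Qed.

Lemma admissible_s b nu : dy c_b1 < - b < dy c_b2 -> dy c_M1 < nu < dy c_M2 ->
  admissible (- b) nu.
Proof.
unfold dy, c_b1, c_b2, c_M1, c_M2, scale. intros. unfold admissible. lra.
Qed.

(** * The tangency *)

Lemma contains_sub i j x y : contains i x -> contains j y -> contains (isub i j) (x - y).
Proof. intros Hi Hj. apply contains_add; auto. apply contains_opp, Hj. Qed.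

Lemma contains_param inu nu beta : contains inu nu -> contains ib beta ->
  contains (iparam inu) (param beta nu).
Proof.
intros Hn Hb.
assert (Hh := contains_half).
assert (F : contains (imul (iopp (root_sum itv Iarith inu ib)) half) (fixp beta nu)).
{ unfold fixp, Rdiv. apply contains_mul; auto. apply contains_opp, contains_root_sum; auto. }
unfold param. replace (fixp beta nu ^ 2) with (fixp beta nu * fixp beta nu) by ring.
apply contains_add. apply contains_add; auto. apply contains_mul; auto. apply contains_mul; auto.
Qed.

Section Tangency.

Variable b : R.
Hypothesis b_in : dy c_b1 < - b < dy c_b2.

Let beta := - b.
Let zu := fiber_inverse (X beta (IZR ku)) (dy c_wu1) (dy c_wu2).
Let zs := fiber_inverse (X beta (IZR ks)) (dy c_ws1) (dy c_ws2).
Let hu nu y := X beta (IZR ku) nu (nu * zu nu y).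
Let hs nu y := X beta (IZR ks) nu (nu * zs nu y).
Let dual nu := beta * / nu.

Lemma beta_in : contains ib beta.
Proof. unfold beta. simpl. lra. Qed.

Lemma b_range : -31/100 <= b <= -29/100.
Proof. pose proof b_in. unfold dy, c_b1, c_b2, scale in *. lra. Qed.

Lemma nu_u_in nu : dy c_L1 < nu < dy c_L2 -> contains nu_u nu.
Proof. intros. simpl. lra. Qed.

Lemma nu_s_in nu : dy c_M1 < nu < dy c_M2 -> contains nu_s nu.
Proof. intros. simpl. lra. Qed.

Definition checked_u := checked_manifold nu_u ku c_wu1 c_wu2 c_wua1 c_wua2 c_wub1 c_wub2
  (dy c_L1) (dy c_L2) beta beta_in nu_u_in (fun nu => admissible_u b nu b_in) u_check.
Definition checked_s := checked_manifold nu_s ks c_ws1 c_ws2 c_wsa1 c_wsa2 c_wsb1 c_wsb2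
  (dy c_M1) (dy c_M2) beta beta_in nu_s_in (fun nu => admissible_s b nu b_in) s_check.

Lemma bounded_u nu : dy c_L1 < nu < dy c_L2 -> bounded_coefs beta (IZR ku) nu.
Proof.
exact (checked_bounded nu_u ku c_wu1 c_wu2 c_wua1 c_wua2 c_wub1 c_wub2
  (dy c_L1) (dy c_L2) beta beta_in nu_u_in (fun nu => admissible_u b nu b_in) u_check nu).
Qed.

Lemma bounded_s nu : dy c_M1 < nu < dy c_M2 -> bounded_coefs beta (IZR ks) nu.
Proof.
exact (checked_bounded nu_s ks c_ws1 c_ws2 c_wsa1 c_wsa2 c_wsb1 c_wsb2
  (dy c_M1) (dy c_M2) beta beta_in nu_s_in (fun nu => admissible_s b nu b_in) s_check nu).
Qed.

Lemma nu_u_range nu : dy c_L1 < nu < dy c_L2 -> 3 <= nu <= 4.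
Proof. unfold dy, c_L1, c_L2, scale. lra. Qed.

Lemma dual_range nu : dy c_L1 < nu < dy c_L2 -> dy c_M1 < dual nu < dy c_M2.
Proof.
intros Hnu. pose proof tangency_check as H. cbn zeta in H. split_checks H.
assert (A := contains_mul _ _ _ _ beta_in (contains_inv _ _ (nu_u_in nu Hnu))).
split; [eapply ilt_sound; [apply contains_ipt | exact A | assumption]
       |eapply ilt_sound; [exact A | apply contains_ipt | assumption]].
Qed.

Lemma dual_derive nu : 0 < nu -> is_derive dual nu (- (beta * (/ nu * / nu))).
Proof. intros Hn. unfold dual. auto_derive. lra. field. lra. Qed.

Lemma w_bounds : -4 < dy c_wu1 /\ dy c_wu2 < 4 /\ -4 < dy c_ws1 /\ dy c_ws2 < 4.
Proof. unfold dy, c_wu1, c_wu2, c_ws1, c_ws2, scale. lra. Qed.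

(** The splitting as a function of the unstable multiplier alone, the stable one being tied to it by
    [dual]. *)
Let g l y := hu l y - hs (dual l) y.
Let g1 l y := drift beta (IZR ku) l (zu l y) -
  drift beta (IZR ks) (dual l) (zs (dual l) y) * - (beta * (/ l * / l)).
Let g2 l y := slope beta (IZR ku) l (zu l y) - slope beta (IZR ks) (dual l) (zs (dual l) y).
Let g22 l y := bend beta (IZR ku) l (zu l y) - bend beta (IZR ks) (dual l) (zs (dual l) y).

Lemma g_C2 : fiberwise_C2 (dy c_L1) (dy c_L2) (dy c_y1) (dy c_y2) g g1 g2 g22.
Proof.
apply (fiberwise_C2_minus _ _ _ _ _ _ _ _ _ _ _ _ (proj1 checked_u)).
apply (fiberwise_C2_reparam _ _ (dy c_L1) (dy c_L2) _ _ _ _ _ _ dual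
  (fun l => - (beta * (/ l * / l))) (proj1 checked_s)).
intros l Hl. split. apply dual_range, Hl. apply dual_derive. pose proof (nu_u_range l Hl). lra.
Qed.

Lemma g_box l y : dy c_L1 < l < dy c_L2 -> dy c_y1 < y < dy c_y2 ->
  g22 l y < 0 /\ Rabs (g2 l y) <= dy c_G /\ 0 < g1 l y.
Proof.
intros Hl Hy.
pose proof (checked_box nu_u ku c_wu1 c_wu2 c_wua1 c_wua2 c_wub1 c_wub2
  (dy c_L1) (dy c_L2) beta beta_in nu_u_in (fun nu => admissible_u b nu b_in) u_check l y Hl Hy) as U.
pose proof (checked_box nu_s ks c_ws1 c_ws2 c_wsa1 c_wsa2 c_wsb1 c_wsb2
  (dy c_M1) (dy c_M2) beta beta_in nu_s_in (fun nu => admissible_s b nu b_in) s_check (dual l) y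
  (dual_range l Hl) Hy) as S.
cbn zeta in U, S. destruct U as [U1 [U2 U3]]. destruct S as [S1 [S2 S3]].
fold zu in U1, U2, U3. fold zs in S1, S2, S3.
pose proof tangency_check as H. cbn zeta in H. split_checks H.
split; [|split].
- pose proof (ilt_sound _ _ _ _ U2 S2 K) as Q. unfold g22. lra.
- assert (A := contains_sub _ _ _ _ U1 S1).
  pose proof (ilt_sound _ _ _ _ A (contains_ipt _) K0) as Q1.
  pose proof (ilt_sound _ _ _ _ (contains_ipt _) A K1) as Q2.
  apply Rabs_le_between. unfold g2.
  assert (E : dy (- c_G) = - dy c_G) by (unfold dy; rewrite opp_IZR; unfold Rdiv; ring). lra.
- assert (I1 := contains_inv _ _ (nu_u_in l Hl)).
  assert (A := contains_add _ _ _ _ U3 (contains_mul _ _ _ _ S3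
     (contains_mul _ _ _ _ beta_in (contains_mul _ _ _ _ I1 I1)))).
  pose proof (ilt_sound _ _ _ _ (contains_ipt _) A K6) as Q.
  unfold g1. assert (E : dy 0 = 0) by (unfold dy, Rdiv; ring). rewrite E in Q. lra.
Qed.

Lemma g2_ya l : dy c_L1 < l < dy c_L2 -> 0 < g2 l (dy c_ya).
Proof.
intros Hl.
pose proof (checked_slope_ya nu_u ku c_wu1 c_wu2 c_wua1 c_wua2 c_wub1 c_wub2
  (dy c_L1) (dy c_L2) beta beta_in nu_u_in (fun nu => admissible_u b nu b_in) u_check l Hl) as U.
pose proof (checked_slope_ya nu_s ks c_ws1 c_ws2 c_wsa1 c_wsa2 c_wsb1 c_wsb2
  (dy c_M1) (dy c_M2) beta beta_in nu_s_in (fun nu => admissible_s b nu b_in) s_check (dual l)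
  (dual_range l Hl)) as S.
fold zu in U. fold zs in S.
pose proof tangency_check as H. cbn zeta in H. split_checks H.
pose proof (ilt_sound _ _ _ _ S U K2) as Q. unfold g2. lra.
Qed.

Lemma g2_yb l : dy c_L1 < l < dy c_L2 -> g2 l (dy c_yb) < 0.
Proof.
intros Hl.
pose proof (checked_slope_yb nu_u ku c_wu1 c_wu2 c_wua1 c_wua2 c_wub1 c_wub2
  (dy c_L1) (dy c_L2) beta beta_in nu_u_in (fun nu => admissible_u b nu b_in) u_check l Hl) as U.
pose proof (checked_slope_yb nu_s ks c_ws1 c_ws2 c_wsa1 c_wsa2 c_wsb1 c_wsb2
  (dy c_M1) (dy c_M2) beta beta_in nu_s_in (fun nu => admissible_s b nu b_in) s_check (dual l)
  (dual_range l Hl)) as S.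
fold zu in U. fold zs in S.
pose proof tangency_check as H. cbn zeta in H. split_checks H.
pose proof (ilt_sound _ _ _ _ U S K3) as Q. unfold g2. lra.
Qed.

Lemma L_order : dy c_L1 < dy c_la /\ dy c_la < dy c_lb /\ dy c_lb < dy c_L2.
Proof. repeat split; apply dy_lt; reflexivity. Qed.

Lemma contains_thin l i wu wu' ws ws' : dy c_L1 < l < dy c_L2 -> contains i l ->
  thin_check (tables i ib (iint ku)) i c_wu1 c_wu2 wu wu' = true ->
  thin_check (tables (imul ib (iinv i)) ib (iint ks)) (imul ib (iinv i)) c_ws1 c_ws2 ws ws' = true ->
  contains (isub (enc_x (enc_u i wu wu')) (enc_x (enc_s (imul ib (iinv i)) ws ws')))
    (g l (dy c_yc)).
Proof.
intros Hl Hi Hu Hs. apply contains_sub.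
- exact (checked_thin nu_u ku c_wu1 c_wu2 c_wua1 c_wua2 c_wub1 c_wub2
  (dy c_L1) (dy c_L2) beta beta_in nu_u_in (fun nu => admissible_u b nu b_in) u_check
   i wu wu' l Hl Hi Hu).
- exact (checked_thin nu_s ks c_ws1 c_ws2 c_wsa1 c_wsa2 c_wsb1 c_wsb2
  (dy c_M1) (dy c_M2) beta beta_in nu_s_in (fun nu => admissible_s b nu b_in) s_check
   (imul ib (iinv i)) ws ws' (dual l) (dual_range l Hl)
   (contains_mul _ _ _ _ beta_in (contains_inv _ _ Hi)) Hs).
Qed.

Lemma dy_sub x y : dy (x - y) = dy x - dy y.
Proof. unfold dy. rewrite minus_IZR. unfold Rdiv. ring. Qed.

Lemma g_la : g (dy c_la) (dy c_yc) + dy c_G * (dy c_yb - dy c_ya) < 0.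
Proof.
pose proof L_order.
pose proof (contains_thin (dy c_la) nu_uc c_wuc1 c_wuc2 c_wsc1 c_wsc2 ltac:(lra) (contains_ipt _)
  uc_check sc_check) as A.
pose proof tangency_check as T. cbn zeta in T. split_checks T.
rewrite <- dy_sub.
pose proof (ilt_sound _ _ _ _ (contains_add _ _ _ _ A
  (contains_mul _ _ _ _ (contains_ipt c_G) (contains_ipt (c_yb - c_ya)))) (contains_ipt _) K4) as Q.
assert (E : dy 0 = 0) by (unfold dy, Rdiv; ring). rewrite E in Q. exact Q.
Qed.

Lemma g_lb : 0 < g (dy c_lb) (dy c_yc) - dy c_G * (dy c_yb - dy c_ya).
Proof.
pose proof L_order.
pose proof (contains_thin (dy c_lb) nu_ud c_wud1 c_wud2 c_wsd1 c_wsd2 ltac:(lra) (contains_ipt _)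
  ud_check sd_check) as A.
pose proof tangency_check as T. cbn zeta in T. split_checks T.
rewrite <- dy_sub.
pose proof (ilt_sound _ _ _ _
  (contains_mul _ _ _ _ (contains_ipt c_G) (contains_ipt (c_yb - c_ya))) A K5) as Q. lra.
Qed.

Lemma tangency_multiplier :
  exists l y, dy c_L1 < l < dy c_L2 /\ dy c_y1 < y < dy c_y2 /\ g l y = 0 /\ g2 l y = 0.
Proof.
destruct L_order as [O1 [O2 O3]]. destruct dy_y_order as [P1 [P2 [P3 P4]]].
destruct (fold_tangency_exists (dy c_L1) (dy c_L2) (dy c_y1) (dy c_y2) (dy c_la) (dy c_lb)
  (dy c_ya) (dy c_yb) (dy c_yc) (dy c_G) g g1 g2 g22) as [l [y [Hl [Hy [E1 E2]]]]];
  try lra.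
- exact g_C2.
- intros l y Hl Hy. apply g_box; auto.
- intros l y Hl Hy. apply g_box; auto.
- exact g2_ya.
- exact g2_yb.
- exact g_la.
- exact g_lb.
- exists l, y. repeat split; auto; lra.
Qed.

Lemma unstable_graph_contracts nu : dy c_L1 < nu < dy c_L2 -> forall eta, 0 < eta ->
  exists N, forall n, (N <= n)%nat -> forall y, dy c_y1 < y < dy c_y2 ->
    dist2 (Nat.iter n (henon_inv (param beta nu) b) (hu nu y, y)) (fixp beta nu, fixp beta nu)
      < eta.
Proof.
intros Hnu eta Heta. pose proof (nu_u_range nu Hnu) as R.
assert (Ad := admissible_u b nu b_in Hnu). fold beta in Ad.
assert (Bd := bounded_u nu Hnu).
assert (Hi : 0 <= / nu < 1).
{ split. left; apply Rinv_0_lt_compat; lra. rewrite <- Rinv_1. apply Rinv_lt_contravar; lra. }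
destruct (curve_contraction beta (IZR ku) nu (/ nu) eta Ad Bd Hi Heta) as [N HN].
exists N. intros n Hn y Hy.
destruct checked_u as [_ [S _]]. destruct (S nu y Hnu Hy) as [Hz Ez]. fold zu in Hz, Ez.
pose proof w_bounds.
assert (Hz4 : Rabs (zu nu y) < 4) by (apply Rabs_lt_between; lra).
replace (hu nu y, y) with (curve beta (IZR ku) nu (zu nu y))
  by (unfold curve, hu; f_equal; exact Ez).
rewrite (iter_scaled_curve _ beta (IZR ku) nu (/ nu) 4); auto; try lra.
intros w Hw. replace b with (- beta) by (unfold beta; ring).
apply henon_inv_curve; auto; lra.
Qed.

Lemma stable_graph_contracts nu : dy c_M1 < nu < dy c_M2 -> forall eta, 0 < eta ->
  exists N, forall n, (N <= n)%nat -> forall y, dy c_y1 < y < dy c_y2 ->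
    dist2 (Nat.iter n (henon (param beta nu) b) (hs nu y, y)) (fixp beta nu, fixp beta nu)
      < eta.
Proof.
intros Hnu eta Heta.
assert (R : 0 <= nu < 1) by (unfold dy, c_M1, c_M2, scale in Hnu; lra).
assert (Ad := admissible_s b nu b_in Hnu). fold beta in Ad.
assert (Bd := bounded_s nu Hnu).
destruct (curve_contraction beta (IZR ks) nu nu eta Ad Bd R Heta) as [N HN].
exists N. intros n Hn y Hy.
destruct checked_s as [_ [S _]]. destruct (S nu y Hnu Hy) as [Hz Ez]. fold zs in Hz, Ez.
pose proof w_bounds.
assert (Hz4 : Rabs (zs nu y) < 4) by (apply Rabs_lt_between; lra).
replace (hs nu y, y) with (curve beta (IZR ks) nu (zs nu y))
  by (unfold curve, hs; f_equal; exact Ez).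
rewrite (iter_scaled_curve _ beta (IZR ks) nu nu 4); auto; try lra.
intros w Hw. replace b with (- beta) by (unfold beta; ring).
apply henon_curve; auto; lra.
Qed.

Lemma tangency_near_a0 :
  exists a, a_0 - / 100000 <= a <= a_0 + / 100000 /\ quadratic_tangency_generic_unfolding a b.
Proof.
destruct tangency_multiplier as [l [y [Hl [Hy [E1 E2]]]]].
assert (Rb := b_range). assert (Rl := nu_u_range l Hl).
assert (Ad := admissible_u b l b_in Hl). fold beta in Ad.
set (a := param beta l).
assert (Ma : multiplier b a = l).
{ unfold a. replace b with (- beta) by (unfold beta; ring). apply multiplier_param; auto; lra. }
assert (Ra : dy c_A1 < a < dy c_A2).
{ assert (A := contains_param _ _ _ (nu_u_in l Hl) beta_in). fold a in A.
  pose proof tangency_check as H. cbn zeta in H. split_checks H.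
  split; [eapply ilt_sound; [apply contains_ipt | exact A | assumption]
         |eapply ilt_sound; [exact A | apply contains_ipt | assumption]]. }
assert (Ra' : a_0 - / 100000 <= a <= a_0 + / 100000 /\ 1.1 < a).
{ unfold a_0. unfold dy, c_A1, c_A2, scale in Ra. lra. }
exists a. split. apply Ra'.
destruct (multiplier_derive b a ltac:(lra) Rb) as [da [Da Pa]].
(* Continuity of the multiplier keeps it in the verified range. As [a > 1.1], radius below 1/10 also
   keeps [a' > 1], where the multiplier formulas are available. *)
assert (Near : exists r, 0 < r /\ r < 1/10 /\ forall a', a - r < a' < a + r ->
  dy c_L1 < multiplier b a' < dy c_L2).
{ destruct (is_derive_continuity_pt _ _ _ Da (Rmin (l - dy c_L1) (dy c_L2 - l))) as [r [Hr Hc]].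
  apply Rmin_pos; lra.
  exists (Rmin (r / 2) (1/20)). split. apply Rmin_pos; lra.
  pose proof (Rmin_l (r / 2) (1/20)). pose proof (Rmin_r (r / 2) (1/20)).
  split. lra. intros a' Ha'.
  pose proof (Rmin_l (l - dy c_L1) (dy c_L2 - l)). pose proof (Rmin_r (l - dy c_L1) (dy c_L2 - l)).
  destruct (Req_dec a' a) as [->|Hne]. lra.
  specialize (Hc a'). simpl in Hc. unfold Rdist in Hc. rewrite Ma in Hc.
  assert (Q : Rabs (multiplier b a' - l) < Rmin (l - dy c_L1) (dy c_L2 - l)).
  { apply Hc. split. split; [exact I | auto]. apply Rabs_lt_between. lra. }
  apply Rabs_lt_between in Q. lra. }
destruct Near as [r [Hr0 [Hr1 Near]]].
(* [multiplier_derive] provides the derivative only existentially; [Derive] turns it into a function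
   of a. *)
set (dm := Derive (multiplier b)).
assert (Dm : forall a', a - r < a' < a + r -> is_derive (multiplier b) a' (dm a')).
{ intros a' Ha'. destruct (multiplier_derive b a' ltac:(lra) Rb) as [l' [D' _]].
  apply Derive_correct. eexists; exact D'. }
assert (Dma : 0 < dm a) by (unfold dm; rewrite (is_derive_unique _ _ _ Da); exact Pa).
assert (Hu : fiberwise_C2 (a - r) (a + r) (dy c_y1) (dy c_y2) (fun a y => hu (multiplier b a) y)
  (fun a y => drift beta (IZR ku) (multiplier b a) (zu (multiplier b a) y) * dm a)
  (fun a y => slope beta (IZR ku) (multiplier b a) (zu (multiplier b a) y))
  (fun a y => bend beta (IZR ku) (multiplier b a) (zu (multiplier b a) y))).
{ apply (fiberwise_C2_reparam _ _ (a - r) (a + r) _ _ _ _ _ _ (multiplier b) dm (proj1 checked_u)).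
  intros a' Ha'. split; [apply Near | apply Dm]; exact Ha'. }
assert (Hs : fiberwise_C2 (a - r) (a + r) (dy c_y1) (dy c_y2)
  (fun a y => hs (dual (multiplier b a)) y)
  (fun a y => drift beta (IZR ks) (dual (multiplier b a)) (zs (dual (multiplier b a)) y) *
     (dm a * - (beta * (/ multiplier b a * / multiplier b a))))
  (fun a y => slope beta (IZR ks) (dual (multiplier b a)) (zs (dual (multiplier b a)) y))
  (fun a y => bend beta (IZR ks) (dual (multiplier b a)) (zs (dual (multiplier b a)) y))).
{ apply (fiberwise_C2_reparam _ _ (a - r) (a + r) _ _ _ _ _ _ (fun a => dual (multiplier b a))
    (fun a => dm a * - (beta * (/ multiplier b a * / multiplier b a))) (proj1 checked_s)).
  intros a' Ha'. split. apply dual_range, Near, Ha'.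
  apply (is_derive_comp dual (multiplier b)). apply dual_derive.
  pose proof (nu_u_range _ (Near a' Ha')). lra. apply Dm, Ha'. }
assert (Pf : forall a', a - r < a' < a + r ->
  a' = param beta (multiplier b a') /\
  pfix a' b = (fixp beta (multiplier b a'), fixp beta (multiplier b a'))).
{ intros a' Ha'. unfold beta. rewrite param_multiplier, fixp_multiplier by lra. split; auto. }
destruct (g_box l y Hl Hy) as [N1 [_ N2]].
apply (quadratic_tangency_of_graphs b a y (a - r) (a + r) (dy c_y1) (dy c_y2)
  _ _ _ _ _ _ _ _ Hu Hs).
- lra.
- exact Hy.
(* The tangency point is not the fixed point: its second coordinate exceeds -1, while the fixed
   point lies below -3/2. *)
- pose proof (fix_x_upper b a ltac:(lra) Rb).
  assert (-1 < dy c_y1) by (unfold dy, c_y1, scale; lra). lra.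
- intros a' Ha' eta Heta. destruct (Pf a' Ha') as [Ep ->].
  assert (Ad' := admissible_u b _ b_in (Near a' Ha')). fold beta in Ad'.
  destruct (stable_graph_contracts (dual (multiplier b a')) (dual_range _ (Near a' Ha')) eta Heta)
    as [N HN].
  exists N. intros n Hn v Hv. specialize (HN n Hn v Hv).
  assert (Efix : fixp beta (dual (multiplier b a')) = fixp beta (multiplier b a'))
    by (apply fixp_dual, Ad').
  (* [param] depends on the multiplier only through [fixp], so the symmetry of [fixp] replaces the
     stable multiplier by the unstable one here. *)
  unfold param in HN. rewrite Efix in HN.
  change (fixp beta (multiplier b a') + fixp beta (multiplier b a') ^ 2 +
    beta * fixp beta (multiplier b a')) with (param beta (multiplier b a')) in HN.
  rewrite <- Ep in HN. exact HN.
- intros a' Ha' eta Heta. destruct (Pf a' Ha') as [Ep ->].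
  destruct (unstable_graph_contracts (multiplier b a') (Near a' Ha') eta Heta) as [N HN].
  exists N. intros n Hn v Hv. specialize (HN n Hn v Hv).
  rewrite <- Ep in HN. exact HN.
- rewrite Ma. unfold g in E1. lra.
- rewrite Ma. unfold g2 in E2. lra.
- rewrite Ma. unfold g22 in N1. lra.
(* By the chain rule the difference of the speeds in a is [dm a] times [g1], a product of two
   positive numbers. *)
- rewrite Ma. unfold g1 in N2. intros K.
  assert (0 < dm a * (drift beta (IZR ku) l (zu l y) -
     drift beta (IZR ks) (dual l) (zs (dual l) y) * - (beta * (/ l * / l))))
    by (apply Rmult_lt_0_compat; assumption). lra.
Qed.

End Tangency.

Theorem mainTheorem1 :
  exists B : R -> Prop, open_set B /\ B (-3/10) /\
    forall b, B b ->
      exists a, a_0 - / 100000 <= a <= a_0 + / 100000 /\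
        quadratic_tangency_generic_unfolding a b.
Proof.
(* The open interval of radius about 1e-16 around -3/10 on which the checks were run. *)
exists (fun b => dy c_b1 < - b < dy c_b2). split; [|split].
- intros b Hb.
  assert (Hd : 0 < Rmin (- b - dy c_b1) (dy c_b2 + b)) by (apply Rmin_pos; lra).
  exists (mkposreal _ Hd). intros x Hx. unfold disc in Hx. simpl in Hx.
  pose proof (Rmin_l (- b - dy c_b1) (dy c_b2 + b)).
  pose proof (Rmin_r (- b - dy c_b1) (dy c_b2 + b)).
  apply Rabs_lt_between in Hx. lra.
- unfold dy, c_b1, c_b2, scale. lra.
- exact tangency_near_a0.
Qed.
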